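(* For complex $z$, put $\sigma=1/\ln z$ and $\tau=\ln\ln z/\ln z$. The domain of convergence, in the complex $z$-plane, of the series $$\sum_{n=1}^\infty \sum_{m=1}^n (-1)^{n-m}\genfrac{[}{]}{0pt}{}{n}{n-m+1}\frac{\sigma^{n-m}\tau^{m}}{m!}$$ is defined by $$\operatorname{Re} W_k\left(-\frac{\ln z}{e}\right)>-1,$$ where the branch $W_k$ is chosen as follows: $k=-1$ if $-\pi<\arg z\le 0$, and $k=1$ if $0<\arg z\le\pi$.
   Context: $\ln$ denotes the principal branch of the natural logarithm, with $\arg z\in(-\pi,\pi]$. $\genfrac{[}{]}{0pt}{}{n}{k}$ is the (unsigned) Stirling cycle number: the number of permutations of $n$ elements with exactly $k$ cycles. The series is summed as an outer series over $n$ of the finite inner sums over $m$. ''Domain of convergence'' means the open region of the $z$-plane in which the series converges (the interior of the set of points of convergence). $W_k$, $k\in\mathbb{Z}$, are the standard branches (Corless et al.) of the Lambert $W$ function, the multivalued inverse of $w\mapsto we^w$: $W_k(z)\sim \ln z+2\pi i k$ for large $|z|$, the branch cuts lie on the negative real axis, and values on a cut are obtained by continuity from $\operatorname{Im} z\ge 0$. In particular, for real $x$ with $-1/e\le x<0$, $W_{-1}(x)$ is the real solution $w\le -1$ of $we^w=x$, and for $x<-1/e$ it is the solution with $-\pi<\operatorname{Im}w<0$; moreover $W_1(z)=\overline{W_{-1}(\bar z)}$ off the cut. *)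

(* Defs.v *)
From Stdlib Require Import Reals ZArith ClassicalEpsilon.
From mathcomp Require Import ssreflect ssrbool eqtype fintype finset perm.
From Coquelicot Require Import Coquelicot.

Open Scope R_scope.
Open Scope C_scope.

Definition Cexp (w : C) : C :=
  ((exp (Re w) * cos (Im w))%R, (exp (Re w) * sin (Im w))%R).

(* For z <> 0 this is the argument in (-PI, PI]: it equals PI on the negative
   real axis, where acos (-1) = PI.  Carg 0 has no meaning. *)
Definition Carg (z : C) : R :=
  if Rle_dec 0 (Im z) then acos (Re z / Cmod z)
  else (- acos (Re z / Cmod z))%R.

Definition Cln (z : C) : C := (ln (Cmod z), Carg z).

(* Fixed points count as cycles: [porbits s] partitions all of 'I_n. *)
Definition stirling_cycle (n k : nat) : nat :=
  #|[set s : 'S_n | #|porbits s| == k]|.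

(* The branches of Lambert W are numbered by their ranges, following Corless,
   Gonnet, Hare, Jeffrey and Knuth.  The ranges are separated by the curves
     C_j = { -y cot y + i y : 2 j PI < y < (2 j + 1) PI },   j = 0, 1, 2, ...,
   which separates the ranges of W_j and W_(j+1), by the complex conjugates
   of the C_j, which separate those of W_(-j) and W_(-j-1), and by the half-line
   (-oo, -1], which separates those of W_1 and W_(-1).  Since
   -y cot y -> +oo as y increases to (2 j + 1) PI, a point with
   Im w >= (2 j + 1) PI is above C_j whatever its real part. *)
Definition curve_abscissa (y : R) : R := (- y * (cos y / sin y))%R.

Definition above_curve (j : nat) (w : C) : Prop :=
  ((2 * INR j + 1) * PI <= Im w \/
   (2 * INR j * PI < Im w < (2 * INR j + 1) * PI /\
    Re w < curve_abscissa (Im w)))%R.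

(* Unlike [above_curve], this includes the curve itself and, for j = 0, the
   half-line (-oo, -1]: values on a branch cut are obtained by continuity from
   above (counter-clockwise closure), so a range contains its upper boundary. *)
Definition on_or_below_conj_curve (j : nat) (w : C) : Prop :=
  (Im w <= - ((2 * INR j + 1) * PI) \/
   (- ((2 * INR j + 1) * PI) < Im w < - (2 * INR j * PI) /\
    Re w <= curve_abscissa (Im w)) \/
   (j = 0%nat /\ Im w = 0 /\ Re w <= -1))%R.

(* The point -1 = W_0(-1/e) = W_(-1)(-1/e) lies in two ranges. *)
Definition lambertW_range (k : Z) (w : C) : Prop :=
  match k with
  | Z0 => (~ above_curve 0 w /\ ~ on_or_below_conj_curve 0 w) \/ w = RtoC (-1)
  | Zpos p => above_curve (Nat.pred (Pos.to_nat p)) w /\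
              ~ above_curve (Pos.to_nat p) w
  | Zneg p => on_or_below_conj_curve (Nat.pred (Pos.to_nat p)) w /\
              ~ on_or_below_conj_curve (Pos.to_nat p) w
  end.

(* Meaningful for z <> 0, and also for z = 0 when k = 0. *)
Definition lambertW (k : Z) (z : C) : C :=
  epsilon (inhabits (RtoC 0))
    (fun w : C => w * Cexp w = z /\ lambertW_range k w).

Definition sigma (z : C) : C := / Cln z.

Definition tau (z : C) : C := Cln (Cln z) / Cln z.

Definition inner_sum (z : C) (n : nat) : C :=
  sum_n_m
    (fun m : nat =>
       RtoC (-1) ^ (n - m) * RtoC (INR (stirling_cycle n (n - m + 1)))
       * (sigma z ^ (n - m) * tau z ^ m / RtoC (INR (fact m)))) 1 n.

(* sigma and tau are defined only when ln z exists and is nonzero, that is for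
   z different from 0 and 1; the totalised operations above return arbitrary
   values at these two points.  The outer index starts at n = 1. *)
Definition series_converges (z : C) : Prop :=
  z <> RtoC 0 /\ z <> RtoC 1 /\ ex_series (fun n : nat => inner_sum z (S n)).

Definition domain_of_convergence (z : C) : Prop := locally z series_converges.

(* Main.v *)
Require Import Defs.
From Stdlib Require Import Reals Ranalysis5 ZArith Arith Lra Lia Classical ClassicalEpsilon.
From Coquelicot Require Import Coquelicot.
From mathcomp Require ssreflect ssrfun ssrbool eqtype ssrnat seq choice fintype
  finset fingroup perm bigop.
Open Scope R_scope.
Open Scope C_scope.

(** Write L = ln z, x = ln L, R = |L| and b = |arg L| = |Im x|.  The n-th inner
    sum is a_n(x) s^n with s = 1/L and
    a_n(x) = sum over m of (-1)^(n-m) [n, n-m+1] x^m / m!,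
    so at a given z the series is a power series U(s) in s with x frozen.  It is
    the solution, vanishing at s = 0, of g(U) = s, where
    g(u) = (1 - e^(-u)) / (x - u).
    The question is whether 1/R is inside or outside the radius of convergence,
    and the answer is [conv_region]: the series converges near z if and only if
    b < R sin t - t for some t in (0, pi).  For R > 1 the best t is the angle phi
    with R cos phi = 1, and the condition reads b < tan phi - phi.

    Convergence: by Lagrange inversion n a_n(x) is the residue of g^(-n) at 0.
    This is proved without inverting anything: the contour integrals of
    u^j / (1 - e^(-u))^n obey the recurrence of the Stirling cycle numbers, since
    the derivative of a function has integral 0 along a closed contour
    ([contour_coef_rec], [stirling_cycle_contour], [stirling_poly_contour]).  On
    the rectangle with right side Re u = ln R and horizontal sides Im u = phi and
    Im u = - phi, its left side far away, |g| > 1/R holds exactly because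
    b < tan phi - phi ([contour_strict]); so the terms decay geometrically.

    Divergence: a recurrence in n for the derivatives of the a_n shows that U
    satisfies the differential equation of the inverse of g ([ode_coef_0]), hence
    g(U(s)) = s in the whole disc of convergence ([Vsum_equation]).  If the
    series converged at |s| = 1/R, the identity U(g(u)) = u could be continued
    from u = 0 along every path on which |g| < 1/R ([Usum_path]).  When
    b > tan phi - phi, or R < 1, such a path leads to Re u = + infinity, where g
    tends to 0: this contradicts U(0) = 0 ([no_escape],
    [stirling_series_diverges]).

    On the boundary b = tan phi - phi the series may converge, but replacing L by
    k L with k < 1 close to 1 gives points of divergence, while [conv_region] is
    open; so the interior of the set of convergence is [conv_region]
    ([domain_of_convergence_region]).

    The Lambert function: up to complex conjugation, w = W_k(-L/e) is the solution
    with arg w + Im w = b + pi and |w| e^(Re w + 1) = R.  For t = pi - arg w,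
    R sin t - t > b means R > |w|, that is Re w > -1; and if Re w <= -1, the
    tangent to the sine at pi - arg w bounds R sin t - t by b for all t
    ([lambert_solution_region]). *)

(** * The recurrence of the Stirling cycle numbers *)

Module StirlingCycle.
Import ssreflect ssrfun ssrbool eqtype ssrnat seq choice fintype finset fingroup perm bigop.
Local Open Scope nat_scope.
Local Open Scope group_scope.

Section Lift.
Variable n : nat.
Implicit Types (s : 'S_n) (j : 'I_n.+1).
Local Notation top := (@ord_max n).
Local Notation fixtop := (lift_perm top top).

(** [fixtop s] lets [s] act on the first [n] points and fixes the last one. *)
Lemma fixtopX s i : fixtop s ^+ i = fixtop (s ^+ i).
Proof.
elim: i => [|i IH]; first by rewrite !expg0 lift_perm1.
by rewrite !expgS IH lift_permM.
Qed.

Lemma porbit_fixtop_lift s (x : 'I_n) :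
  porbit (fixtop s) (lift top x) = [set lift top y | y in porbit s x].
Proof.
apply/setP=> z; apply/porbitP/imsetP => [[i ->]|[y /porbitP[i ->] ->]].
  by exists ((s ^+ i) x); rewrite ?mem_porbit // fixtopX (lift_perm_lift top top).
by exists i; rewrite fixtopX (lift_perm_lift top top).
Qed.

Lemma porbit_fixtop_top s : porbit (fixtop s) top = [set top].
Proof.
apply/setP=> z; rewrite inE; apply/porbitP/eqP => [[i ->]|->].
  by rewrite fixtopX lift_perm_id.
by exists 0; rewrite expg0 perm1.
Qed.

Lemma porbits_fixtop s :
  porbits (fixtop s) =
  [set top] |: [set [set lift top y | y in A] | A : {set 'I_n} in porbits s].
Proof.
apply/setP=> B; rewrite in_setU1; apply/imsetP/orP.
- case=> z _ ->; case: (unliftP top z) => [x ->|->]; last first.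
    by left; rewrite porbit_fixtop_top.
  right; apply/imsetP; exists (porbit s x); first exact: imset_f.
  exact: porbit_fixtop_lift.
- case=> [/eqP ->|/imsetP[A /imsetP[x _ ->] ->]].
    by exists top => //; rewrite porbit_fixtop_top.
  by exists (lift top x) => //; rewrite porbit_fixtop_lift.
Qed.

Lemma card_porbits_fixtop s : #|porbits (fixtop s)| = #|porbits s|.+1.
Proof.
rewrite porbits_fixtop cardsU1 card_imset; last exact/imset_inj/lift_inj.
case: imsetP => [[A _ /setP /(_ top)]|_] //.
by rewrite inE eqxx => /esym /imsetP[y _ /eqP]; rewrite (negPf (neq_lift _ _)).
Qed.

(** Every permutation of [n+1] points arises exactly once by inserting the last
    point in front of a point [j] in its cycle, or as a new cycle if [j] is that
    last point itself. *)
Definition insert_top (p : 'S_n * 'I_n.+1) : 'S_n.+1 :=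
  tperm top p.2 * fixtop p.1.

(** Multiplication by a transposition of points in different cycles merges the
    two cycles; here one of them is the fixed last point. *)
Lemma card_porbits_insert_top p :
  #|porbits (insert_top p)| = #|porbits p.1| + (p.2 == top).
Proof.
case: p => s j; have := porbits_mul_tperm (fixtop s) top j.
rewrite /insert_top /= card_porbits_fixtop.
have -> : (top \in porbit (fixtop s) j) = (j == top).
  by rewrite -porbit_sym porbit_fixtop_top inE.
rewrite [top == j]eq_sym; case: (j == top) => /=; first by rewrite !addn0 addn1.
by rewrite addn0 addn1 addn2 => -[].
Qed.

Lemma insert_top_bij : bijective insert_top.
Proof.
apply: inj_card_bij => [[s j] [s' j']|]; last first.
  by rewrite card_prod !card_Sn card_ord factS mulnC.
rewrite /insert_top /= => eq_p.
have ej : j = j'.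
  have /permP/(_ j) := eq_p; rewrite !permM tpermR lift_perm_id => e.
  apply: (@perm_inj _ (tperm top j')).
  by apply: (@perm_inj _ (fixtop s')); rewrite -e tpermR lift_perm_id.
move: eq_p; rewrite -ej => /mulgI /permP eqL; congr (_, _).
apply/permP=> x; apply: (@lift_inj _ top).
by have := eqL (lift top x); rewrite !(lift_perm_lift top top).
Qed.

End Lift.

Local Close Scope group_scope.

(** Of the [n+1] insertions into a permutation of [n] points, one creates a cycle
    and [n] do not. *)
Lemma stirling_cycle_rec n k :
  stirling_cycle n.+1 k.+1 = n * stirling_cycle n k.+1 + stirling_cycle n k.
Proof.
have sumE m l : stirling_cycle m l = \sum_(s : 'S_m) (#|porbits s| == l).
  by rewrite /stirling_cycle -sum1dep_card big_mkcond.
rewrite !sumE (reindex (@insert_top n)) /=; last first.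
  by apply: onW_bij; exact: insert_top_bij.
under eq_bigr => p _ do rewrite card_porbits_insert_top.
rewrite -(pair_bigA _ (fun s j => nat_of_bool (#|porbits s| + (j == ord_max) == k.+1))) /=.
rewrite big_distrr -big_split /=; apply: eq_bigr => s _.
rewrite (bigD1 ord_max) //= eqxx addn1 eqSS addnC; congr (_ + _).
rewrite (eq_bigr (fun=> nat_of_bool (#|porbits s| == k.+1))); last first.
  by move=> j /negPf ->; rewrite addn0.
rewrite sum_nat_const; congr (_ * _).
by rewrite cardC1 card_ord.
Qed.

Lemma stirling_cycle_0 k : stirling_cycle 0 k = (k == 0).
Proof.
have porb0 (s : 'S_0) : #|porbits s| = 0.
  by apply/eqP; rewrite cards_eq0; apply/eqP/setP=> A; rewrite inE; apply/imsetP=> -[[]].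
rewrite /stirling_cycle; case: k => [|k].
  rewrite (_ : [set s | _] = setT); last by apply/setP=> s; rewrite !inE porb0.
  by rewrite cardsT card_Sn.
apply/eqP; rewrite cards_eq0; apply/eqP/setP=> s.
by rewrite !inE porb0.
Qed.

Lemma stirling_cycle_small n k : n < k -> stirling_cycle n k = 0.
Proof.
elim: n k => [|n IH] [|k] // lt; first by rewrite stirling_cycle_0.
by rewrite stirling_cycle_rec !IH ?muln0 // ltnW.
Qed.

Lemma stirling_cycle_S_0 n : stirling_cycle n.+1 0 = 0.
Proof.
apply/eqP; rewrite cards_eq0; apply/eqP/setP=> s; rewrite !inE cards_eq0.
by apply/negP=> /eqP /setP /(_ (porbit s ord0)); rewrite inE imset_f.
Qed.

Lemma stirling_cycle_rec_nat n k :
  stirling_cycle (S n) (S k) =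
  Nat.add (Nat.mul n (stirling_cycle n (S k))) (stirling_cycle n k).
Proof. exact: stirling_cycle_rec. Qed.

Lemma stirling_cycle_small_nat n k : Peano.lt n k -> stirling_cycle n k = 0.
Proof. by move/ltP; exact: stirling_cycle_small. Qed.

Lemma stirling_cycle_1_1 : stirling_cycle 1 1 = 1.
Proof. by rewrite stirling_cycle_rec !stirling_cycle_0. Qed.

End StirlingCycle.
Import StirlingCycle.

(** * Derivatives of complex functions along curves *)

Lemma C_ext (z w : C) : Re z = Re w -> Im z = Im w -> z = w.
Proof. destruct z, w; simpl; intros -> ->; reflexivity. Qed.

Lemma exp_mono x y : (x <= y -> exp x <= exp y)%R.
Proof. intros [H|H]; [left; now apply exp_increasing|right; now rewrite H]. Qed.

Lemma exp_opp_mult x : (exp (- x) * exp x = 1)%R.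
Proof. rewrite <- exp_plus, Rplus_opp_l. apply exp_0. Qed.

Lemma sin2_cos2_mult x : (sin x * sin x + cos x * cos x = 1)%R.
Proof. apply sin2_cos2. Qed.

Lemma cos_le_cos_between h y : 0 <= h <= PI -> - h <= y <= h -> cos h <= cos y.
Proof.
  intros Hh Hy. destruct (Rle_dec 0 y); [|rewrite <- (cos_neg y)]; apply cos_decr_1; lra.
Qed.

Definition curve_deriv (f : R -> C) (t : R) (l : C) : Prop :=
  is_derive (fun t => Re (f t)) t (Re l) /\ is_derive (fun t => Im (f t)) t (Im l).

Definition curve_cont (f : R -> C) (t : R) : Prop :=
  continuous (fun t => Re (f t)) t /\ continuous (fun t => Im (f t)) t.

(** Complex differentiability, tested on differentiable real curves: the chain
    rule is built in, which is all that integration along paths requires. *)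
Definition hol_deriv (F : C -> C) (u l : C) : Prop :=
  forall (c : R -> C) t d,
    c t = u -> curve_deriv c t d -> curve_deriv (fun t => F (c t)) t (l * d).

Lemma curve_deriv_cont f t l : curve_deriv f t l -> curve_cont f t.
Proof.
  intros [H1 H2]; split; apply (ex_derive_continuous (V := R_NormedModule)).
  - exists (Re l); exact H1.
  - exists (Im l); exact H2.
Qed.

Lemma curve_deriv_eq f t l l' : curve_deriv f t l -> l = l' -> curve_deriv f t l'.
Proof. intros H <-; exact H. Qed.

Lemma curve_deriv_const c t : curve_deriv (fun _ => c) t 0.
Proof. split; simpl; apply @is_derive_const. Qed.

Lemma curve_deriv_plus f g t l m :
  curve_deriv f t l -> curve_deriv g t m -> curve_deriv (fun t => f t + g t) t (l + m).
Proof. intros [H1 H2] [H3 H4]; split; simpl; now apply @is_derive_plus. Qed.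

Lemma curve_deriv_opp f t l : curve_deriv f t l -> curve_deriv (fun t => - f t) t (- l).
Proof. intros [H1 H2]; split; simpl; now apply @is_derive_opp. Qed.

Lemma curve_deriv_minus f g t l m :
  curve_deriv f t l -> curve_deriv g t m -> curve_deriv (fun t => f t - g t) t (l - m).
Proof. intros; apply curve_deriv_plus; [|apply curve_deriv_opp]; assumption. Qed.

Lemma is_derive_Rmult (f g : R -> R) t l m :
  is_derive f t l -> is_derive g t m ->
  is_derive (fun t => f t * g t)%R t (l * g t + f t * m)%R.
Proof. intros H1 H2. apply (is_derive_mult f g t l m H1 H2). intros; apply Rmult_comm. Qed.

Lemma curve_deriv_mult f g t l m :
  curve_deriv f t l -> curve_deriv g t m ->
  curve_deriv (fun t => f t * g t) t (l * g t + f t * m).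
Proof.
  intros [H1 H2] [H3 H4]; split.
  - evar_last.
    + apply @is_derive_minus; apply is_derive_Rmult; eassumption.
    + unfold minus, plus, opp; simpl; unfold Re, Im in *; simpl; ring.
  - evar_last.
    + apply @is_derive_plus; apply is_derive_Rmult; eassumption.
    + unfold minus, plus, opp; simpl; unfold Re, Im in *; simpl; ring.
Qed.

Lemma is_derive_Rcomp (f g : R -> R) t l m :
  is_derive f (g t) l -> is_derive g t m ->
  is_derive (fun t => f (g t)) t (m * l)%R.
Proof. intros H1 H2. now apply (is_derive_comp f g t l m). Qed.

Lemma curve_deriv_exp f t l :
  curve_deriv f t l -> curve_deriv (fun t => Cexp (f t)) t (Cexp (f t) * l).
Proof.
  intros [H1 H2]; unfold Cexp, curve_deriv; simpl.
  assert (He := is_derive_Rcomp exp _ t _ _ (is_derive_exp (Re (f t))) H1).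
  assert (Hc := is_derive_Rcomp cos _ t _ _ (is_derive_cos (Im (f t))) H2).
  assert (Hs := is_derive_Rcomp sin _ t _ _ (is_derive_sin (Im (f t))) H2).
  split.
  - evar_last. apply (is_derive_Rmult _ _ t _ _ He Hc). cbv beta. unfold Re, Im in *; simpl; ring.
  - evar_last. apply (is_derive_Rmult _ _ t _ _ He Hs). cbv beta. unfold Re, Im in *; simpl; ring.
Qed.

Lemma Cmod2_pos (z : C) : z <> 0 -> (0 < Re z ^ 2 + Im z ^ 2)%R.
Proof.
  intros H. destruct (Req_dec (Re z) 0) as [E|E]; [destruct (Req_dec (Im z) 0) as [E'|E']|].
  - elim H; now apply C_ext.
  - nra.
  - nra.
Qed.

Lemma curve_deriv_inv (f : R -> C) t l :
  f t <> 0 -> curve_deriv f t l -> curve_deriv (fun t => / f t) t (- (l / (f t * f t))).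
Proof.
  intros N [H1 H2]. assert (P := Cmod2_pos _ N).
  assert (Dn : is_derive (fun t => / (Re (f t) ^ 2 + Im (f t) ^ 2))%R t
     (- (2 * Re (f t) * Re l + 2 * Im (f t) * Im l) / (Re (f t) ^ 2 + Im (f t) ^ 2) ^ 2)%R).
  { apply (is_derive_inv (fun t => Re (f t) ^ 2 + Im (f t) ^ 2)%R); [|lra].
    evar_last. apply @is_derive_plus; apply is_derive_pow; eassumption.
    unfold plus; simpl; ring. }
  assert (quad : forall x y : R, (0 < x * (x * 1) + y * (y * 1))%R ->
    ((x * x - y * y) * (x * x - y * y) + (x * y + y * x) * (x * y + y * x) <> 0
     /\ x * x + y * y <> 0)%R).
  { intros x y Hxy. split; [|nra].
    replace (_ + _)%R with ((x * x + y * y) * (x * x + y * y))%R by ring. nra. }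
  split; unfold Cinv; simpl.
  - eapply is_derive_ext; [intros s; unfold Rdiv; reflexivity|].
    evar_last. apply (is_derive_Rmult _ _ t _ _ H1 Dn).
    cbv beta. unfold Re, Im in *; simpl in *. field. now apply quad.
  - eapply is_derive_ext; [intros s; unfold Rdiv; reflexivity|].
    evar_last. apply (is_derive_Rmult _ _ t _ _ (is_derive_opp _ t _ H2) Dn).
    unfold opp; simpl. unfold Re, Im in *; simpl in *. field. now apply quad.
Qed.

Lemma hol_id u : hol_deriv (fun u => u) u 1.
Proof. intros c t d _ H. eapply curve_deriv_eq; [exact H|ring]. Qed.

Lemma hol_const k u : hol_deriv (fun _ => k) u 0.
Proof. intros c t d _ H. eapply curve_deriv_eq; [apply curve_deriv_const|ring]. Qed.

Lemma hol_plus F G u l m :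
  hol_deriv F u l -> hol_deriv G u m -> hol_deriv (fun u => F u + G u) u (l + m).
Proof.
  intros H1 H2 c t d E H. eapply curve_deriv_eq.
  apply curve_deriv_plus; [apply H1|apply H2]; eassumption. ring.
Qed.

Lemma hol_mult F G u l m :
  hol_deriv F u l -> hol_deriv G u m -> hol_deriv (fun u => F u * G u) u (l * G u + F u * m).
Proof.
  intros H1 H2 c t d E H. eapply curve_deriv_eq.
  apply curve_deriv_mult; [apply H1|apply H2]; eassumption. cbv beta; rewrite E; ring.
Qed.

Lemma hol_eq F u l l' : hol_deriv F u l -> l = l' -> hol_deriv F u l'.
Proof. intros H <-; exact H. Qed.

Lemma hol_opp F u l : hol_deriv F u l -> hol_deriv (fun u => - F u) u (- l).
Proof.
  intros H1 c t d E H. eapply curve_deriv_eq.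
  apply curve_deriv_opp, H1; eassumption. ring.
Qed.

Lemma hol_exp F u l : hol_deriv F u l -> hol_deriv (fun u => Cexp (F u)) u (Cexp (F u) * l).
Proof.
  intros H1 c t d E H. eapply curve_deriv_eq.
  apply curve_deriv_exp, H1; eassumption. cbv beta; rewrite E; ring.
Qed.

Lemma hol_inv (F : C -> C) u l : F u <> 0 -> hol_deriv F u l ->
  hol_deriv (fun u => / F u) u (- (l / (F u * F u))).
Proof.
  intros N H1 c t d E H. eapply curve_deriv_eq.
  apply curve_deriv_inv; [now rewrite E| apply H1; eassumption]. cbv beta; rewrite E; field; exact N.
Qed.

Lemma hol_pow F u l n : hol_deriv F u l ->
  hol_deriv (fun u => F u ^ n) u (RtoC (INR n) * F u ^ (pred n) * l).
Proof.
  intros H. induction n as [|n IH].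
  - simpl. eapply hol_eq. apply hol_const. ring.
  - eapply hol_eq. apply (hol_mult _ _ u _ _ H IH). simpl pred.
    rewrite S_INR, RtoC_plus. destruct n as [|n]; simpl; ring.
Qed.

(** * Integrals along segments and rectangles *)

Definition Cint (f : R -> C) (a b : R) : C :=
  (RInt (fun t => Re (f t)) a b, RInt (fun t => Im (f t)) a b).

Lemma ex_RInt_curve_cont f a b : a <= b ->
  (forall t, a <= t <= b -> curve_cont f t) ->
  ex_RInt (fun t => Re (f t)) a b /\ ex_RInt (fun t => Im (f t)) a b.
Proof.
  intros L H; split; apply (ex_RInt_continuous (V := R_CompleteNormedModule));
  intros t Ht; rewrite Rmin_left, Rmax_right in Ht by exact L; apply (H t Ht).
Qed.

Lemma Im_le_Cmod (z : C) : Rabs (Im z) <= Cmod z.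
Proof. eapply Rle_trans; [apply Rmax_r|apply Rmax_Cmod]. Qed.

Lemma Cmod_le_abs (z : C) : Cmod z <= Rabs (Re z) + Rabs (Im z).
Proof.
  apply Rsqr_incr_0_var; [|generalize (Rabs_pos (Re z)) (Rabs_pos (Im z)); lra].
  rewrite !Rsqr_pow2, Cmod2_alt, <- (pow2_abs (Re z)), <- (pow2_abs (Im z)).
  generalize (Rabs_pos (Re z)) (Rabs_pos (Im z)); nra.
Qed.

Lemma Cint_plus f g a b : a <= b ->
  (forall t, a <= t <= b -> curve_cont f t) -> (forall t, a <= t <= b -> curve_cont g t) ->
  Cint (fun t => f t + g t) a b = Cint f a b + Cint g a b.
Proof.
  intros L Hf Hg.
  destruct (ex_RInt_curve_cont f a b L Hf), (ex_RInt_curve_cont g a b L Hg).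
  apply C_ext; unfold Cint; simpl;
  apply (RInt_plus (V := R_CompleteNormedModule)); assumption.
Qed.

Lemma Cint_scal k f a b : a <= b -> (forall t, a <= t <= b -> curve_cont f t) ->
  Cint (fun t => k * f t) a b = k * Cint f a b.
Proof.
  intros L Hf. destruct (ex_RInt_curve_cont f a b L Hf) as [H1 H2].
  assert (E : forall x : R, ex_RInt (fun t => x * Re (f t))%R a b /\ ex_RInt (fun t => x * Im (f t))%R a b).
  { intros x; split; apply (ex_RInt_scal (V := R_NormedModule)); assumption. }
  assert (E' : forall x : R, RInt (fun t => x * Re (f t))%R a b = (x * RInt (fun t => Re (f t)) a b)%R
     /\ RInt (fun t => x * Im (f t))%R a b = (x * RInt (fun t => Im (f t)) a b)%R).
  { intros x; split; apply (RInt_scal (V := R_CompleteNormedModule)); assumption. }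
  destruct (E' (Re k)) as [e1 e2], (E' (Im k)) as [e3 e4].
  destruct (E (Re k)) as [E1 E2], (E (Im k)) as [E3 E4].
  apply C_ext.
  - change (RInt (fun t => minus (Re k * Re (f t))%R (Im k * Im (f t))%R) a b =
      (Re k * RInt (fun t => Re (f t)) a b - Im k * RInt (fun t => Im (f t)) a b)%R).
    rewrite <- e1, <- e4.
    exact (RInt_minus (V := R_CompleteNormedModule) _ _ a b E1 E4).
  - change (RInt (fun t => plus (Re k * Im (f t))%R (Im k * Re (f t))%R) a b =
      (Re k * RInt (fun t => Im (f t)) a b + Im k * RInt (fun t => Re (f t)) a b)%R).
    rewrite <- e2, <- e3.
    exact (RInt_plus (V := R_CompleteNormedModule) _ _ a b E2 E3).
Qed.

Lemma Cint_deriv F f a b : a <= b ->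
  (forall t, a <= t <= b -> curve_deriv F t (f t)) ->
  (forall t, a <= t <= b -> curve_cont f t) ->
  Cint f a b = F b - F a.
Proof.
  intros L HF Hf. apply C_ext; unfold Cint; simpl.
  - apply (is_RInt_unique (V := R_CompleteNormedModule)).
    apply (is_RInt_derive (fun t => Re (F t)));
    intros t Ht; rewrite Rmin_left, Rmax_right in Ht by exact L; [apply (HF t Ht)|apply (Hf t Ht)].
  - apply (is_RInt_unique (V := R_CompleteNormedModule)).
    apply (is_RInt_derive (fun t => Im (F t)));
    intros t Ht; rewrite Rmin_left, Rmax_right in Ht by exact L; [apply (HF t Ht)|apply (Hf t Ht)].
Qed.

Lemma Cint_bound f a b B : a <= b ->
  (forall t, a <= t <= b -> curve_cont f t) ->
  (forall t, a <= t <= b -> Cmod (f t) <= B) ->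
  Cmod (Cint f a b) <= 2 * (b - a) * B.
Proof.
  intros L Hf HB. destruct (ex_RInt_curve_cont f a b L Hf) as [H1 H2].
  eapply Rle_trans; [apply Cmod_le_abs|]. unfold Cint; simpl.
  replace (2 * (b - a) * B)%R with ((b - a) * B + (b - a) * B)%R by ring.
  apply Rplus_le_compat; apply abs_RInt_le_const; try assumption;
  intros t Ht; (eapply Rle_trans; [|apply (HB t Ht)]); [apply re_le_Cmod|apply Im_le_Cmod].
Qed.

Lemma Cint_ext f g a b : a <= b -> (forall t, a <= t <= b -> f t = g t) ->
  Cint f a b = Cint g a b.
Proof.
  intros L H. unfold Cint. f_equal; apply RInt_ext; intros t Ht;
  rewrite Rmin_left, Rmax_right in Ht by exact L; rewrite H by lra; reflexivity.
Qed.

Definition line (p q : C) (t : R) : C := p + RtoC t * (q - p).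

Lemma line_deriv p q t : curve_deriv (line p q) t (q - p).
Proof.
  unfold line; split; simpl.
  - evar_last. auto_derive; auto. unfold Re; simpl; ring.
  - evar_last. auto_derive; auto. unfold Im; simpl; ring.
Qed.

Definition seg_int (f : C -> C) (p q : C) : C :=
  (q - p) * Cint (fun t => f (line p q t)) 0 1.

Definition holomorphic_on (D : C -> Prop) (f : C -> C) : Prop :=
  forall u, D u -> exists l, hol_deriv f u l.

Definition on_seg (p q u : C) : Prop := exists t : R, 0 <= t <= 1 /\ u = line p q t.

Lemma hol_line_cont f p q t :
  holomorphic_on (on_seg p q) f -> 0 <= t <= 1 -> curve_cont (fun t => f (line p q t)) t.
Proof.
  intros H Ht. destruct (H (line p q t)) as [l Hl]; [now exists t|].
  eapply curve_deriv_cont. apply (Hl _ t (q - p)); [reflexivity|apply line_deriv].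
Qed.

Lemma seg_int_plus f g p q : holomorphic_on (on_seg p q) f -> holomorphic_on (on_seg p q) g ->
  seg_int (fun u => f u + g u) p q = seg_int f p q + seg_int g p q.
Proof.
  intros Hf Hg. unfold seg_int. rewrite Cint_plus; [ring|lra| |];
  intros t Ht; now apply hol_line_cont.
Qed.

Lemma seg_int_scal k f p q : holomorphic_on (on_seg p q) f ->
  seg_int (fun u => k * f u) p q = k * seg_int f p q.
Proof.
  intros Hf. unfold seg_int. rewrite Cint_scal; [ring|lra|].
  intros t Ht; now apply hol_line_cont.
Qed.

Lemma seg_int_deriv F f p q : (forall u, on_seg p q u -> hol_deriv F u (f u)) ->
  holomorphic_on (on_seg p q) f -> seg_int f p q = F q - F p.
Proof.
  intros HF Hf. unfold seg_int. rewrite <- Cint_scal; [|lra|intros t Ht; now apply hol_line_cont].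
  rewrite (Cint_deriv (fun t => F (line p q t))).
  - f_equal; [|f_equal]; f_equal; unfold line; ring.
  - lra.
  - intros t Ht. rewrite Cmult_comm. apply HF; [now exists t|reflexivity|apply line_deriv].
  - intros t Ht. destruct (Hf (line p q t)) as [l Hl]; [now exists t|].
    eapply curve_deriv_cont. apply curve_deriv_mult; [apply curve_deriv_const|].
    apply (Hl _ t (q - p)); [reflexivity|apply line_deriv].
Qed.

Lemma seg_int_bound f p q B : holomorphic_on (on_seg p q) f ->
  (forall u, on_seg p q u -> Cmod (f u) <= B) -> Cmod (seg_int f p q) <= 2 * Cmod (q - p) * B.
Proof.
  intros Hf HB. unfold seg_int. rewrite Cmod_mult.
  replace (2 * Cmod (q - p) * B)%R with (Cmod (q - p) * (2 * (1 - 0) * B))%R by ring.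
  apply Rmult_le_compat_l; [apply Cmod_ge_0|].
  apply Cint_bound; [lra|intros t Ht; now apply hol_line_cont|].
  intros t Ht; apply HB; now exists t.
Qed.

Lemma seg_int_ext f g p q : (forall u, on_seg p q u -> f u = g u) ->
  seg_int f p q = seg_int g p q.
Proof.
  intros H. unfold seg_int. f_equal. apply Cint_ext; [lra|].
  intros t Ht; apply H; now exists t.
Qed.

Section Rectangle.
Variables M a h : R.
Let p1 : C := ((- M)%R, (- h)%R).
Let p2 : C := (a, (- h)%R).
Let p3 : C := (a, h).
Let p4 : C := ((- M)%R, h).

(** The boundary of the rectangle [-M, a] x [-h, h], counterclockwise. *)
Definition on_rect (u : C) : Prop :=
  on_seg p1 p2 u \/ on_seg p2 p3 u \/ on_seg p3 p4 u \/ on_seg p4 p1 u.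

Definition rect_int (f : C -> C) : C :=
  seg_int f p1 p2 + seg_int f p2 p3 + seg_int f p3 p4 + seg_int f p4 p1.

Lemma on_rect_sides (D : C -> Prop) : (forall u, on_rect u -> D u) ->
  (forall u, on_seg p1 p2 u -> D u) /\ (forall u, on_seg p2 p3 u -> D u) /\
  (forall u, on_seg p3 p4 u -> D u) /\ (forall u, on_seg p4 p1 u -> D u).
Proof. unfold on_rect; repeat split; intuition. Qed.

Lemma rect_int_ext f g : (forall u, on_rect u -> f u = g u) -> rect_int f = rect_int g.
Proof.
  intros H; apply on_rect_sides in H as (?&?&?&?).
  unfold rect_int; rewrite !(seg_int_ext f g); auto.
Qed.

Lemma rect_int_plus f g : holomorphic_on on_rect f -> holomorphic_on on_rect g ->
  rect_int (fun u => f u + g u) = rect_int f + rect_int g.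
Proof.
  intros Hf Hg; apply on_rect_sides in Hf as (?&?&?&?); apply on_rect_sides in Hg as (?&?&?&?).
  unfold rect_int; rewrite !seg_int_plus; auto. ring.
Qed.

Lemma rect_int_scal k f : holomorphic_on on_rect f ->
  rect_int (fun u => k * f u) = k * rect_int f.
Proof.
  intros Hf; apply on_rect_sides in Hf as (?&?&?&?).
  unfold rect_int; rewrite !seg_int_scal; auto. ring.
Qed.

Lemma rect_int_deriv F f : (forall u, on_rect u -> hol_deriv F u (f u)) ->
  holomorphic_on on_rect f -> rect_int f = 0.
Proof.
  intros HF Hf; apply on_rect_sides in Hf as (?&?&?&?); apply on_rect_sides in HF as (?&?&?&?).
  unfold rect_int; rewrite !(seg_int_deriv F f); auto. ring.
Qed.

(** The constant is twice the perimeter: real and imaginary parts of an integral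
    are bounded separately. *)
Lemma rect_int_bound : exists K : R, 0 <= K /\ forall f B, holomorphic_on on_rect f ->
  (forall u, on_rect u -> Cmod (f u) <= B) -> Cmod (rect_int f) <= K * B.
Proof.
  exists (2 * Cmod (p2 - p1) + 2 * Cmod (p3 - p2) + 2 * Cmod (p4 - p3) + 2 * Cmod (p1 - p4))%R.
  split.
  - generalize (Cmod_ge_0 (p2 - p1)) (Cmod_ge_0 (p3 - p2)) (Cmod_ge_0 (p4 - p3)) (Cmod_ge_0 (p1 - p4)); lra.
  - intros f B Hf HB; apply on_rect_sides in Hf as (?&?&?&?); apply on_rect_sides in HB as (?&?&?&?).
    unfold rect_int. rewrite !Rmult_plus_distr_r.
    repeat (eapply Rle_trans; [apply Cmod_triangle|apply Rplus_le_compat; [|now apply seg_int_bound]]).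
    now apply seg_int_bound.
Qed.

End Rectangle.

Lemma on_rect_coord M a h u : 0 < M -> 0 < a -> 0 < h -> on_rect M a h u ->
  (- M <= Re u <= a /\ (Im u = h \/ Im u = - h)%R) \/
  ((Re u = - M \/ Re u = a)%R /\ - h <= Im u <= h).
Proof.
  intros HM Ha Hh [H|[H|[H|H]]]; destruct H as (t & Ht & ->); unfold line; simpl;
  unfold Re, Im; simpl.
  - left. split; [nra|right; ring].
  - right. split; [right; ring|nra].
  - left. split; [nra|left; ring].
  - right. split; [left; ring|nra].
Qed.

(** * The contour integrals of u^j / (1 - e^(-u))^n *)

Definition Emap (u : C) : C := 1 - Cexp (- u).

Lemma Re_Emap u : Re (Emap u) = (1 - exp (- Re u) * cos (Im u))%R.
Proof. unfold Emap, Cexp; simpl. rewrite cos_neg. reflexivity. Qed.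

Lemma Im_Emap u : Im (Emap u) = (exp (- Re u) * sin (Im u))%R.
Proof. unfold Emap, Cexp; simpl. rewrite sin_neg. unfold Im, Re; simpl; ring. Qed.

(** The other zeros of 1 - e^(-u) are the multiples of 2 i pi. *)
Lemma Emap_neq_0 u : - PI < Im u < PI -> u <> 0 -> Emap u <> 0.
Proof.
  intros Hy Hu E.
  assert (E1 := f_equal Re E); assert (E2 := f_equal Im E).
  rewrite Re_Emap in E1; rewrite Im_Emap in E2; simpl in E1, E2.
  assert (Hp := exp_pos (- Re u)).
  assert (S : sin (Im u) = 0).
  { apply Rmult_integral in E2; destruct E2; [lra|assumption]. }
  assert (Y : Im u = 0).
  { destruct (Rtotal_order (Im u) 0) as [L|[L|L]]; [|assumption|].
    - assert (0 < sin (- Im u)) by (apply sin_gt_0; lra). rewrite sin_neg in H; lra.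
    - assert (0 < sin (Im u)) by (apply sin_gt_0; lra). lra. }
  rewrite Y, cos_0 in E1. apply Hu, C_ext; [simpl|exact Y].
  assert (X : exp (- Re u) = exp 0) by (rewrite exp_0; lra).
  apply exp_inv in X. unfold Re in *; simpl; lra.
Qed.

Lemma hol_Emap u : hol_deriv Emap u (1 - Emap u).
Proof.
  eapply hol_eq.
  - apply (hol_plus (fun _ => 1) (fun u => - Cexp (- u))); [apply hol_const|].
    apply hol_opp, (hol_exp (fun u => - u)), hol_opp, hol_id.
  - unfold Emap; ring.
Qed.

Definition kernel (j n : nat) (u : C) : C := u ^ j * (/ Emap u) ^ n.

(** The derivative of [kernel j n], with e^(-u) eliminated as 1 - (1 - e^(-u)) so
    that only kernels occur. *)
Definition kernel' (j n : nat) (u : C) : C :=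
  RtoC (INR j) * kernel (pred j) n u +
  (RtoC (- INR n) * kernel j (S n) u + RtoC (INR n) * kernel j n u).

Lemma hol_kernel j n u : Emap u <> 0 -> hol_deriv (kernel j n) u (kernel' j n u).
Proof.
  intros N. eapply hol_eq.
  - apply hol_mult.
    + apply (hol_pow (fun u => u)), hol_id.
    + apply (hol_pow (fun u => / Emap u)), hol_inv; [exact N|apply hol_Emap].
  - unfold kernel', kernel. destruct n as [|n]; simpl pred.
    + simpl. rewrite Ropp_0. ring.
    + rewrite RtoC_opp. simpl Cpow. field. exact N.
Qed.

Section ContourCoefficients.
Variables M a h : R.
Hypotheses (HM : 0 < M) (Ha : 0 < a) (Hh : 0 < h < PI).
Hypothesis Hleft : 1 < exp M * cos h.

Definition contour_coef (j n : nat) : C := rect_int M a h (kernel j n).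

Lemma on_rect_Emap_neq_0 u : on_rect M a h u -> Emap u <> 0.
Proof.
  intros H. apply on_rect_coord in H; try lra.
  apply Emap_neq_0.
  - destruct H as [[_ [-> | ->]]|[_ H]]; lra.
  - intros ->; simpl in H. unfold Re, Im in H; simpl in H. lra.
Qed.

Lemma holomorphic_kernel j n : holomorphic_on (on_rect M a h) (kernel j n).
Proof. intros u Hu; eexists; now apply hol_kernel, on_rect_Emap_neq_0. Qed.

Lemma holomorphic_scal D k f : holomorphic_on D f -> holomorphic_on D (fun u => k * f u).
Proof.
  intros H u Hu; destruct (H u Hu) as [l Hl]. eexists; apply hol_mult; [apply hol_const|exact Hl].
Qed.

Lemma holomorphic_plus D f g : holomorphic_on D f -> holomorphic_on D g ->
  holomorphic_on D (fun u => f u + g u).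
Proof.
  intros Hf Hg u Hu; destruct (Hf u Hu) as [l Hl], (Hg u Hu) as [m Hm].
  eexists; apply hol_plus; eassumption.
Qed.

(** The derivative of [kernel j n] has integral 0.  After multiplication by
    factorials this is the recurrence of the Stirling cycle numbers. *)
Lemma contour_coef_rec j n :
  RtoC (INR n) * contour_coef j (S n) =
  RtoC (INR n) * contour_coef j n + RtoC (INR j) * contour_coef (pred j) n.
Proof.
  assert (H : rect_int M a h (kernel' j n) = 0).
  { apply (rect_int_deriv M a h (kernel j n)).
    - intros u Hu; now apply hol_kernel, on_rect_Emap_neq_0.
    - apply holomorphic_plus; [|apply holomorphic_plus];
      apply holomorphic_scal, holomorphic_kernel. }
  unfold kernel' in H.
  rewrite (rect_int_plus M a h (fun u => RtoC (INR j) * kernel (pred j) n u)) in H;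
    [|apply holomorphic_scal, holomorphic_kernel
     |apply holomorphic_plus; apply holomorphic_scal, holomorphic_kernel].
  rewrite (rect_int_plus M a h (fun u => RtoC (- INR n) * kernel j (S n) u)) in H;
    [|apply holomorphic_scal, holomorphic_kernel..].
  rewrite !rect_int_scal in H by apply holomorphic_kernel.
  fold (contour_coef j n) (contour_coef j (S n)) (contour_coef (pred j) n) in H.
  rewrite RtoC_opp in H.
  transitivity (RtoC (INR n) * contour_coef j (S n) + 0); [ring|]. rewrite <- H. ring.
Qed.

Lemma seg_int_Im_pos f p q : holomorphic_on (on_seg p q) f ->
  (forall u, on_seg p q u -> 0 < Im ((q - p) * f u)) -> 0 < Im (seg_int f p q).
Proof.
  intros Hf Hp. unfold seg_int.
  rewrite <- Cint_scal; [|lra|intros t Ht; now apply hol_line_cont].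
  unfold Cint. simpl. apply RInt_gt_0; [lra| |].
  - intros t Ht. apply Hp. exists t; split; [lra|reflexivity].
  - intros t Ht. apply (hol_line_cont (fun u => (q - p) * f u)); [|exact Ht].
    now apply holomorphic_scal.
Qed.

Lemma Im_div_pos (d e : C) : e <> 0 -> (0 < Im d * Re e - Re d * Im e)%R -> 0 < Im (d * / e).
Proof.
  intros N P. assert (Q := Cmod2_pos e N).
  replace (Im (d * / e)) with ((Im d * Re e - Re d * Im e) / (Re e ^ 2 + Im e ^ 2))%R.
  - now apply Rdiv_lt_0_compat.
  - unfold Cinv, Re, Im in *; simpl in *. field. lra.
Qed.

(** By the residue theorem this integral is 2 i pi.  That it is nonzero is visible
    directly: on each of the four sides the integrand times the direction has
    positive imaginary part. *)
Lemma contour_coef_0_1_Im_pos : 0 < Im (contour_coef 0 1).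
Proof.
  assert (HH := holomorphic_kernel 0 1).
  apply (on_rect_sides M a h) in HH as (H1 & H2 & H3 & H4).
  assert (N := on_rect_Emap_neq_0).
  apply (on_rect_sides M a h) in N as (N1 & N2 & N3 & N4).
  assert (K : forall d u, Emap u <> 0 ->
    (0 < Im d * (1 - exp (- Re u) * cos (Im u)) - Re d * (exp (- Re u) * sin (Im u)))%R ->
    0 < Im (d * kernel 0 1 u)).
  { intros d u Nu P. rewrite <- Re_Emap, <- Im_Emap in P.
    replace (kernel 0 1 u) with (/ Emap u) by (unfold kernel; simpl; ring).
    now apply Im_div_pos. }
  assert (S : (0 < sin h)%R) by (apply sin_gt_0; lra).
  assert (G : forall z1 z2 z3 z4 : C, 0 < Im z1 -> 0 < Im z2 -> 0 < Im z3 -> 0 < Im z4 ->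
    0 < Im (z1 + z2 + z3 + z4)).
  { intros [? ?] [? ?] [? ?] [? ?]; simpl; lra. }
  unfold contour_coef, rect_int.
  apply G; (apply seg_int_Im_pos; [assumption|]);
    intros u Hu; (apply K; [auto|]); destruct Hu as (t & Ht & ->);
    unfold line, Re, Im; simpl.
  - match goal with |- context [sin ?x] => replace x with (- h)%R by ring end.
    rewrite sin_neg. match goal with |- context [exp ?x] => assert (X := exp_pos x); set (e := exp x) in * end.
    match goal with |- context [cos ?x] => set (c := cos x) end.
    match goal with |- _ < ?g => replace g with ((a + M) * (e * sin h))%R by ring end.
    apply Rmult_lt_0_compat; [lra|now apply Rmult_lt_0_compat].
  - match goal with |- context [exp ?x] => replace x with (- a)%R by ring end.
    assert (X : exp (- a) < 1) by (rewrite <- exp_0; apply exp_increasing; lra).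
    assert (Y := exp_pos (- a)).
    match goal with |- context [cos ?x] => assert (Z := COS_bound x); set (c := cos x) in * end.
    match goal with |- context [sin ?x] => set (s := sin x) end.
    match goal with |- _ < ?g => replace g with ((2 * h) * (1 - exp (- a) * c))%R by ring end.
    apply Rmult_lt_0_compat; [lra|nra].
  - match goal with |- context [sin ?x] => replace x with h by ring end.
    match goal with |- context [exp ?x] => assert (X := exp_pos x); set (e := exp x) in * end.
    match goal with |- context [cos ?x] => set (c := cos x) end.
    match goal with |- _ < ?g => replace g with ((a + M) * (e * sin h))%R by ring end.
    apply Rmult_lt_0_compat; [lra|now apply Rmult_lt_0_compat].
  - match goal with |- context [exp ?x] => replace x with M by ring end.
    match goal with |- context [cos ?x] => assert (Z := cos_le_cos_between h x ltac:(lra) ltac:(nra)); set (c := cos x) in * end.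
    match goal with |- context [sin ?x] => set (s := sin x) end.
    match goal with |- _ < ?g => replace g with ((2 * h) * (exp M * c - 1))%R by ring end.
    assert (Y := exp_pos M). apply Rmult_lt_0_compat; [lra|nra].
Qed.

End ContourCoefficients.

(** * Cauchy theorem for a rectangle *)

Definition plane_cont (g : R * R -> R) (u : R * R) : Prop := continuous g u.

(** Joint continuity in both coordinates, needed to differentiate an integral with
    respect to a parameter. *)
Definition C_cont (F : C -> C) (u : C) : Prop :=
  plane_cont (fun z => Re (F z)) u /\ plane_cont (fun z => Im (F z)) u.

Lemma plane_cont_comp (f : R -> R) g u d :
  is_derive f (g u) d -> plane_cont g u -> plane_cont (fun z => f (g z)) u.
Proof.
  intros Hf Hg. apply (continuous_comp g f); [exact Hg|].
  apply (ex_derive_continuous (V := R_NormedModule)). now exists d.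
Qed.

Lemma plane_cont_plus f g u : plane_cont f u -> plane_cont g u ->
  plane_cont (fun z => f z + g z)%R u.
Proof. apply (continuous_plus (V := R_NormedModule)). Qed.

Lemma plane_cont_opp f u : plane_cont f u -> plane_cont (fun z => - f z)%R u.
Proof. apply (continuous_opp (V := R_NormedModule)). Qed.

Lemma plane_cont_mult f g u : plane_cont f u -> plane_cont g u ->
  plane_cont (fun z => f z * g z)%R u.
Proof. apply (continuous_mult (K := R_AbsRing)). Qed.

Lemma C_cont_id u : C_cont (fun u => u) u.
Proof. split; [apply continuous_fst|apply continuous_snd]. Qed.

Lemma C_cont_const k u : C_cont (fun _ => k) u.
Proof. split; apply continuous_const. Qed.

Lemma C_cont_plus F G u : C_cont F u -> C_cont G u -> C_cont (fun u => F u + G u) u.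
Proof. intros [] []; split; simpl; now apply plane_cont_plus. Qed.

Lemma C_cont_opp F u : C_cont F u -> C_cont (fun u => - F u) u.
Proof. intros []; split; simpl; now apply plane_cont_opp. Qed.

Lemma C_cont_mult F G u : C_cont F u -> C_cont G u -> C_cont (fun u => F u * G u) u.
Proof.
  intros [] []; split; simpl.
  - apply plane_cont_plus; [|apply plane_cont_opp]; now apply plane_cont_mult.
  - apply plane_cont_plus; now apply plane_cont_mult.
Qed.

Lemma C_cont_pow F u n : C_cont F u -> C_cont (fun u => F u ^ n) u.
Proof.
  intros H; induction n as [|n IH]; simpl; [apply C_cont_const|now apply C_cont_mult].
Qed.

Lemma C_cont_exp F u : C_cont F u -> C_cont (fun u => Cexp (F u)) u.
Proof.
  intros []; split; simpl; apply plane_cont_mult.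
  - eapply plane_cont_comp; [apply is_derive_exp|assumption].
  - eapply plane_cont_comp; [apply is_derive_cos|assumption].
  - eapply plane_cont_comp; [apply is_derive_exp|assumption].
  - eapply plane_cont_comp; [apply is_derive_sin|assumption].
Qed.

Lemma C_cont_inv (F : C -> C) u : F u <> 0 -> C_cont F u -> C_cont (fun u => / F u) u.
Proof.
  intros N [H1 H2]. assert (P := Cmod2_pos _ N).
  assert (D : plane_cont (fun z => / (Re (F z) ^ 2 + Im (F z) ^ 2))%R u).
  { apply (plane_cont_comp Rinv (fun z => Re (F z) ^ 2 + Im (F z) ^ 2)%R u
      (- / (Re (F u) ^ 2 + Im (F u) ^ 2) ^ 2)%R).
    - auto_derive; [lra|]. field; lra.
    - apply plane_cont_plus; (apply plane_cont_mult; [|apply plane_cont_mult; [|apply continuous_const]]);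
        assumption. }
  split; unfold Cinv; simpl; unfold Rdiv; (apply plane_cont_mult; [|exact D]).
  - exact H1.
  - now apply plane_cont_opp.
Qed.

Lemma C_cont_2d F u : C_cont F u ->
  continuity_2d_pt (fun y x => Re (F (x, y))) (Im u) (Re u) /\
  continuity_2d_pt (fun y x => Im (F (x, y))) (Im u) (Re u).
Proof.
  intros [H1 H2].
  assert (K : forall g : R * R -> R, plane_cont g u -> continuity_2d_pt (fun y x => g (x, y)) (Im u) (Re u)).
  { intros g Hg. apply continuity_2d_pt_filterlim.
    set (RR := prod_UniformSpace R_UniformSpace R_UniformSpace).
    apply (continuous_comp (U := RR) (V := RR) (fun z : R * R => (snd z, fst z)) g (Im u, Re u)).
    - apply (continuous_comp_2 (U := RR) (V := R_UniformSpace) (W := R_UniformSpace) (X := RR) snd fst (fun a b => (a, b))).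
      + apply continuous_snd.
      + apply continuous_fst.
      + apply (continuous_ext (fun z => z)); [intros [? ?]; reflexivity|apply continuous_id].
    - simpl. destruct u; exact Hg. }
  split; [apply (K (fun z => Re (F z)))|apply (K (fun z => Im (F z)))]; assumption.
Qed.

Lemma curve_cont_max f a b : a <= b -> (forall t, a <= t <= b -> curve_cont f t) ->
  exists m, a <= m <= b /\ forall t, a <= t <= b -> Cmod (f t) <= Cmod (f m).
Proof.
  intros L Hc.
  destruct (continuity_ab_maj (fun t => Re (f t) ^ 2 + Im (f t) ^ 2)%R a b L) as (m & Hm & Im).
  - intros t Ht. apply continuity_pt_filterlim. destruct (Hc t Ht) as [H1 H2].
    assert (S : forall g, continuous g t -> continuous (fun t => g t ^ 2)%R t).
    { intros g Hg. apply (continuous_ext (fun t => mult (g t) (g t))); [intros; unfold mult; simpl; ring|].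
      now apply (continuous_mult (K := R_AbsRing)). }
    apply (continuous_plus (V := R_NormedModule) (fun t => Re (f t) ^ 2)%R (fun t => Im (f t) ^ 2)%R); now apply S.
  - exists m. split; [exact Im|]. intros t Ht.
    apply Rsqr_incr_0_var; [|apply Cmod_ge_0]. rewrite !Rsqr_pow2, !Cmod2_alt. now apply Hm.
Qed.

Lemma Cint_Chasles f a b c : a <= b <= c -> (forall t, a <= t <= c -> curve_cont f t) ->
  Cint f a c = Cint f a b + Cint f b c.
Proof.
  intros L H.
  destruct (ex_RInt_curve_cont f a b) as [H1 H2]; [lra|intros; apply H; lra|].
  destruct (ex_RInt_curve_cont f b c) as [H3 H4]; [lra|intros; apply H; lra|].
  apply C_ext; unfold Cint; simpl; symmetry;
  apply (RInt_Chasles (V := R_CompleteNormedModule)); assumption.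
Qed.

Lemma Cint_swap f a b : a <= b -> (forall t, a <= t <= b -> curve_cont f t) ->
  Cint f b a = - Cint f a b.
Proof.
  intros L H. destruct (ex_RInt_curve_cont f a b L H) as [H1 H2].
  apply C_ext; unfold Cint; simpl; symmetry; now apply (opp_RInt_swap (V := R_CompleteNormedModule)).
Qed.

Lemma Cint_affine g p q : (forall t, Rmin p q <= t <= Rmax p q -> curve_cont g t) ->
  RtoC (q - p) * Cint (fun t => g (p + t * (q - p))%R) 0 1 = Cint g p q.
Proof.
  intros H.
  assert (K : forall r : R -> R, (forall t, Rmin p q <= t <= Rmax p q -> continuous r t) ->
    ((q - p) * RInt (fun t => r (p + t * (q - p))) 0 1 = RInt r p q)%R).
  { intros r Hr.
    assert (E : forall t : R, ((q - p) * t + p)%R = (p + t * (q - p))%R) by (intros; ring).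
    assert (X : ex_RInt r ((q - p) * 0 + p) ((q - p) * 1 + p)).
    { replace ((q - p) * 0 + p)%R with p by ring. replace ((q - p) * 1 + p)%R with q by ring.
      now apply (ex_RInt_continuous (V := R_CompleteNormedModule)). }
    assert (A := RInt_comp_lin (V := R_CompleteNormedModule) r (q - p) p 0 1 X).
    replace ((q - p) * 0 + p)%R with p in A by ring. replace ((q - p) * 1 + p)%R with q in A by ring.
    rewrite <- A. symmetry.
    destruct (Req_dec p q) as [<-|N].
    - rewrite Rminus_diag.
      transitivity (RInt (fun _ => 0%R) 0 1).
      + apply RInt_ext; intros t _. apply (Rmult_0_l (r (0 * t + p)%R)).
      + rewrite RInt_const. unfold scal; simpl; unfold mult; simpl. ring.
    - transitivity (RInt (fun t => scal (q - p)%R (r (p + t * (q - p))%R)) 0 1).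
      + apply RInt_ext; intros t _. now rewrite E.
      + apply (RInt_scal (V := R_CompleteNormedModule)).
        assert (B := ex_RInt_comp_lin (V := R_NormedModule) r (q - p) p 0 1 X).
        apply (ex_RInt_scal (V := R_NormedModule) _ _ _ (/ (q - p))) in B.
        eapply ex_RInt_ext; [|exact B]. intros t _. unfold scal; simpl; unfold mult; simpl.
        rewrite E. field. lra. }
  apply C_ext; unfold Cint; simpl.
  - rewrite (K (fun t => Re (g t))); [ring|exact (fun t Ht => proj1 (H t Ht))].
  - rewrite (K (fun t => Im (g t))); [ring|exact (fun t Ht => proj2 (H t Ht))].
Qed.

Lemma seg_int_horizontal f x0 x1 y :
  (forall x, Rmin x0 x1 <= x <= Rmax x0 x1 -> curve_cont (fun x => f (x, y)) x) ->
  seg_int f (x0, y) (x1, y) = Cint (fun x => f (x, y)) x0 x1.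
Proof.
  intros H. rewrite <- (Cint_affine (fun x => f (x, y))) by exact H.
  unfold seg_int. f_equal.
  - apply C_ext; unfold Re, Im; simpl; ring.
  - apply Cint_ext; [lra|]. intros t _. f_equal. apply C_ext; unfold line, Re, Im; simpl; ring.
Qed.

Lemma seg_int_vertical f x y0 y1 :
  (forall y, Rmin y0 y1 <= y <= Rmax y0 y1 -> curve_cont (fun y => f (x, y)) y) ->
  seg_int f (x, y0) (x, y1) = Ci * Cint (fun y => f (x, y)) y0 y1.
Proof.
  intros H. rewrite <- (Cint_affine (fun y => f (x, y))) by exact H.
  unfold seg_int. rewrite Cmult_assoc. f_equal.
  - apply C_ext; unfold Re, Im; simpl; ring.
  - apply Cint_ext; [lra|]. intros t _. f_equal. apply C_ext; unfold line, Re, Im; simpl; ring.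
Qed.

Lemma hol_deriv_horizontal f l x y : hol_deriv f (x, y) l -> curve_deriv (fun x => f (x, y)) x l.
Proof.
  intros H. eapply curve_deriv_eq.
  - apply (H (fun x => (x, y)) x 1); [reflexivity|].
    split; simpl; [apply @is_derive_id|apply @is_derive_const].
  - ring.
Qed.

Lemma hol_deriv_vertical f l x y : hol_deriv f (x, y) l -> curve_deriv (fun y => f (x, y)) y (l * Ci).
Proof.
  intros H. apply (H (fun y => (x, y)) y Ci); [reflexivity|].
  split; simpl; [apply @is_derive_const|apply @is_derive_id].
Qed.

(** Differentiation under the integral sign replaces d/dy by i d/dx, which the
    fundamental theorem of calculus integrates. *)
Lemma curve_deriv_horizontal_integral f f' x0 x1 y0 r : x0 <= x1 -> 0 < r ->
  (forall x y, x0 - r < x < x1 + r -> Rabs (y - y0) < r -> hol_deriv f (x, y) (f' (x, y)) /\ C_cont f' (x, y)) ->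
  curve_deriv (fun y => Cint (fun x => f (x, y)) x0 x1) y0 (Ci * (f (x1, y0) - f (x0, y0))).
Proof.
  intros L Hr H.
  assert (H0 : forall x, x0 <= x <= x1 -> hol_deriv f (x, y0) (f' (x, y0)) /\ C_cont f' (x, y0)).
  { intros x Hx; apply H; [lra|]. rewrite Rminus_diag, Rabs_R0; exact Hr. }
  assert (IC : forall x, x0 <= x <= x1 -> curve_cont (fun x => f' (x, y0)) x).
  { intros x Hx. destruct (H0 x Hx) as [_ [K1 K2]].
    assert (A : continuous (fun x : R => (x, y0) : R * R) x).
    { apply (continuous_comp_2 (fun x : R => x) (fun _ => y0) (fun a b : R => (a, b))).
        - apply continuous_id. - apply continuous_const.
        - apply (continuous_ext (fun z : R * R => z)); [intros [? ?]; reflexivity|apply continuous_id]. }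
      split; [apply (continuous_comp (fun x => (x, y0)) (fun z => Re (f' z)))
             |apply (continuous_comp (fun x => (x, y0)) (fun z => Im (f' z)))]; assumption. }
  assert (I : Cint (fun x => f' (x, y0)) x0 x1 = f (x1, y0) - f (x0, y0)).
  { apply (Cint_deriv (fun x => f (x, y0))); [exact L| |exact IC].
    intros x Hx; apply hol_deriv_horizontal, H0, Hx. }
  assert (LL : forall t : R, Rmin x0 x1 <= t <= Rmax x0 x1 -> x0 <= t <= x1).
  { intros t; rewrite Rmin_left, Rmax_right by exact L; auto. }
  assert (LY : locally y0 (fun y => Rabs (y - y0) < r)).
  { exists (mkposreal r Hr). intros y Hy; exact Hy. }
  assert (D : forall x y, x0 - r < x < x1 + r -> Rabs (y - y0) < r ->
     is_derive (fun y => Re (f (x, y))) y (- Im (f' (x, y)))%R /\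
     is_derive (fun y => Im (f (x, y))) y (Re (f' (x, y)))).
  { intros x y Hx Hy. destruct (hol_deriv_vertical _ _ _ _ (proj1 (H x y Hx Hy))) as [D1 D2].
    split; [evar_last; [exact D1|]|evar_last; [exact D2|]]; unfold Re, Im; simpl; ring. }
  assert (EX : forall y, Rabs (y - y0) < r -> ex_RInt (fun x => Re (f (x, y))) x0 x1 /\ ex_RInt (fun x => Im (f (x, y))) x0 x1).
  { intros y Hy. apply (ex_RInt_curve_cont (fun x => f (x, y)) x0 x1 L).
    intros x Hx. eapply curve_deriv_cont, hol_deriv_horizontal, (H x y); [lra|exact Hy]. }
  rewrite <- I.
  assert (CI := fun x Hx => C_cont_2d _ _ (proj2 (H0 x Hx))). cbv [Re Im fst snd] in CI.
  assert (PR : forall (g : C -> R) (g' : C -> R),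
    (forall x y, x0 - r < x < x1 + r -> Rabs (y - y0) < r -> is_derive (fun y => g (x, y)) y (g' (x, y))) ->
    (forall x, x0 <= x <= x1 -> continuity_2d_pt (fun y x => g' (x, y)) y0 x) ->
    (forall y, Rabs (y - y0) < r -> ex_RInt (fun x => g (x, y)) x0 x1) ->
    is_derive (fun y => RInt (fun x => g (x, y)) x0 x1) y0 (RInt (fun x => g' (x, y0)) x0 x1)).
  { intros g g' Hg Hc Hi.
    evar_last.
    - apply (is_derive_RInt_param (fun y x => g (x, y)) x0 x1 y0).
      + revert LY; apply filter_imp. intros y Hy t Ht. exists (g' (t, y)).
        assert (Lt := LL t Ht). apply Hg; [lra|exact Hy].
      + intros t Ht. assert (Lt := LL t Ht).
        apply (continuity_2d_pt_ext_loc (fun y x => g' (x, y))); [|now apply Hc].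
        exists (mkposreal r Hr). simpl. intros u v Hu Hv. symmetry.
        apply is_derive_unique, Hg; [|exact Hu].
        apply Rabs_def2 in Hv. lra.
      + revert LY; apply filter_imp. exact Hi.
    - apply RInt_ext. intros x Hx. rewrite Rmin_left, Rmax_right in Hx by exact L.
      apply is_derive_unique, Hg; [lra|]. rewrite Rminus_diag, Rabs_R0; exact Hr. }
  split.
  - evar_last.
    + apply (PR (fun z => Re (f z)) (fun z => - Im (f' z))%R).
      * intros x y Hx Hy; now apply D.
      * intros x Hx. destruct (CI x Hx) as [_ K].
        apply (continuity_2d_pt_opp (fun y x => snd (f' (x, y)))), K.
      * exact (fun y Hy => proj1 (EX y Hy)).
    + unfold Cint; simpl.
      destruct (ex_RInt_curve_cont (fun x => f' (x, y0)) x0 x1 L IC) as [X1 X2].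
      rewrite (RInt_opp (V := R_CompleteNormedModule)) by exact X2.
      unfold opp; simpl. match goal with |- ?l = ?r => change (@eq R l r) end. ring.
  - evar_last.
    + apply (PR (fun z => Im (f z)) (fun z => Re (f' z))).
      * intros x y Hx Hy; now apply D.
      * intros x Hx. apply (CI x Hx).
      * exact (fun y Hy => proj2 (EX y Hy)).
    + unfold Cint; simpl. now rewrite Rmult_0_l, Rmult_1_l, Rplus_0_l.
Qed.

Lemma curve_cont_scal k f t : curve_cont f t -> curve_cont (fun t => k * f t) t.
Proof.
  intros [H1 H2].
  assert (S : forall (x : R) g, continuous g t -> continuous (fun t => x * g t)%R t).
  { intros x g Hg. apply (continuous_mult (K := R_AbsRing) (fun _ => x) g); [apply continuous_const|exact Hg]. }
  split; simpl.
  - apply (continuous_minus (V := R_NormedModule)); now apply S.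
  - apply (continuous_plus (V := R_NormedModule)); now apply S.
Qed.

Lemma curve_cont_plus f g t : curve_cont f t -> curve_cont g t -> curve_cont (fun t => f t + g t) t.
Proof.
  intros [H1 H2] [H3 H4]; split; simpl.
  - exact (continuous_plus (V := R_NormedModule) _ _ _ H1 H3).
  - exact (continuous_plus (V := R_NormedModule) _ _ _ H2 H4).
Qed.

Lemma curve_cont_opp f t : curve_cont f t -> curve_cont (fun t => - f t) t.
Proof.
  intros [H1 H2]; split; simpl.
  - apply (continuous_opp (V := R_NormedModule) (fun t => Re (f t))), H1.
  - apply (continuous_opp (V := R_NormedModule) (fun t => Im (f t))), H2.
Qed.

Lemma Cint_minus f g a b : a <= b ->
  (forall t, a <= t <= b -> curve_cont f t) -> (forall t, a <= t <= b -> curve_cont g t) ->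
  Cint (fun t => f t - g t) a b = Cint f a b - Cint g a b.
Proof.
  intros L Hf Hg.
  destruct (ex_RInt_curve_cont f a b L Hf), (ex_RInt_curve_cont g a b L Hg).
  apply C_ext; unfold Cint; simpl;
  apply (RInt_minus (V := R_CompleteNormedModule)); assumption.
Qed.

Lemma eq_0_le_linear (x K h : R) : 0 < h -> 0 <= x -> (forall e, 0 < e < h -> x <= K * e) -> x = 0%R.
Proof.
  intros Hh Hx H. apply Rle_antisym; [|exact Hx]. apply Rnot_lt_le. intros P.
  assert (KP : (0 < Rabs K + 1)%R) by (generalize (Rabs_pos K); lra).
  set (e := Rmin (h / 2) (x / (2 * (Rabs K + 1)))).
  assert (He : 0 < e < h).
  { split.
    - apply Rmin_glb_lt; [lra|]. apply Rdiv_lt_0_compat; lra.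
    - eapply Rle_lt_trans; [apply Rmin_l|lra]. }
  specialize (H e He).
  assert (e * (2 * (Rabs K + 1)) <= x)%R.
  { apply (Rle_trans _ (x / (2 * (Rabs K + 1)) * (2 * (Rabs K + 1)))).
    - apply Rmult_le_compat_r; [lra|apply Rmin_r].
    - right; field; lra. }
  assert (K <= Rabs K)%R by apply Rle_abs. nra.
Qed.

(** The function may fail to be differentiable on the real axis.  By
    [curve_deriv_horizontal_integral] the parts of the rectangle above height [e]
    and below height [-e] contribute 0, and the middle strip contributes O(e)
    because the values on its two long sides differ by O(e). *)
Lemma cauchy_rectangle f f' M a h : 0 < M -> 0 < a -> 0 < h < PI ->
  (forall u, 0 < Rabs (Im u) < PI -> hol_deriv f u (f' u) /\ C_cont f' u) ->
  (forall y, - PI < y < PI -> exists l, hol_deriv f ((- M)%R, y) l) ->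
  (forall y, - PI < y < PI -> exists l, hol_deriv f (a, y) l) ->
  (exists K, forall x e, - M <= x <= a -> 0 < e < h -> Cmod (f (x, e) - f (x, (- e)%R)) <= K * e) ->
  rect_int M a h f = 0.
Proof.
  intros HM Ha Hh Hf HfM Hfa [K HK].
  assert (cM : forall y, - PI < y < PI -> curve_cont (fun y => f ((- M)%R, y)) y).
  { intros y Hy; destruct (HfM y Hy) as [l Hl]. eapply curve_deriv_cont, hol_deriv_vertical, Hl. }
  assert (ca : forall y, - PI < y < PI -> curve_cont (fun y => f (a, y)) y).
  { intros y Hy; destruct (Hfa y Hy) as [l Hl]. eapply curve_deriv_cont, hol_deriv_vertical, Hl. }
  assert (ch : forall y, 0 < Rabs y < PI -> forall x, curve_cont (fun x => f (x, y)) x).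
  { intros y Hy x. eapply curve_deriv_cont, hol_deriv_horizontal, (proj1 (Hf (x, y) Hy)). }
  assert (Ah : forall e, 0 < e <= h -> 0 < Rabs e < PI /\ 0 < Rabs (- e) < PI).
  { intros e He. rewrite Rabs_Ropp, Rabs_pos_eq by lra. lra. }
  set (H := fun y => Cint (fun x => f (x, y)) (- M) a).
  set (g := fun t => Ci * (f (a, t) - f ((- M)%R, t))).
  assert (cg : forall t, - PI < t < PI -> curve_cont g t).
  { intros t Ht. apply (curve_cont_scal Ci (fun t => f (a, t) - f ((- M)%R, t))).
    apply (curve_cont_plus (fun t => f (a, t)) (fun t => - f ((- M)%R, t))); [|apply curve_cont_opp]; auto. }
  assert (dH : forall y, 0 < Rabs y < PI -> curve_deriv H y (g y)).
  { intros y Hy. apply (curve_deriv_horizontal_integral f f' (- M) a y (Rmin (Rabs y) (PI - Rabs y))); [lra| |].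
    - apply Rmin_glb_lt; lra.
    - intros x y' _ Hy'. apply Hf. simpl. unfold Im; simpl.
      assert (L1 := Rmin_l (Rabs y) (PI - Rabs y)). assert (L2 := Rmin_r (Rabs y) (PI - Rabs y)).
      revert Hy' L1 L2. generalize (Rmin (Rabs y) (PI - Rabs y)). intros r.
      unfold Rabs; repeat destruct Rcase_abs; lra. }
  assert (E0 : rect_int M a h f = H (- h)%R - H h + Cint g (- h) h).
  { unfold rect_int.
    rewrite seg_int_horizontal, seg_int_vertical, seg_int_horizontal, seg_int_vertical.
    2: { intros y. rewrite Rmin_right, Rmax_left by lra. intros; apply cM; lra. }
    2: { intros x _; apply ch, Ah; lra. }
    2: { intros y. rewrite Rmin_left, Rmax_right by lra. intros; apply ca; lra. }
    2: { intros x _; apply ch, Ah; lra. }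
    rewrite (Cint_swap (fun x => f (x, h)) (- M) a); [|lra|intros; apply ch, Ah; lra].
    rewrite (Cint_swap (fun y => f ((- M)%R, y)) (- h) h); [|lra|intros; apply cM; lra].
    unfold g. rewrite Cint_scal; [|lra|].
    - rewrite Cint_minus; [|lra|intros; apply ca; lra|intros; apply cM; lra].
      unfold H; ring.
    - intros t Ht.
      apply (curve_cont_plus (fun t => f (a, t)) (fun t => - f ((- M)%R, t)));
      [apply ca|apply curve_cont_opp, cM]; lra. }
  destruct (curve_cont_max g (- h) h) as (m & _ & HB); [lra|intros; apply cg; lra|].
  set (B := Cmod (g m)) in *.
  apply Cmod_eq_0. apply (eq_0_le_linear _ (2 * (a - - M) * K + 2 * 2 * B) h); [lra|apply Cmod_ge_0|].
  intros e He.
  assert (E1 : rect_int M a h f = Cint g (- e) e - (H e - H (- e)%R)).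
  { rewrite E0.
    rewrite (Cint_Chasles g (- h) (- e) h); [|lra|intros; apply cg; lra].
    rewrite (Cint_Chasles g (- e) e h); [|lra|intros; apply cg; lra].
    rewrite (Cint_deriv H g (- h) (- e)); [|lra| |intros; apply cg; lra].
    - rewrite (Cint_deriv H g e h); [|lra| |intros; apply cg; lra].
      + ring.
      + intros t Ht; apply dH, Ah; lra.
    - intros t Ht; apply dH. rewrite <- (Ropp_involutive t). apply Ah; lra. }
  rewrite E1.
  eapply Rle_trans; [apply Cmod_triangle|]. rewrite Cmod_opp.
  assert (B1 : Cmod (Cint g (- e) e) <= 2 * (e - - e) * B).
  { apply Cint_bound; [lra|intros; apply cg; lra|intros; apply HB; lra]. }
  assert (B2 : Cmod (H e - H (- e)%R) <= 2 * (a - - M) * (K * e)).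
  { unfold H. rewrite <- Cint_minus; [|lra|intros; apply ch, Ah; lra..].
    apply Cint_bound; [lra| |intros; apply HK; lra].
    intros t _.
    apply (curve_cont_plus (fun x => f (x, e)) (fun x => - f (x, (- e)%R)));
      [|apply curve_cont_opp]; apply ch, Ah; lra. }
  lra.
Qed.

(** * The removable singularity at 0 *)

(** The entire function (1 - e^(-u)) / u; the integral form gives a lower bound
    near 0 without a limit. *)
Definition Eratio (u : C) : C := Cint (fun t => Cexp (- (RtoC t * u))) 0 1.

Lemma curve_deriv_ray (u : C) (t : R) : curve_deriv (fun t => RtoC t * u) t u.
Proof.
  split; simpl; (evar_last; [auto_derive; auto|unfold Re, Im; simpl; ring]).
Qed.

Lemma curve_cont_exp_ray (u : C) (t : R) : curve_cont (fun t => Cexp (- (RtoC t * u))) t.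
Proof. eapply curve_deriv_cont, curve_deriv_exp, curve_deriv_opp, curve_deriv_ray. Qed.

Lemma Cexp_0 : Cexp 0 = 1.
Proof. unfold Cexp; simpl. rewrite exp_0, cos_0, sin_0. apply C_ext; simpl; ring. Qed.

Lemma Cexp_plus z w : Cexp (z + w) = Cexp z * Cexp w.
Proof.
  apply C_ext; unfold Cexp, Re, Im; simpl; rewrite exp_plus, ?cos_plus, ?sin_plus; ring.
Qed.

Lemma Cmod_Cexp z : Cmod (Cexp z) = exp (Re z).
Proof.
  apply Rsqr_inj; [apply Cmod_ge_0|left; apply exp_pos|]. rewrite !Rsqr_pow2, Cmod2_alt.
  assert (S2 := sin2_cos2_mult (Im z)). unfold Cexp; simpl.
  transitivity (exp (Re z) * exp (Re z) * (sin (Im z) * sin (Im z) + cos (Im z) * cos (Im z)))%R;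
    [ring|rewrite S2; ring].
Qed.

Lemma Emap_Eratio u : Emap u = u * Eratio u.
Proof.
  unfold Eratio. rewrite <- Cint_scal; [|lra|intros; apply curve_cont_exp_ray].
  rewrite (Cint_deriv (fun t => - Cexp (- (RtoC t * u)))).
  - unfold Emap. rewrite Cmult_1_l, Cmult_0_l, Copp_0, Cexp_0. ring.
  - lra.
  - intros t _. eapply curve_deriv_eq.
    + apply curve_deriv_opp, curve_deriv_exp, curve_deriv_opp, curve_deriv_ray.
    + cbv beta; ring.
  - intros t _. apply curve_cont_scal, curve_cont_exp_ray.
Qed.

Lemma Re_Eratio_ge a h u : 0 < a -> 0 <= h < PI / 2 -> Re u <= a -> Rabs (Im u) <= h ->
  exp (- a) * cos h <= Re (Eratio u).
Proof.
  intros Ha Hh Hx Hy. unfold Eratio, Cint. simpl.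
  replace (exp (- a) * cos h)%R with (RInt (fun _ => exp (- a) * cos h)%R 0 1).
  2: { rewrite RInt_const. unfold scal; simpl; unfold mult; simpl. ring. }
  destruct (ex_RInt_curve_cont (fun t => Cexp (- (RtoC t * u))) 0 1) as [H1 _];
    [lra|intros; apply curve_cont_exp_ray|].
  apply RInt_le; [lra|apply ex_RInt_const|exact H1|].
  intros t Ht.
  change (exp (- a) * cos h <= exp (- (t * Re u - 0 * Im u)) * cos (- (t * Im u + 0 * Re u)))%R.
  assert (C1 : cos h <= cos (- (t * Im u + 0 * Re u))).
  { rewrite cos_neg. replace (t * Im u + 0 * Re u)%R with (t * Im u)%R by ring.
    apply Rabs_le_between in Hy. apply cos_le_cos_between; [lra|nra]. }
  assert (C2 : exp (- a) <= exp (- (t * Re u - 0 * Im u))).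
  { apply exp_mono. nra. }
  assert (0 <= cos h) by (apply cos_ge_0; lra).
  apply Rmult_le_compat; try assumption. left; apply exp_pos.
Qed.

Lemma Eratio_conj_diff M x e : - M <= x -> 0 < M -> 0 < e < PI ->
  Cmod (Eratio (x, e) - Eratio (x, (- e)%R)) <= 4 * exp M * e.
Proof.
  intros Hx HM He. unfold Eratio.
  rewrite <- Cint_minus; [|lra|intros; apply curve_cont_exp_ray..].
  replace (4 * exp M * e)%R with (2 * (1 - 0) * (exp M * (2 * e)))%R by ring.
  apply Cint_bound; [lra| |].
  - intros t _. apply (curve_cont_plus (fun t => Cexp (- (RtoC t * (x, e))))
      (fun t => - Cexp (- (RtoC t * (x, (- e)%R))))); [|apply curve_cont_opp]; apply curve_cont_exp_ray.
  - intros t Ht. unfold Cexp. simpl. unfold Re, Im. simpl.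
    replace (- (t * x - 0 * - e))%R with (- (t * x))%R by ring.
    replace (- (t * x - 0 * e))%R with (- (t * x))%R by ring.
    replace (- (t * - e + 0 * x))%R with (t * e)%R by ring.
    replace (- (t * e + 0 * x))%R with (- (t * e))%R by ring.
    rewrite cos_neg, sin_neg.
    assert (S0 : (0 <= sin (t * e))%R) by (apply sin_ge_0; nra).
    assert (S1 : (sin (t * e) <= e)%R).
    { destruct (Req_dec (t * e) 0) as [Z|Z]; [rewrite Z, sin_0; lra|].
      assert (sin (t * e) < t * e)%R by (apply sin_lt_x; nra). nra. }
    eapply Rle_trans; [apply Cmod_le_abs|]. unfold Re, Im; simpl.
    set (p := exp (- (t * x))). set (q := cos (t * e)). set (w := sin (t * e)) in *.
    replace (p * q + - (p * q))%R with 0%R by ring.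
    replace (p * - w + - (p * w))%R with (- (p * (2 * w)))%R by ring.
    rewrite Rabs_R0, Rabs_Ropp, Rplus_0_l, Rabs_pos_eq.
    + apply Rmult_le_compat; try lra; [left; apply exp_pos|]. unfold p.
      apply exp_mono. nra.
    + apply Rmult_le_pos; [left; apply exp_pos|lra].
Qed.

Lemma Cpow_diff_le (u v : C) (r : R) n : Cmod u <= r -> Cmod v <= r ->
  Cmod (u ^ n - v ^ n) <= INR n * r ^ pred n * Cmod (u - v).
Proof.
  intros Hu Hv. assert (0 <= r) by (eapply Rle_trans; [apply Cmod_ge_0|exact Hu]).
  induction n as [|n IH].
  - simpl. replace (1 - 1) with (RtoC 0) by ring. rewrite Cmod_0. lra.
  - replace (u ^ S n - v ^ S n) with (u * (u ^ n - v ^ n) + (u - v) * v ^ n) by (simpl; ring).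
    eapply Rle_trans; [apply Cmod_triangle|]. rewrite !Cmod_mult, Cmod_pow.
    assert (P1 : (Cmod v ^ n <= r ^ n)%R) by (apply pow_incr; split; [apply Cmod_ge_0|exact Hv]).
    assert (P2 := Cmod_ge_0 (u - v)). assert (P3 := Cmod_ge_0 u). assert (P4 := Cmod_ge_0 (u ^ n - v ^ n)).
    assert (P5 : (Cmod u * Cmod (u ^ n - v ^ n) <= r * (INR n * r ^ pred n * Cmod (u - v)))%R)
      by (apply Rmult_le_compat; assumption).
    rewrite S_INR. simpl pred.
    replace ((INR n + 1) * r ^ n * Cmod (u - v))%R
      with (INR n * r ^ n * Cmod (u - v) + Cmod (u - v) * r ^ n)%R by ring.
    apply Rplus_le_compat; [|now apply Rmult_le_compat_l].
    eapply Rle_trans; [exact P5|]. right. destruct n; simpl; ring.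
Qed.

Lemma C_cont_Emap u : C_cont Emap u.
Proof.
  apply (C_cont_plus (fun _ => 1) (fun u => - Cexp (- u))); [apply C_cont_const|].
  apply C_cont_opp, (C_cont_exp (fun u => - u)), C_cont_opp, C_cont_id.
Qed.

Lemma C_cont_kernel j n u : Emap u <> 0 -> C_cont (kernel j n) u.
Proof.
  intros N. apply C_cont_mult.
  - apply C_cont_pow, C_cont_id.
  - apply (C_cont_pow (fun u => / Emap u)), C_cont_inv; [exact N|apply C_cont_Emap].
Qed.

(** u^(j+1) / (1 - e^(-u)) has only a removable singularity in the strip
    |Im u| < pi. *)
Lemma contour_coef_removable M a h j : 0 < M -> 0 < a -> 0 < h < PI / 2 -> contour_coef M a h (S j) 1 = 0.
Proof.
  intros HM Ha Hh. assert (HP := PI_RGT_0).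
  apply (cauchy_rectangle _ (kernel' (S j) 1)); try lra.
  - intros u Hu. assert (N : Emap u <> 0).
    { apply Emap_neq_0; [|intros ->; simpl in Hu; rewrite Rabs_R0 in Hu; lra].
      revert Hu; unfold Rabs; destruct Rcase_abs; lra. }
    split; [now apply hol_kernel|].
    unfold kernel'.
    apply (C_cont_plus (fun u => RtoC (INR (S j)) * kernel (pred (S j)) 1 u)
      (fun u => RtoC (- INR 1) * kernel (S j) 2 u + RtoC (INR 1) * kernel (S j) 1 u)).
    + apply C_cont_mult; [apply C_cont_const|now apply C_cont_kernel].
    + apply (C_cont_plus (fun u => RtoC (- INR 1) * kernel (S j) 2 u) (fun u => RtoC (INR 1) * kernel (S j) 1 u));
      (apply C_cont_mult; [apply C_cont_const|now apply C_cont_kernel]).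
  - intros y Hy. eexists; apply hol_kernel, Emap_neq_0; [exact Hy|].
    intros E; apply (f_equal Re) in E; unfold Re in E; simpl in E; lra.
  - intros y Hy. eexists; apply hol_kernel, Emap_neq_0; [exact Hy|].
    intros E; apply (f_equal Re) in E; unfold Re in E; simpl in E; lra.
  - set (c := (exp (- a) * cos h)%R).
    assert (Hc : 0 < c) by (apply Rmult_lt_0_compat; [apply exp_pos|apply cos_gt_0; lra]).
    set (r := (M + a + h)%R).
    exists (INR j * r ^ pred j * 2 / c + r ^ j * (4 * exp M) / (c * c))%R.
    intros x e Hx He.
    set (u := (x, e) : C). set (v := (x, (- e)%R) : C).
    assert (Nu : u <> 0) by (intros E; apply (f_equal Im) in E; unfold Im in E; simpl in E; lra).
    assert (Nv : v <> 0) by (intros E; apply (f_equal Im) in E; unfold Im in E; simpl in E; lra).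
    assert (Gu : c <= Cmod (Eratio u)).
    { eapply Rle_trans; [apply (Re_Eratio_ge a h u); try lra|].
      - apply Hx. - unfold u, Im; simpl; rewrite Rabs_pos_eq; lra.
      - eapply Rle_trans; [apply Rle_abs|apply re_le_Cmod]. }
    assert (Gv : c <= Cmod (Eratio v)).
    { eapply Rle_trans; [apply (Re_Eratio_ge a h v); try lra|].
      - apply Hx. - unfold v, Im; simpl; rewrite Rabs_Ropp, Rabs_pos_eq; lra.
      - eapply Rle_trans; [apply Rle_abs|apply re_le_Cmod]. }
    assert (Zu : Eratio u <> 0) by (apply Cmod_gt_0; lra).
    assert (Zv : Eratio v <> 0) by (apply Cmod_gt_0; lra).
    assert (Ru : Cmod u <= r).
    { eapply Rle_trans; [apply Cmod_le_abs|]. unfold u, r, Re, Im; simpl.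
      unfold Rabs; repeat destruct Rcase_abs; lra. }
    assert (Rv : Cmod v <= r).
    { eapply Rle_trans; [apply Cmod_le_abs|]. unfold v, r, Re, Im; simpl.
      unfold Rabs; repeat destruct Rcase_abs; lra. }
    assert (Duv : Cmod (u - v) <= 2 * e).
    { eapply Rle_trans; [apply Cmod_le_abs|]. unfold u, v, Re, Im; simpl.
      unfold Rabs; repeat destruct Rcase_abs; lra. }
    assert (DE := Eratio_conj_diff M x e ltac:(lra) HM ltac:(lra)). fold u v in DE.
    assert (K : forall w : C, w <> 0 -> Eratio w <> 0 -> kernel (S j) 1 w = w ^ j / Eratio w).
    { intros w Hw HE. unfold kernel. rewrite Emap_Eratio. simpl. field. split; assumption. }
    rewrite !K by assumption.
    replace (u ^ j / Eratio u - v ^ j / Eratio v)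
      with ((u ^ j - v ^ j) * / Eratio u + (- (v ^ j * (Eratio u - Eratio v))) * / (Eratio u * Eratio v))
      by (field; split; assumption).
    eapply Rle_trans; [apply Cmod_triangle|].
    rewrite !Cmod_mult, Cmod_opp, !Cmod_inv, !Cmod_mult, Cmod_pow by (try apply Cmult_neq_0; assumption).
    assert (Pd := Cpow_diff_le u v r j Ru Rv).
    assert (r0 : 0 <= r) by (unfold r; lra).
    assert (P1 := pow_le r (pred j) r0). assert (P2 := pow_le r j r0). assert (P3 := pos_INR j).
    assert (P4 : (Cmod v ^ j <= r ^ j)%R) by (apply pow_incr; split; [apply Cmod_ge_0|exact Rv]).
    assert (P5 := exp_pos M).
    rewrite Rmult_plus_distr_r. apply Rplus_le_compat.
    + apply (Rle_trans _ (INR j * r ^ pred j * (2 * e) * / c)); [|right; field; lra].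
      apply Rmult_le_compat; [apply Cmod_ge_0| | |].
      * left; apply Rinv_0_lt_compat; lra.
      * eapply Rle_trans; [exact Pd|]. apply Rmult_le_compat_l; [|exact Duv]. now apply Rmult_le_pos.
      * apply Rinv_le_contravar; lra.
    + apply (Rle_trans _ (r ^ j * (4 * exp M * e) * / (c * c))); [|right; field; lra].
      apply Rmult_le_compat.
      * apply Rmult_le_pos; [apply pow_le|]; apply Cmod_ge_0.
      * left; apply Rinv_0_lt_compat; nra.
      * apply Rmult_le_compat; [apply pow_le, Cmod_ge_0|apply Cmod_ge_0|exact P4|exact DE].
      * apply Rinv_le_contravar; nra.
Qed.

(** * The polynomials a_n as contour integrals *)

Fixpoint Csum (f : nat -> C) (n : nat) : C :=
  match n with O => 0 | S n => Csum f n + f n end.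

Lemma Csum_ext f g n : (forall i, (i < n)%nat -> f i = g i) -> Csum f n = Csum g n.
Proof.
  induction n as [|n IH]; intros H; simpl; [reflexivity|].
  rewrite IH, H; auto.
Qed.

Lemma Csum_plus f g n : Csum (fun i => f i + g i) n = Csum f n + Csum g n.
Proof. induction n as [|n IH]; simpl; [ring|rewrite IH; ring]. Qed.

Lemma Csum_scal k f n : Csum (fun i => k * f i) n = k * Csum f n.
Proof. induction n as [|n IH]; simpl; [ring|rewrite IH; ring]. Qed.

Lemma Csum_shift f n : Csum f (S n) = f O + Csum (fun i => f (S i)) n.
Proof. induction n as [|n IH]; [simpl; ring|]. simpl in *. rewrite IH. ring. Qed.

Lemma sum_n_m_Csum (f : nat -> C) n : sum_n_m f 1 n = Csum (fun i => f (S i)) n.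
Proof.
  induction n as [|n IH].
  - rewrite sum_n_m_zero by lia. reflexivity.
  - rewrite sum_n_Sm by lia. rewrite IH. reflexivity.
Qed.

Lemma RtoC_neq_0 (x : R) : (x <> 0)%R -> RtoC x <> 0.
Proof. intros H E; apply H. now apply RtoC_inj. Qed.

Lemma RtoC_fact_neq_0 n : RtoC (INR (fact n)) <> 0.
Proof. apply RtoC_neq_0, INR_fact_neq_0. Qed.

Lemma RtoC_fact_S n : RtoC (INR (fact (S n))) = RtoC (INR (S n)) * RtoC (INR (fact n)).
Proof. rewrite <- RtoC_mult, <- mult_INR. reflexivity. Qed.

Lemma RtoC_INR_S_neq_0 n : RtoC (INR (S n)) <> 0.
Proof. apply RtoC_neq_0, not_0_INR. lia. Qed.

(** Divided powers: with them the binomial theorem has no binomial coefficients. *)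
Definition dpow (x : C) (n : nat) : C := x ^ n / RtoC (INR (fact n)).

Lemma dpow_S x n : RtoC (INR (S n)) * dpow x (S n) = x * dpow x n.
Proof.
  unfold dpow. rewrite RtoC_fact_S. simpl Cpow. field.
  split; [apply RtoC_fact_neq_0|apply RtoC_INR_S_neq_0].
Qed.

Lemma dpow_plus x y n :
  dpow (x + y) n = Csum (fun m => dpow x m * dpow y (n - m)) (S n).
Proof.
  induction n as [|n IH].
  - simpl. unfold dpow. simpl. field.
  - assert (N := RtoC_INR_S_neq_0 n).
    assert (K : forall z w : C, RtoC (INR (S n)) * z = RtoC (INR (S n)) * w -> z = w).
    { intros z w E. replace z with (/ RtoC (INR (S n)) * (RtoC (INR (S n)) * z)) by (field; exact N).
      rewrite E. field; exact N. }
    apply K. rewrite dpow_S, IH.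
    rewrite <- Csum_scal.
    transitivity (Csum (fun m => RtoC (INR m) * dpow x m * dpow y (S n - m)) (S (S n)) +
       Csum (fun m => dpow x m * (RtoC (INR (S n - m)) * dpow y (S n - m))) (S (S n))).
    2: { rewrite <- Csum_plus, <- Csum_scal. apply Csum_ext. intros m Hm.
      rewrite (minus_INR (S n) m) by lia. rewrite RtoC_minus. ring. }
    rewrite (Csum_shift (fun m => RtoC (INR m) * dpow x m * dpow y (S n - m))).
    change (Csum (fun m => dpow x m * (RtoC (INR (S n - m)) * dpow y (S n - m))) (S (S n)))
      with (Csum (fun m => dpow x m * (RtoC (INR (S n - m)) * dpow y (S n - m))) (S n) +
        dpow x (S n) * (RtoC (INR (S n - S n)) * dpow y (S n - S n))).
    rewrite Nat.sub_diag. simpl INR at 1. simpl (INR 0).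
    rewrite (Csum_ext (fun m => (x + y) * (dpow x m * dpow y (n - m)))
       (fun m => x * dpow x m * dpow y (n - m) + dpow x m * (y * dpow y (n - m)))) by (intros; ring).
    rewrite Csum_plus.
    rewrite (Csum_ext (fun i => RtoC (INR (S i)) * dpow x (S i) * dpow y (S n - S i))
       (fun m => x * dpow x m * dpow y (n - m))).
    2: { intros m _. rewrite dpow_S. reflexivity. }
    rewrite (Csum_ext (fun m => dpow x m * (RtoC (INR (S n - m)) * dpow y (S n - m)))
       (fun m => dpow x m * (y * dpow y (n - m)))).
    2: { intros m Hm. rewrite Nat.sub_succ_l by lia. rewrite dpow_S. reflexivity. }
    ring.
Qed.

(** The polynomial a_n; the index [i] stands for m - 1. *)
Definition stirling_poly (n : nat) (x : C) : C :=
  Csum (fun i => RtoC (-1) ^ (n - S i) * RtoC (INR (stirling_cycle n (n - i))) * dpow x (S i)) n.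

Lemma inner_sum_stirling_poly z n :
  Defs.inner_sum z n = stirling_poly n (Cln (Cln z)) * Defs.sigma z ^ n.
Proof.
  unfold Defs.inner_sum, stirling_poly. rewrite sum_n_m_Csum.
  rewrite Cmult_comm, <- Csum_scal. apply Csum_ext. intros i Hi.
  replace (n - S i + 1)%nat with (n - i)%nat by lia.
  replace (Defs.sigma z ^ n) with (Defs.sigma z ^ (n - S i) * Defs.sigma z ^ S i).
  2: { rewrite <- Cpow_add_r. f_equal. lia. }
  unfold Defs.tau, dpow. unfold Cdiv at 2. fold (Defs.sigma z). rewrite Cpow_mult_l.
  unfold Cdiv. ring.
Qed.

Section Contour.
Variables M a h : R.
Hypotheses (HM : 0 < M) (Ha : 0 < a) (Hh : 0 < h < PI / 2).
Hypothesis Hleft : 1 < exp M * cos h.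

Let Q := contour_coef M a h.
Let HhPI : 0 < h < PI.
Proof. assert (H := PI_RGT_0). lra. Qed.

(** For n = 1 the integrand is regular at 0, and [contour_coef_rec] propagates
    the vanishing. *)
Lemma contour_coef_vanish n : forall j, (S n <= j)%nat -> Q j (S n) = 0.
Proof.
  induction n as [|n IH]; intros j Hj.
  - destruct j as [|j]; [lia|]. now apply contour_coef_removable.
  - assert (R := contour_coef_rec M a h HM Ha HhPI j (S n)). fold Q in R.
    rewrite !IH in R by lia. rewrite !Cmult_0_r, Cplus_0_l in R.
    replace (Q j (S (S n))) with (/ RtoC (INR (S n)) * (RtoC (INR (S n)) * Q j (S (S n)))).
    + rewrite R; ring.
    + field. apply RtoC_INR_S_neq_0.
Qed.

(** Both sides satisfy the same recurrence; the constant [Q 0 1] absorbs the value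
    of 2 i pi. *)
Lemma stirling_cycle_contour n : forall j,
  Q 0 1 * RtoC (INR (fact j)) * RtoC (INR (stirling_cycle (S n) (S j))) =
  RtoC (INR (fact n)) * Q j (S n).
Proof.
  induction n as [|n IH]; intros j.
  - destruct j as [|j].
    + rewrite stirling_cycle_1_1. simpl fact. simpl (INR 1). ring.
    + rewrite stirling_cycle_small_nat by lia. unfold Q. rewrite contour_coef_removable by assumption.
      simpl (INR 0); ring.
  - rewrite stirling_cycle_rec_nat, plus_INR, mult_INR, RtoC_plus, RtoC_mult.
    assert (R := contour_coef_rec M a h HM Ha HhPI j (S n)). fold Q in R.
    rewrite (RtoC_fact_S n).
    transitivity (RtoC (INR (fact n)) * (RtoC (INR (S n)) * Q j (S (S n)))); [|ring].
    rewrite R.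
    assert (IHj := IH j).
    transitivity (RtoC (INR (S n)) * (Q 0 1 * RtoC (INR (fact j)) * RtoC (INR (stirling_cycle (S n) (S j))))
       + Q 0 1 * RtoC (INR (fact j)) * RtoC (INR (stirling_cycle (S n) j))); [ring|].
    rewrite IHj.
    destruct j as [|j].
    + rewrite stirling_cycle_S_0. simpl (INR 0). ring.
    + rewrite (RtoC_fact_S j).
      transitivity (RtoC (INR (S n)) * (RtoC (INR (fact n)) * Q (S j) (S n)) + RtoC (INR (S j)) *
        (Q 0 1 * RtoC (INR (fact j)) * RtoC (INR (stirling_cycle (S n) (S j))))); [ring|].
      rewrite (IH j). simpl pred. ring.
Qed.

Lemma contour_coef_0_1_neq_0 : Q 0 1 <> 0.
Proof.
  assert (P := contour_coef_0_1_Im_pos M a h HM Ha HhPI Hleft). fold Q in P.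
  intros E. rewrite E in P. simpl in P. lra.
Qed.

Lemma rect_int_Csum (c : nat -> C) (f : nat -> C -> C) n :
  (forall i, holomorphic_on (on_rect M a h) (f i)) ->
  holomorphic_on (on_rect M a h) (fun u => Csum (fun i => c i * f i u) n) /\
  rect_int M a h (fun u => Csum (fun i => c i * f i u) n) =
  Csum (fun i => c i * rect_int M a h (f i)) n.
Proof.
  intros H. induction n as [|n [IH1 IH2]]; simpl.
  - split.
    + intros u _. exists 0. apply hol_const.
    + apply (rect_int_deriv M a h (fun _ => 0)).
      * intros; apply hol_const.
      * intros u _. exists 0. apply hol_const.
  - split.
    + apply holomorphic_plus; [exact IH1|now apply holomorphic_scal].
    + rewrite (rect_int_plus M a h (fun u => Csum (fun i => c i * f i u) n)); [|exact IH1|now apply holomorphic_scal].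
      rewrite IH2, rect_int_scal by auto. reflexivity.
Qed.

(** Lagrange inversion: expand (x - u)^n by the binomial theorem.  The term
    without x vanishes by [contour_coef_vanish]. *)
Lemma stirling_poly_contour n x :
  RtoC (INR (S n)) * Q 0 1 * stirling_poly (S n) x =
  rect_int M a h (fun u => ((x - u) / Emap u) ^ S n).
Proof.
  (* coefficients in the expansion of ((x - u) / (1 - e^(-u)))^(n+1) *)
  set (c := fun m => RtoC (INR (fact (S n))) * (dpow x m * (RtoC (-1) ^ (S n - m) / RtoC (INR (fact (S n - m)))))).
  rewrite (rect_int_ext M a h _ (fun u => Csum (fun m => c m * kernel (S n - m) (S n) u) (S (S n)))).
  2: { intros u Hu. unfold Cdiv. rewrite Cpow_mult_l.
    replace ((x - u) ^ S n) with (RtoC (INR (fact (S n))) * dpow (x + (- u)) (S n)).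
    2: { unfold dpow, Cminus. field. apply RtoC_fact_neq_0. }
    rewrite dpow_plus, <- Csum_scal, Cmult_comm, <- Csum_scal.
    apply Csum_ext. intros m _. unfold c, kernel. unfold dpow at 2.
    replace (- u) with (RtoC (-1) * u) by ring. rewrite Cpow_mult_l. unfold Cdiv. ring. }
  rewrite (proj2 (rect_int_Csum c (fun m => kernel (S n - m) (S n)) (S (S n)) (fun i => holomorphic_kernel M a h HM Ha HhPI _ _))).
  rewrite Csum_shift.
  change (rect_int M a h (kernel (S n - 0) (S n))) with (Q (S n) (S n)).
  rewrite (contour_coef_vanish n (S n)) by lia. rewrite Cmult_0_r, Cplus_0_l.
  unfold stirling_poly. rewrite <- Csum_scal. apply Csum_ext. intros i Hi.
  change (rect_int M a h (kernel (S n - S i) (S n))) with (Q (S n - S i) (S n)).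
  assert (E := stirling_cycle_contour n (S n - S i)).
  replace (S (S n - S i)) with (S n - i)%nat in E by lia.
  assert (E' : Q (S n - S i) (S n) = / RtoC (INR (fact n)) * (RtoC (INR (fact n)) * Q (S n - S i) (S n)))
    by (field; apply RtoC_fact_neq_0).
  rewrite <- E in E'. rewrite E'. unfold c. rewrite RtoC_fact_S.
  field. split; apply RtoC_fact_neq_0.
Qed.

Lemma stirling_poly_bound x rho : 0 < rho ->
  (forall u, on_rect M a h u -> Cmod (x - u) <= rho * Cmod (Emap u)) ->
  exists K, forall n, Cmod (stirling_poly n x) <= K * rho ^ n.
Proof.
  intros Hr H. destruct (rect_int_bound M a h) as (K & HK & HB).
  set (k := Cmod (Q 0 1)).
  assert (Hk : 0 < k) by apply Cmod_gt_0, contour_coef_0_1_neq_0.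
  exists (K / k)%R. intros [|n].
  - simpl. unfold stirling_poly; simpl. rewrite Cmod_0.
    assert (0 <= K / k) by (apply Rdiv_le_0_compat; lra). lra.
  - assert (B : Cmod (rect_int M a h (fun u => ((x - u) / Emap u) ^ S n)) <= K * rho ^ S n).
    { apply HB.
      - intros u Hu. eexists. apply (hol_pow (fun u => (x - u) / Emap u)).
        apply (hol_mult (fun u => x - u) (fun u => / Emap u)).
        + apply (hol_plus (fun _ => x) (fun u => - u)); [apply hol_const|apply hol_opp, hol_id].
        + apply hol_inv; [now apply (on_rect_Emap_neq_0 M a h)|apply hol_Emap].
      - intros u Hu. rewrite Cmod_pow. apply pow_incr. split; [apply Cmod_ge_0|].
        assert (N := on_rect_Emap_neq_0 M a h HM Ha HhPI u Hu).
        unfold Cdiv. rewrite Cmod_mult, Cmod_inv by exact N.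
        assert (P := Cmod_gt_0 (Emap u)). apply P in N.
        apply (Rmult_le_reg_r (Cmod (Emap u))); [exact N|].
        rewrite Rmult_assoc, Rinv_l by lra. rewrite Rmult_1_r. now apply H. }
    rewrite <- stirling_poly_contour in B.
    rewrite !Cmod_mult, Cmod_R, Rabs_pos_eq in B by apply pos_INR. fold k in B.
    assert (1 <= INR (S n)) by (rewrite S_INR; generalize (pos_INR n); lra).
    assert (P := Cmod_ge_0 (stirling_poly (S n) x)).
    apply (Rmult_le_reg_l k); [exact Hk|].
    replace (k * (K / k * rho ^ S n))%R with (K * rho ^ S n)%R by (field; lra).
    eapply Rle_trans; [|exact B].
    rewrite Rmult_assoc. rewrite <- (Rmult_1_l (k * Cmod (stirling_poly (S n) x))) at 1.
    apply Rmult_le_compat_r; [nra|assumption].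
Qed.

End Contour.

(** * Geometric decay of the terms *)

(** Compactness of the boundary. *)
Lemma rect_max M a h f r : holomorphic_on (on_rect M a h) f ->
  (forall u, on_rect M a h u -> Cmod (f u) < r) ->
  exists q, q < r /\ forall u, on_rect M a h u -> Cmod (f u) <= q.
Proof.
  intros Hf H.
  assert (K : forall p q, holomorphic_on (on_seg p q) f -> (forall u, on_seg p q u -> Cmod (f u) < r) ->
    exists q', q' < r /\ forall u, on_seg p q u -> Cmod (f u) <= q').
  { intros p q Hh Hs.
    destruct (curve_cont_max (fun t => f (line p q t)) 0 1) as (m & Hm & Hq).
    - lra.
    - intros t Ht; now apply hol_line_cont.
    - exists (Cmod (f (line p q m))). split; [apply Hs; now exists m|].
      intros u (t & Ht & ->). now apply Hq. }
  apply on_rect_sides in Hf as (?&?&?&?). apply on_rect_sides in H as (?&?&?&?).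
  destruct (K _ _ H0 H) as (q1 & ? & ?), (K _ _ H1 H4) as (q2 & ? & ?),
    (K _ _ H2 H5) as (q3 & ? & ?), (K _ _ H3 H6) as (q4 & ? & ?).
  exists (Rmax (Rmax q1 q2) (Rmax q3 q4)). split.
  - repeat apply Rmax_lub_lt; assumption.
  - intros u [Hu|[Hu|[Hu|Hu]]].
    + apply (Rle_trans _ q1); [auto|]. eapply Rle_trans; apply Rmax_l.
    + apply (Rle_trans _ q2); [auto|]. eapply Rle_trans; [apply Rmax_r|apply Rmax_l].
    + apply (Rle_trans _ q3); [auto|]. eapply Rle_trans; [apply Rmax_l|apply Rmax_r].
    + apply (Rle_trans _ q4); [auto|]. eapply Rle_trans; apply Rmax_r.
Qed.

Lemma exp_ge_quad x : 0 <= x -> (1 + x + x * x / 4 <= exp x)%R.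
Proof.
  intros Hx. replace x with (x / 2 + x / 2)%R at 4 by field. rewrite exp_plus.
  assert (H := exp_ineq1_le (x / 2)). nra.
Qed.

Lemma sin_le_x x : 0 <= x -> (sin x <= x)%R.
Proof.
  intros Hx. destruct (Req_dec x 0) as [->|N]; [rewrite sin_0; lra|].
  left; apply sin_lt_x; lra.
Qed.

(** On the line Re u = a with e^a = R, this is |R - e^(-i y)|^2, y = Im u. *)
Lemma Cmod2_scal_Emap R a u : exp a = R ->
  ((R * Cmod (Emap u)) ^ 2 = R ^ 2 - 2 * R * exp (a - Re u) * cos (Im u) + exp (a - Re u) ^ 2)%R.
Proof.
  intros HR. rewrite Rpow_mult_distr, Cmod2_alt, Re_Emap, Im_Emap.
  unfold Rminus. rewrite exp_plus, HR.
  assert (H := sin2_cos2_mult (Im u)).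
  set (s := sin (Im u)) in *. set (c := cos (Im u)) in *. set (e := exp (- Re u)).
  replace ((R * e) ^ 2)%R with ((R * e) ^ 2 * (s * s + c * c))%R by (rewrite H; ring). ring.
Qed.

Lemma Cmod2_sub a lam u : Re lam = a -> (Cmod (lam - u) ^ 2 = (a - Re u) ^ 2 + (Im lam - Im u) ^ 2)%R.
Proof. intros <-. rewrite Cmod2_alt. unfold Re, Im; simpl. ring. Qed.

Lemma neck_square R phi : (R * cos phi = 1)%R -> ((R * sin phi) ^ 2 = R ^ 2 - 1)%R.
Proof.
  intros Hc.
  replace ((R * sin phi) ^ 2)%R with (R ^ 2 * (sin phi * sin phi + cos phi * cos phi) - (R * cos phi) ^ 2)%R by ring.
  rewrite sin2_cos2_mult, Hc; ring.
Qed.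

(** With T = tan phi = R sin phi, the squares of both sides compare as follows.
    On the horizontal sides, at distance X from the right side, the inequality is
    X^2 + (b + phi)^2 < (e^X - 1)^2 + T^2.  On the right side, at height
    phi - d, it is a consequence of
    (T - d)^2 <= T^2 + 2 - 2 cos d - 2 T sin d, which holds since T >= d and
    (d - sin d)^2 + (1 - cos d)^2 >= 0.  Far to the left e^X wins. *)
Lemma contour_strict lam R phi : 1 < R -> Re lam = ln R -> 0 < phi < PI / 2 -> (R * cos phi = 1)%R ->
  Rabs (Im lam) < R * sin phi - phi ->
  exists M, 0 < M /\ 1 < exp M * cos phi /\
  forall u, on_rect M (ln R) phi u -> Cmod (lam - u) < R * Cmod (Emap u).
Proof.
  intros HR Ha Hphi Hc Hb.
  set (a := ln R) in *.
  assert (Pa : 0 < a) by (rewrite <- ln_1; apply ln_increasing; lra).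
  assert (Ea : exp a = R) by (apply exp_ln; lra).
  set (b := Rabs (Im lam)) in *. assert (Pb : 0 <= b) by apply Rabs_pos.
  set (T := (R * sin phi)%R) in *.
  assert (HT := neck_square R phi Hc). fold T in HT.
  (* M = 4 (R + b + phi): on the left side X > M, and e^X >= 1 + X + X^2 / 4 then
     exceeds R + X + b + phi *)
  set (Cc := (R + b + phi)%R).
  assert (PC : 1 < Cc) by (unfold Cc; lra).
  assert (Pcos : 0 < cos phi) by (apply cos_gt_0; lra).
  exists (4 * Cc)%R. split; [lra|]. split.
  { assert (H := exp_ineq1_le (4 * Cc)).
    rewrite <- Hc. apply Rmult_lt_compat_r; [exact Pcos|]. unfold Cc in *; lra. }
  intros u Hu. apply on_rect_coord in Hu; [|lra|exact Pa|lra].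
  assert (PE := Cmod_ge_0 (Emap u)).
  apply Rsqr_incrst_0; [|apply Cmod_ge_0|nra].
  rewrite !Rsqr_pow2, (Cmod2_sub a lam u Ha), (Cmod2_scal_Emap R a u Ea).
  assert (By : forall s, 0 <= s -> Rabs (Im u) <= s -> ((Im lam - Im u) ^ 2 <= (b + s) ^ 2)%R).
  { intros s Hs Hy. assert (Rabs (Im lam - Im u) <= b + s).
    { unfold Rminus. eapply Rle_trans; [apply Rabs_triang|]. rewrite Rabs_Ropp. unfold b. lra. }
    rewrite <- (pow2_abs (Im lam - Im u)). apply pow_incr. split; [apply Rabs_pos|assumption]. }
  destruct Hu as [[Hx Hy]|[[Hx|Hx] Hy]].
  -
    assert (Cy : cos (Im u) = cos phi) by (destruct Hy as [-> | ->]; [|rewrite cos_neg]; reflexivity).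
    assert (Ay : Rabs (Im u) <= phi) by (destruct Hy as [-> | ->]; rewrite ?Rabs_Ropp, Rabs_pos_eq; lra).
    specialize (By phi ltac:(lra) Ay). rewrite Cy.
    set (X := (a - Re u)%R). assert (HX : 0 <= X) by (unfold X; lra).
    assert (He := exp_ineq1_le X).
    replace (2 * R * exp X * cos phi)%R with (2 * exp X * (R * cos phi))%R by ring. rewrite Hc.
    assert (0 < (T - (b + phi)) * (T + (b + phi)))%R by (apply Rmult_lt_0_compat; lra).
    assert (0 <= (exp X - 1 - X) * (exp X - 1 + X))%R by (apply Rmult_le_pos; lra). nra.
  -
    assert (Ay : Rabs (Im u) <= phi) by (unfold Rabs; destruct Rcase_abs; lra).
    specialize (By phi ltac:(lra) Ay).
    set (X := (a - Re u)%R). assert (HX : 4 * Cc < X) by (unfold X; lra).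
    assert (He := exp_ge_quad X ltac:(lra)).
    assert (COS := COS_bound (Im u)).
    assert (X + b + phi < exp X - R) by (unfold Cc in *; nra).
    assert (0 < (exp X - R - (X + b + phi)) * (exp X - R + (X + b + phi)))%R by (apply Rmult_lt_0_compat; lra).
    assert (0 <= X * (b + phi))%R by (apply Rmult_le_pos; lra).
    assert (0 < R * exp X) by (apply Rmult_lt_0_compat; [lra|apply exp_pos]). nra.
  -
    rewrite Hx, Rminus_diag, exp_0.
    set (t := Rabs (Im u)). assert (Pt : 0 <= t) by apply Rabs_pos.
    assert (Ht : t <= phi) by (unfold t, Rabs; destruct Rcase_abs; lra).
    specialize (By t Pt (Rle_refl _)).
    assert (Cy : cos (Im u) = cos t) by (unfold t, Rabs; destruct Rcase_abs; rewrite ?cos_neg; reflexivity).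
    rewrite Cy.
    set (d := (phi - t)%R).
    assert (Cd : (R * cos t = cos d + T * sin d)%R).
    { replace t with (phi - d)%R by (unfold d; ring). rewrite cos_minus.
      unfold T. replace (cos d) with ((R * cos phi) * cos d)%R at 2 by (rewrite Hc; ring). ring. }
    assert (Hd : 0 <= d) by (unfold d; lra).
    assert (Sd := sin_le_x d Hd).
    replace (2 * R * 1 * cos t)%R with (2 * (R * cos t))%R by ring. rewrite Cd.
    assert (0 < (T - d - (b + t)) * (T - d + (b + t)))%R by (apply Rmult_lt_0_compat; unfold d; lra).
    assert (0 <= (d - sin d) ^ 2 + (1 - cos d) ^ 2)%R by (apply Rplus_le_le_0_compat; apply pow2_ge_0).
    assert (S2 := sin2_cos2_mult d).
    assert ((T - d) * (d - sin d) >= 0)%R by (apply Rle_ge, Rmult_le_pos; unfold d in *; lra).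
    nra.
Qed.

Lemma stirling_poly_decay lam R phi : 1 < R -> Re lam = ln R -> 0 < phi < PI / 2 -> (R * cos phi = 1)%R ->
  Rabs (Im lam) < R * sin phi - phi ->
  exists q K, 0 < q < R /\ forall n, Cmod (stirling_poly n lam) <= K * q ^ n.
Proof.
  intros HR Ha Hphi Hc Hb.
  destruct (contour_strict lam R phi HR Ha Hphi Hc Hb) as (M & HM & Hleft & H).
  assert (Pa : 0 < ln R) by (rewrite <- ln_1; apply ln_increasing; lra).
  assert (HP := PI_RGT_0).
  assert (N : forall u, on_rect M (ln R) phi u -> Emap u <> 0).
  { apply on_rect_Emap_neq_0; try assumption; lra. }
  destruct (rect_max M (ln R) phi (fun u => (lam - u) * / Emap u) R) as (q & Hq & Hq').
  - intros u Hu. eexists. apply (hol_mult (fun u => lam - u) (fun u => / Emap u)).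
    + apply (hol_plus (fun _ => lam) (fun u => - u)); [apply hol_const|apply hol_opp, hol_id].
    + apply hol_inv; [now apply N|apply hol_Emap].
  - intros u Hu. rewrite Cmod_mult, Cmod_inv by now apply N.
    assert (P := Cmod_gt_0 (Emap u)). assert (P' := proj1 P (N u Hu)).
    apply (Rmult_lt_reg_r (Cmod (Emap u))); [exact P'|].
    rewrite Rmult_assoc, Rinv_l, Rmult_1_r by lra. now apply H.
  - destruct (stirling_poly_bound M (ln R) phi HM Pa Hphi Hleft lam (Rmax q (R / 2))) as [K HK].
    + eapply Rlt_le_trans; [|apply Rmax_r]. lra.
    + intros u Hu. assert (P' := proj1 (Cmod_gt_0 (Emap u)) (N u Hu)).
      specialize (Hq' u Hu). rewrite Cmod_mult, Cmod_inv in Hq' by now apply N.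
      assert (L := Rmax_l q (R / 2)).
      replace (Cmod (lam - u)) with (Cmod (lam - u) * / Cmod (Emap u) * Cmod (Emap u))%R by (field; lra).
      apply Rmult_le_compat_r; lra.
    + exists (Rmax q (R / 2)), K. split; [|exact HK]. split.
      * eapply Rlt_le_trans; [|apply Rmax_r]. lra.
      * apply Rmax_lub_lt; lra.
Qed.

Lemma sin_le_tangent t phi : 0 <= t <= PI -> 0 <= phi <= PI ->
  (sin t <= sin phi + cos phi * (t - phi))%R.
Proof.
  intros Ht Hphi. destruct (Rtotal_order t phi) as [L|[->|L]]; [|lra|].
  - destruct (MVT_cor2 sin cos t phi L) as (c & E & Hc); [intros; apply derivable_pt_lim_sin|].
    assert (cos phi <= cos c) by (apply cos_decr_1; lra). nra.
  - destruct (MVT_cor2 sin cos phi t L) as (c & E & Hc); [intros; apply derivable_pt_lim_sin|].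
    assert (cos c <= cos phi) by (apply cos_decr_1; lra). nra.
Qed.

(** For R > 1 the supremum of R sin t - t is attained where R cos t = 1, and is
    tan t - t there.  The form with an existential quantifier makes openness and
    the comparison with the Lambert function immediate. *)
Definition conv_region (R b : R) : Prop := exists t, 0 < t < PI /\ b < R * sin t - t.

Lemma conv_region_gt_1 R b : 0 <= b -> conv_region R b -> 1 < R.
Proof.
  intros Hb (t & Ht & H). assert (S := sin_lt_x t ltac:(lra)).
  assert (0 < sin t) by (apply sin_gt_0; lra).
  apply Rnot_le_lt; intros L. nra.
Qed.

Lemma acos_inv R : 1 < R -> 0 < acos (/ R) < PI / 2 /\ (R * cos (acos (/ R)) = 1)%R.
Proof.
  intros HR. assert (0 < / R) by (apply Rinv_0_lt_compat; lra).
  assert (/ R < 1) by (rewrite <- Rinv_1; apply Rinv_lt_contravar; lra).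
  split; [split|].
  - apply acos_bound_lt; lra.
  - apply Rnot_le_lt; intros L. assert (B := acos_bound (/ R)).
    assert (C : (cos (acos (/ R)) <= 0)%R) by (apply cos_le_0; lra). rewrite cos_acos in C; lra.
  - rewrite cos_acos by lra. field; lra.
Qed.

Lemma conv_region_phi R b : 0 <= b -> conv_region R b ->
  b < R * sin (acos (/ R)) - acos (/ R).
Proof.
  intros Hb H. assert (HR := conv_region_gt_1 R b Hb H). destruct H as (t & Ht & H).
  destruct (acos_inv R HR) as [A B]. set (phi := acos (/ R)) in *.
  assert (P := PI_RGT_0).
  assert (S := sin_le_tangent t phi ltac:(lra) ltac:(lra)).
  assert (R * sin t <= R * (sin phi + cos phi * (t - phi)))%R by (apply Rmult_le_compat_l; lra).
  replace (R * (sin phi + cos phi * (t - phi)))%R with (R * sin phi + (R * cos phi) * (t - phi))%R in H0 by ring.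
  rewrite B in H0. lra.
Qed.

(** * The differential equation of the generating function *)

(** The coefficients of V = U - x in powers of s.  With this constant term the
    recurrence [vcoef'_rec] also holds for n = 0. *)
Definition vcoef (n : nat) (x : C) : C :=
  match n with O => - x | S _ => stirling_poly n x end.

Definition stirling_poly' (n : nat) (x : C) : C :=
  Csum (fun i => RtoC (-1) ^ (n - S i) * RtoC (INR (stirling_cycle n (n - i))) * dpow x i) n.

Definition vcoef' (n : nat) (x : C) : C :=
  match n with O => - (1) | S _ => stirling_poly' n x end.

Lemma dpow_0 x : dpow x 0 = 1.
Proof. unfold dpow; simpl. field. Qed.

(** The recurrence of the Stirling cycle numbers, read on the derivatives with
    respect to x; as a differential equation it says
    (1 + s) dV/dx - s^2 dV/ds = -1. *)
Lemma vcoef'_rec n x : vcoef' (S n) x + vcoef' n x = RtoC (INR n) * vcoef n x.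
Proof.
  destruct n as [|n].
  - simpl vcoef'. unfold stirling_poly'. simpl Csum. rewrite stirling_cycle_1_1, dpow_0. simpl. ring.
  - unfold vcoef', vcoef. set (m := S n).
    assert (E : stirling_poly' (S m) x =
      Csum (fun i => RtoC (INR m) * (RtoC (-1) ^ (m - i) * RtoC (INR (stirling_cycle m (S (m - i)))) * dpow x i)) (S m)
      + Csum (fun i => RtoC (-1) ^ (m - i) * RtoC (INR (stirling_cycle m (m - i))) * dpow x i) (S m)).
    { rewrite <- Csum_plus. apply Csum_ext. intros i Hi.
      replace (S m - S i)%nat with (m - i)%nat by lia.
      replace (S m - i)%nat with (S (m - i)) by lia.
      rewrite stirling_cycle_rec_nat, plus_INR, mult_INR, RtoC_plus, RtoC_mult. ring. }
    rewrite E, Csum_shift.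
    change (Csum (fun i => RtoC (-1) ^ (m - i) * RtoC (INR (stirling_cycle m (m - i))) * dpow x i) (S m))
      with (Csum (fun i => RtoC (-1) ^ (m - i) * RtoC (INR (stirling_cycle m (m - i))) * dpow x i) m +
        RtoC (-1) ^ (m - m) * RtoC (INR (stirling_cycle m (m - m))) * dpow x m).
    rewrite Nat.sub_diag, Nat.sub_0_r.
    replace (stirling_cycle m 0) with 0%nat by (unfold m; now rewrite stirling_cycle_S_0).
    rewrite (stirling_cycle_small_nat m (S m)) by lia.
    unfold stirling_poly. rewrite <- Csum_scal.
    rewrite (Csum_ext (fun i => RtoC (INR m) * (RtoC (-1) ^ (m - S i) * RtoC (INR (stirling_cycle m (S (m - S i)))) * dpow x (S i)))
      (fun i => RtoC (INR m) * (RtoC (-1) ^ (m - S i) * RtoC (INR (stirling_cycle m (m - i))) * dpow x (S i)))).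
    2: { intros i Hi. replace (S (m - S i)) with (m - i)%nat by lia. reflexivity. }
    rewrite (Csum_ext (fun i => RtoC (-1) ^ (m - i) * RtoC (INR (stirling_cycle m (m - i))) * dpow x i)
      (fun i => RtoC (-1) * (RtoC (-1) ^ (m - S i) * RtoC (INR (stirling_cycle m (m - i))) * dpow x i))).
    2: { intros i Hi. replace (m - i)%nat with (S (m - S i)) at 1 by lia. rewrite Cpow_S. ring. }
    rewrite !Csum_scal. unfold stirling_poly'. simpl (INR 0). ring.
Qed.

Lemma curve_deriv_Csum (f : nat -> R -> C) (l : nat -> C) t n :
  (forall i, curve_deriv (f i) t (l i)) -> curve_deriv (fun t => Csum (fun i => f i t) n) t (Csum l n).
Proof.
  intros H. induction n as [|n IH]; simpl; [apply curve_deriv_const|now apply curve_deriv_plus].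
Qed.

Lemma curve_deriv_pow f t l n : curve_deriv f t l ->
  curve_deriv (fun t => f t ^ n) t (RtoC (INR n) * f t ^ pred n * l).
Proof.
  intros H. apply (hol_pow (fun u => u) (f t) 1 n (hol_id _) f t l) in H; [|reflexivity].
  eapply curve_deriv_eq; [exact H|ring].
Qed.

Lemma curve_deriv_scal k f t l : curve_deriv f t l -> curve_deriv (fun t => k * f t) t (k * l).
Proof.
  intros H. eapply curve_deriv_eq; [apply curve_deriv_mult; [apply curve_deriv_const|exact H]|cbv beta; ring].
Qed.

Lemma curve_deriv_dpow x t n :
  curve_deriv (fun t => dpow (RtoC t * x) (S n)) t (x * dpow (RtoC t * x) n).
Proof.
  unfold dpow, Cdiv. eapply curve_deriv_eq.
  - apply curve_deriv_mult; [apply curve_deriv_pow, curve_deriv_ray|apply curve_deriv_const].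
  - cbv beta. rewrite RtoC_fact_S. simpl pred. field.
    split; [apply RtoC_fact_neq_0|apply RtoC_INR_S_neq_0].
Qed.

Lemma curve_deriv_vcoef x t n :
  curve_deriv (fun t => vcoef n (RtoC t * x)) t (x * vcoef' n (RtoC t * x)).
Proof.
  destruct n as [|n]; unfold vcoef, vcoef'.
  - eapply curve_deriv_eq; [apply curve_deriv_opp, curve_deriv_ray|ring].
  - unfold stirling_poly, stirling_poly'. rewrite <- Csum_scal.
    apply (curve_deriv_Csum (fun i t => RtoC (-1) ^ (S n - S i) * RtoC (INR (stirling_cycle (S n) (S n - i))) * dpow (RtoC t * x) (S i))).
    intros i. eapply curve_deriv_eq; [apply curve_deriv_scal, curve_deriv_dpow|ring].
Qed.

Lemma vcoef_at_0 n : vcoef n 0 = 0.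
Proof.
  destruct n as [|n]; unfold vcoef; [ring|].
  unfold stirling_poly.
  rewrite (Csum_ext _ (fun _ => 0 * 0)).
  - rewrite Csum_scal. ring.
  - intros i _. unfold dpow. simpl Cpow. unfold Cdiv. ring.
Qed.

Lemma Csum_rev f n : Csum f (S n) = Csum (fun i => f (n - i)%nat) (S n).
Proof.
  induction n as [|n IH]; [reflexivity|].
  rewrite (Csum_shift (fun i => f (S n - i)%nat)).
  rewrite (Csum_ext (fun i => f (S n - S i)%nat) (fun i => f (n - i)%nat)) by (intros; f_equal; lia).
  rewrite <- IH. rewrite Nat.sub_0_r. simpl. ring.
Qed.

(** The coefficient of s^n in V_s (1 + s + s V) + V, where V_s = dV/ds. *)
Definition ode_coef (n : nat) (x : C) : C :=
  RtoC (INR (S n)) * (vcoef (S n) x + vcoef n x) +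
  Csum (fun i => RtoC (INR i) * vcoef i x * vcoef (n - i) x) (S n).

(** The coefficient of s^n in d(sV)/ds + V dV/dx. *)
Definition ode_coef_aux (n : nat) (x : C) : C :=
  RtoC (INR (S n)) * vcoef n x + Csum (fun i => vcoef' i x * vcoef (n - i) x) (S n).

(** After exchanging i and n - i where the second factor is differentiated, the
    weights i and n - i add up to n. *)
Lemma curve_deriv_ode_coef x t n :
  curve_deriv (fun t => ode_coef n (RtoC t * x)) t (RtoC (INR n) * x * ode_coef_aux n (RtoC t * x)).
Proof.
  unfold ode_coef. eapply curve_deriv_eq.
  - apply curve_deriv_plus.
    + apply curve_deriv_scal, curve_deriv_plus; apply curve_deriv_vcoef.
    + apply (curve_deriv_Csum (fun i t => RtoC (INR i) * vcoef i (RtoC t * x) * vcoef (n - i) (RtoC t * x))).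
      intros i. apply curve_deriv_mult; [apply curve_deriv_scal|]; apply curve_deriv_vcoef.
  - cbv beta. set (y := RtoC t * x). rewrite Csum_plus.
    rewrite (Csum_rev (fun i => RtoC (INR i) * vcoef i y * (x * vcoef' (n - i) y))).
    rewrite <- Csum_plus.
    rewrite (Csum_ext _ (fun i => RtoC (INR n) * x * (vcoef' i y * vcoef (n - i) y))).
    2: { intros i Hi. replace (n - (n - i))%nat with i by lia. rewrite minus_INR by lia.
      rewrite RtoC_minus. ring. }
    rewrite Csum_scal. unfold ode_coef_aux.
    transitivity (RtoC (INR (S n)) * x * (vcoef' (S n) y + vcoef' n y) +
      RtoC (INR n) * x * Csum (fun i => vcoef' i y * vcoef (n - i) y) (S n)); [ring|].
    rewrite vcoef'_rec. ring.
Qed.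

Lemma ode_coef_aux_S n x : ode_coef_aux (S n) x + ode_coef_aux n x = ode_coef n x.
Proof.
  unfold ode_coef_aux, ode_coef. rewrite (Csum_shift (fun i => vcoef' i x * vcoef (S n - i) x)).
  change (vcoef' 0 x) with (- (1) : C). rewrite Nat.sub_0_r.
  rewrite (Csum_ext (fun i => RtoC (INR i) * vcoef i x * vcoef (n - i) x)
    (fun i => vcoef' (S i) x * vcoef (S n - S i) x + vcoef' i x * vcoef (n - i) x)).
  2: { intros i Hi. rewrite <- vcoef'_rec. replace (S n - S i)%nat with (n - i)%nat by lia. ring. }
  rewrite Csum_plus. rewrite (S_INR (S n)), RtoC_plus. ring.
Qed.

Lemma curve_deriv_zero_const f a b : a < b -> (forall t, a <= t <= b -> curve_deriv f t 0) -> f a = f b.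
Proof.
  intros L H. apply C_ext.
  - apply (eq_is_derive (V := R_NormedModule) (fun t => Re (f t)) a b); [|exact L].
    intros t Ht; apply (H t Ht).
  - apply (eq_is_derive (V := R_NormedModule) (fun t => Im (f t)) a b); [|exact L].
    intros t Ht; apply (H t Ht).
Qed.

(** By induction on n: [ode_coef n] has derivative n [ode_coef_aux n] in x and
    vanishes at x = 0, and [ode_coef_aux_S] goes from n to n + 1. *)
Lemma ode_coef_0 n : (forall x, ode_coef n x = 0) /\ (forall x, ode_coef_aux n x = 0).
Proof.
  assert (K : forall n, (forall x, ode_coef_aux n x = 0) -> forall x, ode_coef n x = 0).
  { clear n; intros n H x.
    replace x with (RtoC 1 * x) by ring.
    rewrite <- (curve_deriv_zero_const (fun t => ode_coef n (RtoC t * x)) 0 1); [|lra|].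
    - replace (RtoC 0 * x) with (RtoC 0) by ring.
      unfold ode_coef. rewrite !vcoef_at_0.
      rewrite (Csum_ext _ (fun _ => 0 * 0)) by (intros; rewrite !vcoef_at_0; ring).
      rewrite Csum_scal. ring.
    - intros t _. eapply curve_deriv_eq; [apply curve_deriv_ode_coef|]. rewrite H. ring. }
  induction n as [|n [IH1 IH2]].
  - assert (H : forall x, ode_coef_aux 0 x = 0).
    { intros x. unfold ode_coef_aux, vcoef', vcoef. simpl. ring. }
    split; [now apply K|exact H].
  - assert (H : forall x, ode_coef_aux (S n) x = 0).
    { intros x. assert (E := ode_coef_aux_S n x). rewrite IH1, IH2 in E. rewrite <- E. ring. }
    split; [now apply K|exact H].
Qed.

(** * The sum of the series inside its disc of convergence *)

(** The power series with complex coefficients [c] at a real point: a complex power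
    series in s is studied along the rays t |-> t s. *)
Definition ray_series (c : nat -> C) (t : R) : C :=
  (PSeries (fun n => Re (c n)) t, PSeries (fun n => Im (c n)) t).

Definition is_ray_series (c : nat -> C) (t : R) (l : C) : Prop :=
  is_pseries (fun n => Re (c n)) t (Re l) /\ is_pseries (fun n => Im (c n)) t (Im l).

Definition in_radius (c : nat -> C) (t : R) : Prop :=
  Rbar_lt (Rabs t) (CV_radius (fun n => Re (c n))) /\
  Rbar_lt (Rabs t) (CV_radius (fun n => Im (c n))).

Lemma in_radius_is_ray_series c t : in_radius c t -> is_ray_series c t (ray_series c t).
Proof. intros [H1 H2]; split; apply PSeries_correct, CV_radius_inside; assumption. Qed.

Lemma is_ray_series_unique c t l l' : is_ray_series c t l -> is_ray_series c t l' -> l = l'.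
Proof.
  intros [H1 H2] [H3 H4]. apply C_ext.
  - rewrite <- (is_pseries_unique _ _ _ H1). now apply is_pseries_unique.
  - rewrite <- (is_pseries_unique _ _ _ H2). now apply is_pseries_unique.
Qed.

Lemma is_ray_series_ext c d t l : (forall n, c n = d n) -> is_ray_series c t l -> is_ray_series d t l.
Proof.
  intros E [H1 H2]; split.
  - apply (is_pseries_ext (fun n => Re (c n))); [intros n; now rewrite E|exact H1].
  - apply (is_pseries_ext (fun n => Im (c n))); [intros n; now rewrite E|exact H2].
Qed.

Lemma is_ray_series_plus c d t l m : is_ray_series c t l -> is_ray_series d t m -> is_ray_series (fun n => c n + d n) t (l + m).
Proof.
  intros [H1 H2] [H3 H4]; split.
  - exact (is_pseries_plus _ _ _ _ _ H1 H3).
  - exact (is_pseries_plus _ _ _ _ _ H2 H4).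
Qed.

Lemma is_pseries_Rscal (k : R) a t l : is_pseries a t l -> is_pseries (fun n => k * a n)%R t (k * l)%R.
Proof. intros H. exact (is_pseries_scal k a t l (Rmult_comm _ _) H). Qed.

Lemma is_pseries_Rminus a b t l m : is_pseries a t l -> is_pseries b t m ->
  is_pseries (fun n => a n - b n)%R t (l - m)%R.
Proof.
  intros H1 H2. apply (is_pseries_Rscal (-1)) in H2.
  assert (H := is_pseries_plus _ _ _ _ _ H1 H2).
  replace (l - m)%R with (plus l (-1 * m))%R by (unfold plus; simpl; ring).
  eapply is_pseries_ext; [|exact H]. intros n; unfold PS_plus, plus; simpl; ring.
Qed.

Lemma is_ray_series_scal k c t l : is_ray_series c t l -> is_ray_series (fun n => k * c n) t (k * l).
Proof.
  intros [H1 H2]; split.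
  - apply (is_pseries_Rminus (fun n => Re k * Re (c n))%R (fun n => Im k * Im (c n))%R);
    now apply is_pseries_Rscal.
  - apply (is_pseries_plus (fun n => Re k * Im (c n))%R (fun n => Im k * Re (c n))%R);
    now apply is_pseries_Rscal.
Qed.

Lemma Re_Csum f n : Re (Csum f (S n)) = sum_f_R0 (fun i => Re (f i)) n.
Proof.
  induction n as [|n IH]; [simpl; unfold Re; simpl; ring|].
  simpl sum_f_R0. rewrite <- IH. reflexivity.
Qed.

Lemma Im_Csum f n : Im (Csum f (S n)) = sum_f_R0 (fun i => Im (f i)) n.
Proof.
  induction n as [|n IH]; [simpl; unfold Im; simpl; ring|].
  simpl sum_f_R0. rewrite <- IH. reflexivity.
Qed.

Lemma is_ray_series_mult c d t l m : is_ray_series c t l -> is_ray_series d t m -> in_radius c t -> in_radius d t ->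
  is_ray_series (fun n => Csum (fun i => c i * d (n - i)%nat) (S n)) t (l * m).
Proof.
  intros [H1 H2] [H3 H4] [R1 R2] [R3 R4]; split.
  - eapply is_pseries_ext; [|exact (is_pseries_Rminus _ _ _ _ _
      (is_pseries_mult _ _ _ _ _ H1 H3 R1 R3) (is_pseries_mult _ _ _ _ _ H2 H4 R2 R4))].
    intros n. cbv beta. rewrite Re_Csum. unfold PS_mult.
    rewrite <- minus_sum. apply sum_eq. intros i _. reflexivity.
  - eapply is_pseries_ext; [|exact (is_pseries_plus _ _ _ _ _
      (is_pseries_mult _ _ _ _ _ H1 H4 R1 R4) (is_pseries_mult _ _ _ _ _ H2 H3 R2 R3))].
    intros n. cbv beta. rewrite Im_Csum. unfold PS_mult, PS_plus, plus. simpl.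
    rewrite <- plus_sum. apply sum_eq. intros i _. reflexivity.
Qed.

Definition diff_coef (c : nat -> C) (n : nat) : C := RtoC (INR (S n)) * c (S n).
(** The coefficients of t d/dt. *)
Definition euler_coef (c : nat -> C) (n : nat) : C := RtoC (INR n) * c n.

Lemma Re_RtoC_mult x z : Re (RtoC x * z) = (x * Re z)%R.
Proof. unfold Re; simpl; ring. Qed.
Lemma Im_RtoC_mult x z : Im (RtoC x * z) = (x * Im z)%R.
Proof. unfold Im; simpl; ring. Qed.

Lemma in_radius_diff c t : in_radius c t -> in_radius (diff_coef c) t.
Proof.
  intros [H1 H2]; split;
    [rewrite (CV_radius_ext _ (PS_derive (fun n => Re (c n)))) by (intros; apply Re_RtoC_mult)
    |rewrite (CV_radius_ext _ (PS_derive (fun n => Im (c n)))) by (intros; apply Im_RtoC_mult)];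
  now rewrite CV_radius_derive.
Qed.

Lemma PS_euler_eq (a : nat -> R) n : PS_incr_1 (PS_derive a) n = (INR n * a n)%R.
Proof. destruct n; [simpl; rewrite Rmult_0_l; reflexivity|reflexivity]. Qed.

Lemma in_radius_euler c t : in_radius c t -> in_radius (euler_coef c) t.
Proof.
  intros [H1 H2]; split;
    [rewrite (CV_radius_ext _ (PS_incr_1 (PS_derive (fun n => Re (c n)))))
       by (intros; rewrite PS_euler_eq; apply Re_RtoC_mult)
    |rewrite (CV_radius_ext _ (PS_incr_1 (PS_derive (fun n => Im (c n)))))
       by (intros; rewrite PS_euler_eq; apply Im_RtoC_mult)];
  now rewrite CV_radius_incr_1, CV_radius_derive.
Qed.

Lemma is_ray_series_euler c t : in_radius c t -> is_ray_series (euler_coef c) t (RtoC t * ray_series (diff_coef c) t).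
Proof.
  intros H. assert (D := in_radius_is_ray_series _ _ (in_radius_diff c t H)). destruct D as [D1 D2]. split.
  - rewrite Re_RtoC_mult. eapply is_pseries_ext; [|exact (is_pseries_incr_1 _ _ _ D1)].
    intros n; destruct n.
    + unfold euler_coef; rewrite Re_RtoC_mult; simpl; now rewrite Rmult_0_l.
    + reflexivity.
  - rewrite Im_RtoC_mult. eapply is_pseries_ext; [|exact (is_pseries_incr_1 _ _ _ D2)].
    intros n; destruct n.
    + unfold euler_coef; rewrite Im_RtoC_mult; simpl; now rewrite Rmult_0_l.
    + reflexivity.
Qed.

Lemma curve_deriv_ray_series c t : in_radius c t -> curve_deriv (ray_series c) t (ray_series (diff_coef c) t).
Proof.
  intros [H1 H2]; split; simpl.
  - evar_last; [apply is_derive_PSeries, H1|]. apply PSeries_ext. intros n. symmetry. apply Re_RtoC_mult.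
  - evar_last; [apply is_derive_PSeries, H2|]. apply PSeries_ext. intros n. symmetry. apply Im_RtoC_mult.
Qed.

Lemma CV_radius_geom (a : nat -> R) B q t : 0 < q -> (forall n, Rabs (a n) <= B * q ^ n) ->
  Rabs t < / q -> Rbar_lt (Rabs t) (CV_radius a).
Proof.
  intros Hq H Ht. apply (Rbar_lt_le_trans _ (/ q)%R); [exact Ht|].
  apply (CV_radius_bounded a). exists B. intros n.
  rewrite Rabs_mult, <- RPow_abs, (Rabs_pos_eq (/ q)) by (left; apply Rinv_0_lt_compat, Hq).
  rewrite pow_inv.
  assert (P : 0 < q ^ n) by now apply pow_lt.
  apply (Rmult_le_reg_r (q ^ n)); [exact P|]. rewrite Rmult_assoc, Rinv_l, Rmult_1_r by lra. apply H.
Qed.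

Lemma in_radius_geom c B q t : 0 < q -> (forall n, Cmod (c n) <= B * q ^ n) ->
  Rabs t < / q -> in_radius c t.
Proof.
  intros Hq H Ht; split; apply (CV_radius_geom _ B q t Hq); try assumption; intros n;
  (eapply Rle_trans; [|apply H]); [apply re_le_Cmod|apply Im_le_Cmod].
Qed.

Section Generating.
Variables (x : C) (B p : R).
Hypotheses (Hp : 0 < p) (HB : forall n, Cmod (vcoef n x) <= B * p ^ n).

Lemma B_nonneg : 0 <= B.
Proof.
  assert (H := HB 0). simpl in H. rewrite Rmult_1_r in H. eapply Rle_trans; [apply Cmod_ge_0|exact H].
Qed.

(** [Vsum s] is U(s) - x; its terms along the ray of [s] are [Vterm s n] t^n. *)
Definition Vterm (s : C) (n : nat) : C := vcoef n x * s ^ n.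
Definition Vsum (s : C) : C := ray_series (Vterm s) 1.

Lemma Vterm_in_radius s t : Cmod s * p < 1 -> 0 <= t <= 1 -> in_radius (Vterm s) t.
Proof.
  intros Hs Ht.
  assert (Ps := Cmod_ge_0 s).
  set (q := ((1 + Cmod s * p) / 2)%R). assert (0 <= Cmod s * p)%R by (apply Rmult_le_pos; lra).
  assert (Hq : 0 < q < 1) by (unfold q; lra).
  assert (P := B_nonneg).
  apply (in_radius_geom _ B q); [lra| |].
  - intros n. unfold Vterm. rewrite Cmod_mult, Cmod_pow.
    apply (Rle_trans _ (B * p ^ n * Cmod s ^ n)).
    + apply Rmult_le_compat_r; [now apply pow_le|apply HB].
    + rewrite Rmult_assoc, <- Rpow_mult_distr. apply Rmult_le_compat_l; [exact P|].
      apply pow_incr. unfold q; lra.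
  - rewrite Rabs_pos_eq by lra. apply (Rle_lt_trans _ 1); [lra|].
    rewrite <- Rinv_1. apply Rinv_lt_contravar; lra.
Qed.

Lemma ray_ode s t : Cmod s * p < 1 -> 0 <= t <= 1 ->
  ray_series (diff_coef (Vterm s)) t * (1 + s * RtoC t + s * RtoC t * ray_series (Vterm s) t) + s * ray_series (Vterm s) t = 0.
Proof.
  intros Hs Ht. assert (R := Vterm_in_radius s t Hs Ht).
  assert (iV := in_radius_is_ray_series _ _ R).
  assert (iD := in_radius_is_ray_series _ _ (in_radius_diff _ _ R)).
  assert (iE := is_ray_series_euler _ _ R).
  assert (iM := is_ray_series_mult _ _ _ _ _ iE iV (in_radius_euler _ _ R) R).
  set (V := ray_series (Vterm s) t) in *. set (D := ray_series (diff_coef (Vterm s)) t) in *.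
  assert (iS := is_ray_series_plus _ _ _ _ _ iD (is_ray_series_scal s _ _ _ (is_ray_series_plus _ _ _ _ _ iE (is_ray_series_plus _ _ _ _ _ iV iM)))).
  transitivity (D + s * (RtoC t * D + (V + RtoC t * D * V))); [ring|].
  apply (is_ray_series_unique _ _ _ _ iS).
  assert (i0 := is_ray_series_scal 0 _ _ _ iV). rewrite Cmult_0_l in i0.
  eapply is_ray_series_ext; [|exact i0]. intros n. cbv beta.
  rewrite (Csum_ext _ (fun i => s ^ n * (RtoC (INR i) * vcoef i x * vcoef (n - i) x))).
  2: { intros i Hi. unfold euler_coef, Vterm. replace (s ^ n) with (s ^ i * s ^ (n - i)).
       - ring. - rewrite <- Cpow_add_r. f_equal; lia. }
  rewrite Csum_scal. unfold diff_coef, euler_coef, Vterm.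
  assert (E := proj1 (ode_coef_0 n) x). unfold ode_coef in E.
  transitivity (s ^ S n * 0); [simpl; ring|]. rewrite <- E. rewrite S_INR, RtoC_plus. simpl Cpow. ring.
Qed.

(** The left-hand side has derivative 0 along the ray from 0 to [s]. *)
Lemma Vsum_equation s : Cmod s * p < 1 -> (1 + s * Vsum s) * Cexp (Vsum s + x) = 1.
Proof.
  intros Hs.
  set (F := fun t => (1 + RtoC t * s * ray_series (Vterm s) t) * Cexp (ray_series (Vterm s) t + x)).
  assert (E : F 0 = F 1).
  { apply curve_deriv_zero_const; [lra|]. intros t Ht.
    assert (dV := curve_deriv_ray_series _ _ (Vterm_in_radius s t Hs Ht)).
    assert (O := ray_ode s t Hs Ht).
    unfold F. eapply curve_deriv_eq.
    - apply curve_deriv_mult.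
      + apply curve_deriv_plus; [apply curve_deriv_const|].
        apply curve_deriv_mult; [apply curve_deriv_ray|exact dV].
      + apply curve_deriv_exp, curve_deriv_plus; [exact dV|apply curve_deriv_const].
    - cbv beta. match type of O with ?o = _ => transitivity (Cexp (ray_series (Vterm s) t + x) * o) end;
        [ring|rewrite O; ring]. }
  unfold F in E. unfold Vsum.
  replace (1 + s * ray_series (Vterm s) 1) with (1 + RtoC 1 * s * ray_series (Vterm s) 1) by ring.
  rewrite <- E.
  replace (ray_series (Vterm s) 0 + x) with (RtoC 0).
  - rewrite Cexp_0. ring.
  - unfold ray_series. rewrite !PSeries_0. unfold Vterm, vcoef. simpl Cpow.
    apply C_ext; unfold Re, Im; simpl; ring.
Qed.

(** 1 + s V = e^(-U), so 1 + s + s V = 0 says that U is a critical point of g; the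
    differential equation forbids this unless s V = 0. *)
Lemma Vsum_regular s : Cmod s * p < 1 -> 1 + s + s * Vsum s = 0 -> s * Vsum s = 0.
Proof.
  intros Hs H. assert (O := ray_ode s 1 Hs ltac:(lra)). fold (Vsum s) in O.
  replace (1 + s * RtoC 1 + s * RtoC 1 * Vsum s) with (1 + s + s * Vsum s) in O by ring.
  rewrite H in O. rewrite <- O. ring.
Qed.

Lemma Vsum_0 : Vsum 0 = - x.
Proof.
  assert (H : (Cmod 0 * p < 1)%R) by (rewrite Cmod_0; lra).
  unfold Vsum. rewrite <- (curve_deriv_zero_const (ray_series (Vterm 0)) 0 1); [|lra|].
  - unfold ray_series. rewrite !PSeries_0. apply C_ext; unfold Vterm, vcoef, Re, Im; simpl; ring.
  - intros t Ht. eapply curve_deriv_eq; [apply curve_deriv_ray_series; now apply Vterm_in_radius|].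
    etransitivity; [|exact (ray_ode 0 t H Ht)]. ring.
Qed.

Lemma Vsum_lipschitz r : 0 <= r -> r * p < 1 -> exists K, 0 <= K /\
  forall s s', Cmod s <= r -> Cmod s' <= r -> Cmod (Vsum s - Vsum s') <= K * Cmod (s - s').
Proof.
  intros Hr Hrp.
  set (g := fun n => (INR n * (B * p ^ n) * r ^ pred n)%R).
  assert (P := B_nonneg).
  assert (Hg0 : forall n, 0 <= g n).
  { intros n; unfold g. repeat apply Rmult_le_pos; try apply pos_INR; try assumption; apply pow_le; lra. }
  assert (Hg : ex_series g).
  { apply ex_series_incr_1.
    assert (RR : Rbar_lt (Rabs r) (CV_radius (fun n => B * p ^ n)%R)).
    { apply (CV_radius_geom _ B p); [exact Hp| |].
      - intros n. rewrite Rabs_pos_eq; [lra|]. apply Rmult_le_pos; [exact P|apply pow_le; lra].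
      - rewrite Rabs_pos_eq by exact Hr. apply (Rmult_lt_reg_r p); [exact Hp|]. rewrite Rinv_l; lra. }
    rewrite <- (CV_radius_derive (fun n => B * p ^ n)%R) in RR. apply CV_disk_inside in RR.
    eapply ex_series_ext; [|exact RR]. intros n. unfold PS_derive, g. simpl pred.
    rewrite Rabs_pos_eq; [reflexivity|]. repeat apply Rmult_le_pos; try apply pos_INR; try apply pow_le; lra. }
  assert (S0 : 0 <= Series g).
  { replace 0%R with (Series (fun _ => 0%R)).
    - apply Series_le; [intros n; split; [lra|apply Hg0]|exact Hg].
    - transitivity (PSeries (fun _ => 0%R) 1); [|apply PSeries_const_0].
      unfold PSeries. apply Series_ext. intros n. now rewrite Rmult_0_l. }
  exists (2 * Series g)%R. split; [lra|].
  intros s s' Hs Hs'.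
  assert (D : forall n, Cmod (Vterm s n - Vterm s' n) <= Cmod (s - s') * g n).
  { intros n. unfold Vterm. replace (vcoef n x * s ^ n - vcoef n x * s' ^ n) with (vcoef n x * (s ^ n - s' ^ n)) by ring.
    rewrite Cmod_mult. unfold g.
    replace (Cmod (s - s') * (INR n * (B * p ^ n) * r ^ pred n))%R
      with ((B * p ^ n) * (INR n * r ^ pred n * Cmod (s - s')))%R by ring.
    apply Rmult_le_compat; [apply Cmod_ge_0|apply Cmod_ge_0|apply HB|now apply Cpow_diff_le]. }
  assert (EX : forall z, Cmod z <= r -> in_radius (Vterm z) 1).
  { intros z Hz. apply Vterm_in_radius; [|lra]. apply (Rle_lt_trans _ (r * p)); [|lra].
    apply Rmult_le_compat_r; lra. }
  assert (K : forall pr : C -> R, (forall z w, pr (z - w) = (pr z - pr w)%R) -> (forall z, Rabs (pr z) <= Cmod z) ->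
    Rbar_lt (Rabs 1) (CV_radius (fun n => pr (Vterm s n))) -> Rbar_lt (Rabs 1) (CV_radius (fun n => pr (Vterm s' n))) ->
    Rabs (PSeries (fun n => pr (Vterm s n)) 1 - PSeries (fun n => pr (Vterm s' n)) 1) <= Cmod (s - s') * Series g).
  { intros pr Hpr Hle E1 E2.
    assert (A : forall w, Rbar_lt (Rabs 1) (CV_radius (fun n => pr (Vterm w n))) -> ex_series (fun n => pr (Vterm w n))).
    { intros w Hw. apply CV_disk_inside in Hw. apply ex_series_Rabs. eapply ex_series_ext; [|exact Hw].
      intros n. cbv beta. now rewrite pow1, Rmult_1_r. }
    assert (A' : forall w, PSeries (fun n => pr (Vterm w n)) 1 = Series (fun n => pr (Vterm w n))).
    { intros w. unfold PSeries. apply Series_ext. intros n. now rewrite pow1, Rmult_1_r. }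
    rewrite !A', <- Series_minus by now apply A.
    assert (exg : ex_series (fun n => Cmod (s - s') * g n)%R).
    { apply (ex_series_scal_l (Cmod (s - s')) g Hg). }
    assert (L : forall n, Rabs (pr (Vterm s n) - pr (Vterm s' n)) <= Cmod (s - s') * g n).
    { intros n. rewrite <- Hpr. eapply Rle_trans; [apply Hle|apply D]. }
    eapply Rle_trans; [apply Series_Rabs|].
    - apply (ex_series_le (K := R_AbsRing) (V := R_CompleteNormedModule) _ (fun n => Cmod (s - s') * g n)%R); [|exact exg].
      intros n. change (Rabs (Rabs (pr (Vterm s n) - pr (Vterm s' n))) <= Cmod (s - s') * g n).
      rewrite Rabs_Rabsolu. apply L.
    - rewrite <- Series_scal_l. apply Series_le; [|exact exg]. intros n; split; [apply Rabs_pos|apply L]. }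
  eapply Rle_trans; [apply Cmod_le_abs|].
  assert (K1 := K Re (fun z w => eq_refl) re_le_Cmod (proj1 (EX s Hs)) (proj1 (EX s' Hs'))).
  assert (K2 := K Im (fun z w => eq_refl) Im_le_Cmod (proj2 (EX s Hs)) (proj2 (EX s' Hs'))).
  change (Rabs (PSeries (fun n => Re (Vterm s n)) 1 - PSeries (fun n => Re (Vterm s' n)) 1) +
    Rabs (PSeries (fun n => Im (Vterm s n)) 1 - PSeries (fun n => Im (Vterm s' n)) 1) <= 2 * Series g * Cmod (s - s')).
  lra.
Qed.

End Generating.

(** * Continuation along paths, and divergence *)

Lemma locally_Cmod (P : C -> Prop) z : locally (T := C_UniformSpace) z P <->
  exists d, 0 < d /\ forall y, Cmod (y - z) < d -> P y.
Proof.
  split.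
  - intros [d Hd]. exists d. split; [apply cond_pos|]. intros y Hy. apply Hd. split.
    + change (Rabs (Re (y - z)) < d). eapply Rle_lt_trans; [apply re_le_Cmod|exact Hy].
    + change (Rabs (Im (y - z)) < d). eapply Rle_lt_trans; [apply Im_le_Cmod|exact Hy].
  - intros (d & Hd & H). exists (mkposreal (d / 2) ltac:(lra)). intros y [H1 H2]. apply H.
    change (Rabs (Re (y - z)) < d / 2) in H1. change (Rabs (Im (y - z)) < d / 2) in H2.
    eapply Rle_lt_trans; [apply Cmod_le_abs|]. lra.
Qed.

Lemma components_locally {T : UniformSpace} (F : T -> C) (u : T) e : 0 < e ->
  continuous (fun z => Re (F z)) u -> continuous (fun z => Im (F z)) u ->
  locally u (fun z => Cmod (F z - F u) < e).
Proof.
  intros He H1 H2. assert (He2 : 0 < e / 2) by lra.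
  assert (A1 := proj1 (filterlim_locally _ _) H1 (mkposreal _ He2)).
  assert (A2 := proj1 (filterlim_locally _ _) H2 (mkposreal _ He2)).
  generalize (filter_and _ _ A1 A2). apply filter_imp. intros z [B1 B2].
  change (Rabs (Re (F z - F u)) < e / 2) in B1. change (Rabs (Im (F z - F u)) < e / 2) in B2.
  eapply Rle_lt_trans; [apply Cmod_le_abs|]. lra.
Qed.

Lemma C_cont_eps F u : C_cont F u -> forall e, 0 < e ->
  exists d, 0 < d /\ forall z, Cmod (z - u) < d -> Cmod (F z - F u) < e.
Proof. intros [H1 H2] e He. now apply (locally_Cmod (fun z => Cmod (F z - F u) < e)), components_locally. Qed.

Lemma curve_cont_eps f t : curve_cont f t -> forall e, 0 < e ->
  exists d, 0 < d /\ forall s, Rabs (s - t) < d -> Cmod (f s - f t) < e.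
Proof.
  intros [H1 H2] e He. destruct (components_locally f t e He H1 H2) as [d D].
  exists d. split; [apply cond_pos|exact D].
Qed.

(** The difference quotient of e^(-u) between two points close to [u0] is close to
    the derivative at [u0]. *)
Lemma Cexp_strict u0 e : 0 < e -> exists d, 0 < d /\ forall a b,
  Cmod (a - u0) < d -> Cmod (b - u0) < d ->
  Cmod (Cexp (- b) - Cexp (- a) + Cexp (- u0) * (b - a)) <= e * Cmod (b - a).
Proof.
  intros He.
  assert (C0 : C_cont (fun u => Cexp (- u)) u0).
  { apply (C_cont_exp (fun u => - u)), C_cont_opp, C_cont_id. }
  destruct (C_cont_eps _ _ C0 (e / 2)) as (d & Hd & D); [lra|].
  exists d. split; [exact Hd|]. intros a b Ha Hb.
  set (F := fun u => Cexp (- u) + Cexp (- u0) * u).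
  set (f := fun u => - Cexp (- u) + Cexp (- u0)).
  assert (HF : forall u, hol_deriv F u (f u)).
  { intros u. eapply hol_eq.
    - apply (hol_plus (fun u => Cexp (- u)) (fun u => Cexp (- u0) * u)).
      + apply (hol_exp (fun u => - u)), hol_opp, hol_id.
      + apply (hol_mult (fun _ => Cexp (- u0)) (fun u => u)); [apply hol_const|apply hol_id].
    - unfold f; ring. }
  assert (Hf : holomorphic_on (on_seg a b) f).
  { intros u _. eexists.
    apply (hol_plus (fun u => - Cexp (- u)) (fun _ => Cexp (- u0))); [|apply hol_const].
    apply hol_opp, (hol_exp (fun u => - u)), hol_opp, hol_id. }
  replace (Cexp (- b) - Cexp (- a) + Cexp (- u0) * (b - a)) with (F b - F a) by (unfold F; ring).
  rewrite <- (seg_int_deriv F f a b (fun u _ => HF u) Hf).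
  replace (e * Cmod (b - a))%R with (2 * Cmod (b - a) * (e / 2))%R by field.
  apply seg_int_bound; [exact Hf|].
  intros u (t & Ht & ->). unfold f.
  replace (- Cexp (- line a b t) + Cexp (- u0)) with (- (Cexp (- line a b t) - Cexp (- u0))) by ring.
  rewrite Cmod_opp. left. apply D. unfold line.
  replace (a + t * (b - a) - u0) with (RtoC (1 - t) * (a - u0) + RtoC t * (b - u0))
    by (rewrite RtoC_minus; ring).
  eapply Rle_lt_trans; [apply Cmod_triangle|]. rewrite !Cmod_mult, !Cmod_R, !Rabs_pos_eq by lra.
  destruct (Req_dec t 0) as [->|N]; [lra|]. nra.
Qed.

(** Connectedness of [0, T]. *)
Lemma interval_induction (P : R -> Prop) T : 0 <= T -> P 0 ->
  (forall t, 0 <= t <= T -> (forall s, 0 <= s < t -> P s) -> 0 < t -> P t) ->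
  (forall t, 0 <= t <= T -> P t -> exists d, 0 < d /\ forall s, 0 <= s <= T -> Rabs (s - t) < d -> P s) ->
  P T.
Proof.
  intros HT P0 Hclosed Hopen.
  set (E := fun t => 0 <= t <= T /\ forall s, 0 <= s <= t -> P s).
  destruct (completeness E) as [m [Hub Hlub]].
  - exists T. intros t [Ht _]; lra.
  - exists 0%R. split; [lra|]. intros s Hs. replace s with 0%R by lra. exact P0.
  - assert (Hm : 0 <= m <= T).
    { split.
      - apply Hub. split; [lra|]. intros s Hs. replace s with 0%R by lra. exact P0.
      - apply Hlub. intros t [Ht _]; lra. }
    assert (Below : forall s, 0 <= s < m -> P s).
    { intros s Hs. apply NNPP. intros NP.
      assert (m <= s); [|lra]. apply Hlub. intros t [Ht HP].
      apply Rnot_lt_le. intros L. apply NP, HP. lra. }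
    assert (Pm : P m).
    { destruct (Req_dec m 0) as [->|N]; [exact P0|]. apply Hclosed; [exact Hm|exact Below|lra]. }
    destruct (Hopen m Hm Pm) as (d & Hd & D).
    destruct (Rle_lt_dec T m) as [L|L]; [replace T with m by lra; exact Pm|].
    set (m' := Rmin T (m + d / 2)).
    assert (Em : E m').
    { assert (L1 := Rmin_l T (m + d / 2)). assert (L2 := Rmin_r T (m + d / 2)). fold m' in L1, L2.
      assert (m < m') by (apply Rmin_glb_lt; lra).
      split; [lra|]. intros s Hs. destruct (Rlt_le_dec s m); [apply Below; lra|].
      apply D; [lra|]. rewrite Rabs_pos_eq; lra. }
    apply Hub in Em. assert (m < m') by (apply Rmin_glb_lt; lra). lra.
Qed.

Section Divergence.
Variables (x : C) (B p : R).
Hypotheses (Hp : 0 < p) (HB : forall n, Cmod (vcoef n x) <= B * p ^ n).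

Definition Usum (s : C) : C := Vsum x s + x.

Lemma Usum_0 : Usum 0 = 0.
Proof. unfold Usum. rewrite (Vsum_0 x B p Hp HB). ring. Qed.

Lemma Usum_Emap s : Cmod s * p < 1 -> Emap (Usum s) = s * (x - Usum s).
Proof.
  intros Hs. assert (E := Vsum_equation x B p Hp HB s Hs). fold (Usum s) in E.
  unfold Emap.
  assert (E2 : Cexp (Usum s) * Cexp (- Usum s) = 1).
  { rewrite <- Cexp_plus, Cplus_opp_r. apply Cexp_0. }
  replace (Cexp (- Usum s)) with ((1 + s * Vsum x s) * (Cexp (Usum s) * Cexp (- Usum s))).
  - rewrite E2. unfold Usum. ring.
  - rewrite Cmult_assoc, E. ring.
Qed.

Lemma Usum_cont s e : Cmod s * p < 1 -> 0 < e -> exists d, 0 < d /\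
  forall s', Cmod (s' - s) < d -> Cmod s' * p < 1 /\ Cmod (Usum s' - Usum s) < e.
Proof.
  intros Hs He.
  (* Vsum is Lipschitz on discs of radius less than 1 / p *)
  set (r := ((Cmod s + / p) / 2)%R).
  assert (I : 0 < / p) by (apply Rinv_0_lt_compat; exact Hp).
  assert (Ps := Cmod_ge_0 s).
  assert (Hs1 : Cmod s < / p).
  { apply (Rmult_lt_reg_r p); [exact Hp|]. rewrite Rinv_l; lra. }
  assert (Hr : (r * p < 1)%R).
  { apply (Rmult_lt_reg_r (/ p)); [exact I|]. rewrite Rmult_assoc, Rinv_r by lra. unfold r; lra. }
  destruct (Vsum_lipschitz x B p Hp HB r ltac:(unfold r; lra) Hr) as (K & HK & HL).
  exists (Rmin (r - Cmod s) (e / (K + 1))). split.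
  - apply Rmin_glb_lt; [unfold r; lra|]. apply Rdiv_lt_0_compat; lra.
  - intros s' Hs'.
    assert (L1 : Cmod (s' - s) < r - Cmod s) by (eapply Rlt_le_trans; [exact Hs'|apply Rmin_l]).
    assert (L2 : Cmod (s' - s) < e / (K + 1)) by (eapply Rlt_le_trans; [exact Hs'|apply Rmin_r]).
    assert (M : Cmod s' < r).
    { replace s' with (s' - s + s) by ring. eapply Rle_lt_trans; [apply Cmod_triangle|]. lra. }
    split; [nra|].
    replace (Usum s' - Usum s) with (Vsum x s' - Vsum x s) by (unfold Usum; ring).
    eapply Rle_lt_trans; [apply HL; unfold r in *; lra|].
    apply (Rmult_lt_compat_r (K + 1)) in L2; [|lra].
    replace (e / (K + 1) * (K + 1))%R with e in L2 by (field; lra).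
    generalize (Cmod_ge_0 (s' - s)). nra.
Qed.

(** The function g, whose local inverse at 0 is [Usum]. *)
Definition gmap (u : C) : C := Emap u / (x - u).

(** |g(u)| < 1/p, in a form that excludes the pole of g. *)
Definition inside_disc (u : C) : Prop := p * Cmod (Emap u) < Cmod (x - u).

Lemma inside_disc_neq u : inside_disc u -> x - u <> 0.
Proof.
  unfold inside_disc. intros H E. rewrite E, Cmod_0 in H. generalize (Cmod_ge_0 (Emap u)); nra.
Qed.

Lemma inside_disc_gmap u : inside_disc u -> Cmod (gmap u) * p < 1.
Proof.
  intros H. assert (N := inside_disc_neq u H). unfold gmap, Cdiv. rewrite Cmod_mult, Cmod_inv by exact N.
  apply Cmod_gt_0 in N. apply (Rmult_lt_reg_r (Cmod (x - u))); [exact N|].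
  replace (Cmod (Emap u) * / Cmod (x - u) * p * Cmod (x - u))%R with (p * Cmod (Emap u))%R by (field; lra).
  rewrite Rmult_1_l. exact H.
Qed.

Lemma gmap_eq u : inside_disc u -> Emap u = gmap u * (x - u).
Proof. intros H. unfold gmap. field. now apply inside_disc_neq. Qed.

(** At [u0] the root is simple by [Vsum_regular], so two roots of
    1 - e^(-u) = s (x - u) close to [u0] coincide. *)
Lemma Usum_local u0 : inside_disc u0 -> Usum (gmap u0) = u0 -> exists d, 0 < d /\
  forall u, inside_disc u -> Cmod (u - u0) < d -> Cmod (gmap u - gmap u0) < d -> Usum (gmap u) = u.
Proof.
  intros G E. set (s0 := gmap u0) in *.
  assert (Hs0 := inside_disc_gmap u0 G). fold s0 in Hs0.
  assert (N : s0 + Cexp (- u0) <> 0).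
  { intros Z.
    assert (X : Cexp (- u0) = 1 + s0 * Vsum x s0).
    { assert (A := Usum_Emap s0 Hs0). rewrite E in A. unfold Emap in A.
      assert (V : Vsum x s0 = u0 - x) by (rewrite <- E; unfold Usum; ring).
      rewrite V. transitivity (1 - (1 - Cexp (- u0))); [ring|]. rewrite A. ring. }
    assert (Y : s0 * Vsum x s0 = 0).
    { apply (Vsum_regular x B p Hp HB s0 Hs0). rewrite <- Z, X. ring. }
    assert (S : s0 = - (1)).
    { rewrite X, Y in Z. transitivity (s0 + (1 + 0) - 1); [ring|]. rewrite Z. ring. }
    apply (inside_disc_neq u0 G). rewrite <- E. unfold Usum.
    transitivity (s0 * Vsum x s0); [rewrite S; ring|exact Y]. }
  set (m := Cmod (s0 + Cexp (- u0))). assert (Hm : 0 < m) by now apply Cmod_gt_0.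
  destruct (Cexp_strict u0 (m / 3)) as (d1 & P1 & D1); [lra|].
  destruct (Usum_cont s0 d1 Hs0 P1) as (d2 & P2 & D2).
  exists (Rmin (m / 3) (Rmin d1 d2)). split; [repeat apply Rmin_glb_lt; lra|].
  intros u Gu Hu Hg.
  assert (Lm := Rmin_l (m / 3) (Rmin d1 d2)). assert (Lr := Rmin_r (m / 3) (Rmin d1 d2)).
  assert (L1 := Rmin_l d1 d2). assert (L2 := Rmin_r d1 d2).
  set (s := gmap u) in *. destruct (D2 s ltac:(lra)) as [Hs HU]. rewrite E in HU.
  assert (T := D1 (Usum s) u HU ltac:(lra)).
  assert (EU := Usum_Emap s Hs). assert (Eu := gmap_eq u Gu). fold s in Eu.
  unfold Emap in EU, Eu.
  replace (Cexp (- u) - Cexp (- Usum s) + Cexp (- u0) * (u - Usum s))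
    with ((s + Cexp (- u0)) * (u - Usum s)) in T.
  2: { transitivity ((1 - Cexp (- Usum s)) - (1 - Cexp (- u)) + Cexp (- u0) * (u - Usum s)); [|ring].
       rewrite EU, Eu. ring. }
  rewrite Cmod_mult in T.
  assert (Q : (m <= Cmod (s + Cexp (- u0)) + m / 3)%R).
  { unfold m at 1. replace (s0 + Cexp (- u0)) with ((s + Cexp (- u0)) + - (s - s0)) by ring.
    eapply Rle_trans; [apply Cmod_triangle|]. rewrite Cmod_opp. lra. }
  assert (Z : Cmod (u - Usum s) = 0%R).
  { generalize (Cmod_ge_0 (u - Usum s)). intros Pz. nra. }
  apply Cmod_eq_0 in Z. transitivity (u - (u - Usum s)); [ring|]. rewrite Z. ring.
Qed.

(** The set of parameters at which U(g(u)) = u is closed by continuity and open by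
    [Usum_local]. *)
Lemma Usum_path (c : R -> C) T : 0 <= T ->
  (forall t, 0 <= t <= T -> exists d, curve_deriv c t d) ->
  (forall t, 0 <= t <= T -> inside_disc (c t)) ->
  Usum (gmap (c 0)) = c 0 -> Usum (gmap (c T)) = c T.
Proof.
  intros HT Hc Hg H0.
  assert (cc : forall t, 0 <= t <= T -> curve_cont c t).
  { intros t Ht. destruct (Hc t Ht) as [d Hd]. eapply curve_deriv_cont, Hd. }
  assert (cg : forall t, 0 <= t <= T -> curve_cont (fun t => gmap (c t)) t).
  { intros t Ht. destruct (Hc t Ht) as [d Hd]. eapply curve_deriv_cont.
    unfold gmap, Cdiv. apply curve_deriv_mult.
    - apply (hol_Emap (c t) c t d eq_refl Hd).
    - apply curve_deriv_inv; [apply inside_disc_neq, Hg, Ht|].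
      apply curve_deriv_minus; [apply curve_deriv_const|exact Hd]. }
  apply (interval_induction (fun t => Usum (gmap (c t)) = c t) T HT H0).
  - intros t Ht Hb Pt.
    assert (Z : Cmod (Usum (gmap (c t)) - c t) = 0%R).
    { apply (eq_0_le_linear _ 1 1); [lra|apply Cmod_ge_0|]. intros e He. rewrite Rmult_1_l.
      destruct (Usum_cont (gmap (c t)) (e / 2) (inside_disc_gmap _ (Hg t Ht))) as (d1 & P1 & D1); [lra|].
      destruct (curve_cont_eps _ _ (cg t Ht) d1 P1) as (d2 & P2 & D2).
      destruct (curve_cont_eps _ _ (cc t Ht) (e / 2)) as (d3 & P3 & D3); [lra|].
      set (d := Rmin t (Rmin d2 d3)).
      assert (Pd : 0 < d) by (repeat apply Rmin_glb_lt; lra).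
      assert (M1 := Rmin_l t (Rmin d2 d3)). assert (M2 := Rmin_r t (Rmin d2 d3)).
      assert (M3 := Rmin_l d2 d3). assert (M4 := Rmin_r d2 d3). fold d in M1, M2.
      set (s := (t - d / 2)%R).
      assert (As : Rabs (s - t) < d) by (unfold s; rewrite Rabs_left; lra).
      assert (A1 := D2 s ltac:(lra)). cbv beta in A1. apply D1 in A1. destruct A1 as [_ A1].
      assert (A2 := D3 s ltac:(lra)).
      rewrite (Hb s) in A1 by (unfold s; lra).
      replace (Usum (gmap (c t)) - c t) with (- (c s - Usum (gmap (c t))) + (c s - c t)) by ring.
      eapply Rle_trans; [apply Cmod_triangle|]. rewrite Cmod_opp. lra. }
    apply Cmod_eq_0 in Z. transitivity ((Usum (gmap (c t)) - c t) + c t); [ring|]. rewrite Z. ring.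
  - intros t Ht Et. destruct (Usum_local (c t) (Hg t Ht) Et) as (d & Pd & D).
    destruct (curve_cont_eps _ _ (cg t Ht) d Pd) as (d1 & P1 & D1).
    destruct (curve_cont_eps _ _ (cc t Ht) d Pd) as (d2 & P2 & D2).
    exists (Rmin d1 d2). split; [now apply Rmin_glb_lt|].
    intros s Hs As. apply D; [now apply Hg| |].
    + apply D2. eapply Rlt_le_trans; [exact As|apply Rmin_r].
    + apply D1. eapply Rlt_le_trans; [exact As|apply Rmin_l].
Qed.

Lemma Usum_at_0 : x <> 0 -> Usum (gmap 0) = 0.
Proof.
  intros N. replace (gmap 0) with (RtoC 0); [apply Usum_0|].
  unfold gmap, Emap. rewrite Copp_0, Cexp_0. field. intros E; apply N. rewrite <- E; ring.
Qed.

(** g tends to 0 along the ray, so U(g(u)) tends to U(0) = 0 while u is unbounded. *)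
Lemma no_escape (y : R) (u0 : R) : 0 <= u0 -> Re x <= u0 ->
  (forall t, 0 <= t -> Usum (gmap ((u0 + t)%R, y)) = ((u0 + t)%R, y)) -> False.
Proof.
  intros Hu0 Hx H.
  destruct (Usum_cont 0 1) as (d & Pd & D); [rewrite Cmod_0; lra|lra|].
  set (t := (2 / d + 1)%R). assert (Pt : 0 < 2 / d) by (apply Rdiv_lt_0_compat; lra).
  specialize (H t ltac:(unfold t; lra)). set (u := ((u0 + t)%R, y) : C) in *.
  assert (L : t <= Cmod (x - u)).
  { eapply Rle_trans; [|apply re_le_Cmod]. rewrite Rabs_left1; unfold u, Re in *; simpl; unfold t; lra. }
  assert (N : x - u <> 0) by (apply Cmod_gt_0; unfold t in *; lra).
  assert (E : Cmod (Emap u) <= 2).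
  { unfold Emap. eapply Rle_trans; [apply Cmod_triangle|]. rewrite Cmod_opp, Cmod_1.
    assert (Cmod (Cexp (- u)) <= 1); [|lra].
    rewrite Cmod_Cexp, <- exp_0.
    apply exp_mono. unfold u, Re in *; simpl in *; unfold t in *; lra. }
  assert (G : Cmod (gmap u - 0) < d).
  { replace (gmap u - 0) with (gmap u) by ring. unfold gmap, Cdiv. rewrite Cmod_mult, Cmod_inv by exact N.
    apply (Rmult_lt_reg_r (Cmod (x - u))); [unfold t in *; lra|].
    rewrite Rmult_assoc, Rinv_l, Rmult_1_r by (unfold t in *; lra).
    assert (d * t = 2 + d)%R by (unfold t; field; lra). nra. }
  destruct (D _ G) as [_ Q]. rewrite H, Usum_0 in Q.
  assert (R1 := re_le_Cmod (u - 0)).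
  assert (Re (u - 0) = u0 + t)%R by (unfold u, Re; simpl; ring).
  rewrite H0 in R1. assert (A := Rle_abs (u0 + t)). unfold t in *; lra.
Qed.

End Divergence.

Lemma ex_series_C_bounded (a : nat -> C) : ex_series a -> exists B, forall n, Cmod (a n) <= B.
Proof.
  intros H. apply (Cauchy_ex_series (V := C_CompleteNormedModule)) in H.
  destruct (H (mkposreal 1 Rlt_0_1)) as [N HN]. simpl in HN.
  assert (K : forall M, exists B, forall n, (n < M)%nat -> Cmod (a n) <= B).
  { induction M as [|M [B HB]]; [exists 0%R; intros n Hn; lia|].
    exists (Rmax B (Cmod (a M))). intros n Hn.
    destruct (Nat.eq_dec n M) as [->|NE]; [apply Rmax_r|].
    eapply Rle_trans; [apply HB; lia|apply Rmax_l]. }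
  destruct (K N) as [B HB]. exists (Rmax B 1). intros n.
  destruct (Nat.lt_ge_cases n N) as [L|L].
  - eapply Rle_trans; [now apply HB|apply Rmax_l].
  - eapply Rle_trans; [|apply Rmax_r]. left.
    specialize (HN n n L L). rewrite sum_n_n in HN. exact HN.
Qed.

Lemma ex_series_C_geom (a : nat -> C) K q : 0 <= q < 1 -> (forall n, Cmod (a n) <= K * q ^ n) -> ex_series a.
Proof.
  intros Hq H. apply (ex_series_le (V := C_CompleteNormedModule) a (fun n => K * q ^ n)%R H).
  apply (ex_series_scal_l K (fun n => q ^ n)%R). apply ex_series_geom. rewrite Rabs_pos_eq; lra.
Qed.

(** The interior, relative to b >= 0, of the complement of [conv_region]. *)
Definition div_region (R b : R) : Prop :=
  R < 1 \/ exists phi, 0 <= phi < PI / 2 /\ (R * cos phi = 1)%R /\ (R * sin phi - phi < b)%R.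

Lemma exp_opp_bounds t : 0 <= t -> (1 - t <= exp (- t))%R /\ exp (- t) <= 1.
Proof.
  intros Ht. split; [apply exp_ineq1_le|]. rewrite <- exp_0. apply exp_mono. lra.
Qed.

Lemma real_ray_inside_disc lam R t : 0 < R < 1 -> Re lam = ln R -> 0 <= t -> inside_disc lam R (RtoC t).
Proof.
  intros HR Ha Ht. unfold inside_disc.
  assert (La : ln R < 0) by (rewrite <- ln_1; apply ln_increasing; lra).
  apply (Rlt_le_trans _ (t - ln R)).
  - replace (Emap t) with (RtoC (1 - exp (- t))).
    + rewrite Cmod_R. destruct (exp_opp_bounds t Ht) as [L L'].
      rewrite Rabs_pos_eq by lra. nra.
    + apply C_ext; [rewrite Re_Emap|rewrite Im_Emap]; simpl; unfold Re, Im; simpl.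
      * rewrite cos_0; ring. * rewrite sin_0; ring.
  - eapply Rle_trans; [|apply re_le_Cmod]. replace (Re (lam - t)) with (Re lam - t)%R by (unfold Re; simpl; ring).
    rewrite Ha, Rabs_left; lra.
Qed.

Lemma cos_sin_sign e t : (e = 1 \/ e = -1)%R -> cos (e * t) = cos t /\ (sin (e * t) = e * sin t)%R.
Proof.
  intros [-> | ->]; [rewrite !Rmult_1_l; auto|].
  replace (-1 * t)%R with (- t)%R by ring. rewrite cos_neg, sin_neg. split; ring.
Qed.

(** Along this path |1 - e^(-u)| = sin t, while |x - u| is at least t + b; and
    R sin t - t <= R sin phi - phi < b because R cos phi = 1. *)
Lemma neck_path_inside_disc lam R phi e t : 1 <= R -> Re lam = ln R -> 0 <= phi < PI / 2 -> (R * cos phi = 1)%R ->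
  (R * sin phi - phi < Rabs (Im lam))%R -> (e = 1 \/ e = -1)%R -> (e * Im lam = Rabs (Im lam))%R ->
  0 <= t <= phi -> inside_disc lam R ((- ln (cos t))%R, (- (e * t))%R).
Proof.
  intros HR Ha Hphi Hc Hb He Hel Ht. unfold inside_disc.
  assert (P := PI_RGT_0).
  assert (Ct : 0 < cos t) by (apply cos_gt_0; lra).
  assert (St : 0 <= sin t) by (apply sin_ge_0; lra).
  set (u := ((- ln (cos t))%R, (- (e * t))%R) : C).
  assert (e2 : (e * e = 1)%R) by (destruct He as [-> | ->]; ring).
  destruct (cos_sin_sign e t He) as [Cos Sin].
  assert (ME : Cmod (Emap u) = sin t).
  { apply Rsqr_inj; [apply Cmod_ge_0|exact St|]. rewrite !Rsqr_pow2, Cmod2_alt, Re_Emap, Im_Emap.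
    unfold u, Re, Im; simpl. rewrite Ropp_involutive, exp_ln by exact Ct.
    rewrite cos_neg, sin_neg, Cos, Sin.
    assert (S2 := sin2_cos2_mult t).
    set (s := sin t) in *. set (c := cos t) in *.
    transitivity ((1 - c * c) * (1 - c * c) + (e * e) * (c * c) * (s * s))%R; [ring|].
    rewrite e2. replace (1 - c * c)%R with (s * s)%R by lra.
    transitivity (s * s * (s * s + c * c))%R; [ring|]. rewrite S2; ring. }
  rewrite ME.
  assert (T := sin_le_tangent t phi ltac:(lra) ltac:(lra)).
  assert (RT : (R * sin t <= R * sin phi + (R * cos phi) * (t - phi))%R).
  { replace (R * sin phi + R * cos phi * (t - phi))%R with (R * (sin phi + cos phi * (t - phi)))%R by ring.
    apply Rmult_le_compat_l; lra. }
  rewrite Hc in RT.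
  apply (Rlt_le_trans _ (t + Rabs (Im lam))); [lra|].
  eapply Rle_trans; [|apply Im_le_Cmod].
  replace (Im (lam - u)) with (e * (t + Rabs (Im lam)))%R.
  - rewrite Rabs_mult. replace (Rabs e) with 1%R.
    + rewrite Rmult_1_l. apply Rle_abs.
    + destruct He as [-> | ->]; [rewrite Rabs_R1; reflexivity|rewrite Rabs_left; lra].
  - rewrite <- Hel. transitivity (e * t + (e * e) * Im lam)%R; [ring|]. rewrite e2.
    unfold u, Im; simpl; ring.
Qed.

(** The computation is that of the horizontal sides in [contour_strict] with X = -t,
    where (e^X - 1)^2 <= X^2 and the inequality is reversed. *)
Lemma right_ray_inside_disc lam R phi e t : 1 <= R -> Re lam = ln R -> 0 <= phi < PI / 2 -> (R * cos phi = 1)%R ->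
  (R * sin phi - phi < Rabs (Im lam))%R -> (e = 1 \/ e = -1)%R -> (e * Im lam = Rabs (Im lam))%R ->
  0 <= t -> inside_disc lam R ((ln R + t)%R, (- (e * phi))%R).
Proof.
  intros HR Ha Hphi Hc Hb He Hel Ht. unfold inside_disc.
  set (u := ((ln R + t)%R, (- (e * phi))%R) : C).
  assert (P := PI_RGT_0).
  assert (Sp : 0 <= sin phi) by (apply sin_ge_0; lra).
  apply Rsqr_incrst_0; [|generalize (Cmod_ge_0 (Emap u)); nra|apply Cmod_ge_0].
  rewrite !Rsqr_pow2, (Cmod2_scal_Emap R (ln R) u) by (apply exp_ln; lra).
  rewrite (Cmod2_sub (ln R) lam u Ha).
  assert (e2 : (e * e = 1)%R) by (destruct He as [-> | ->]; ring).
  assert (Cos : cos (Im u) = cos phi).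
  { unfold u, Im; simpl. rewrite cos_neg. now apply cos_sin_sign. }
  rewrite Cos.
  replace (ln R - Re u)%R with (- t)%R by (unfold u, Re; simpl; ring).
  replace ((Im lam - Im u) ^ 2)%R with ((Rabs (Im lam) + phi) ^ 2)%R.
  2: { rewrite <- Hel. unfold u, Im; simpl.
    transitivity ((e * e) * (snd lam * snd lam) + 2 * e * snd lam * phi + phi * phi)%R; [ring|].
    transitivity ((snd lam * snd lam) + 2 * e * snd lam * phi + (e * e) * (phi * phi))%R; [rewrite e2; ring|ring]. }
  replace (2 * R * exp (- t) * cos phi)%R with (2 * exp (- t) * (R * cos phi))%R by ring. rewrite Hc.
  assert (HT := neck_square R phi Hc). destruct (exp_opp_bounds t Ht) as [L L'].
  assert (0 <= (t - (1 - exp (- t))) * (t + (1 - exp (- t))))%R by (apply Rmult_le_pos; lra).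
  assert (0 <= R * sin phi)%R by (apply Rmult_le_pos; lra).
  assert (0 < (Rabs (Im lam) + phi - R * sin phi) * (Rabs (Im lam) + phi + R * sin phi))%R by (apply Rmult_lt_0_compat; lra).
  nra.
Qed.

(** For R < 1 the real half-line leads to infinity inside the disc |g| < 1/R.
    Otherwise the path goes from 0 to ln R - e i phi, [e] being the sign of Im x,
    and then horizontally to the right. *)
Lemma stirling_series_diverges lam R s : 0 < R -> Re lam = ln R -> Cmod s = (/ R)%R ->
  div_region R (Rabs (Im lam)) ->
  ~ ex_series (fun n => stirling_poly (S n) lam * s ^ S n).
Proof.
  intros HR Ha Hs HD Hex.
  destruct (ex_series_C_bounded _ Hex) as [B0 HB0].
  assert (HB : exists B, forall n, Cmod (vcoef n lam) <= B * R ^ n).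
  { exists (Rmax (Cmod lam) B0). intros [|n].
    - simpl. rewrite Cmod_opp, Rmult_1_r. apply Rmax_l.
    - unfold vcoef. specialize (HB0 n). rewrite Cmod_mult, Cmod_pow, Hs, pow_inv in HB0.
      assert (Q : 0 < R ^ S n) by now apply pow_lt.
      apply (Rmult_le_compat_r (R ^ S n)) in HB0; [|lra].
      rewrite Rmult_assoc, Rinv_l, Rmult_1_r in HB0 by lra.
      eapply Rle_trans; [exact HB0|]. apply Rmult_le_compat_r; [lra|apply Rmax_r]. }
  destruct HB as [B HB].
  destruct HD as [H1|(phi & Hphi & Hc & Hb)].
  - apply (no_escape lam B R HR HB 0 0); [lra| |].
    + rewrite Ha, <- ln_1. left; apply ln_increasing; lra.
    + intros t Ht. rewrite Rplus_0_l.
      change ((t, 0%R) : C) with (RtoC t).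
      apply (Usum_path lam B R HR HB RtoC t Ht).
      * intros s0 _. exists 1. split; simpl; [apply @is_derive_id|apply @is_derive_const].
      * intros s0 Hs0. apply real_ray_inside_disc; lra.
      * apply (Usum_at_0 lam B R HR HB). intros E. rewrite E in Ha. unfold Re in Ha; simpl in Ha.
        assert (ln R < 0) by (rewrite <- ln_1; apply ln_increasing; lra). lra.
  - assert (P := PI_RGT_0).
    assert (C1 := COS_bound phi). assert (Cp : 0 < cos phi) by (apply cos_gt_0; lra).
    assert (R1 : 1 <= R) by nra.
    assert (Pb : 0 < Rabs (Im lam)).
    { assert (T := sin_le_tangent 0 phi ltac:(lra) ltac:(lra)). rewrite sin_0 in T.
      assert (0 <= R * (sin phi + cos phi * (0 - phi)))%R by (apply Rmult_le_pos; lra).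
      replace (R * (sin phi + cos phi * (0 - phi)))%R with (R * sin phi - (R * cos phi) * phi)%R in H by ring.
      rewrite Hc in H. lra. }
    (* the path lies on the side of the real axis opposite to x *)
    assert (He : exists e, (e = 1 \/ e = -1)%R /\ (e * Im lam = Rabs (Im lam))%R).
    { destruct (Rle_dec 0 (Im lam)) as [L|L].
      - exists 1%R. split; [now left|]. rewrite Rabs_pos_eq by exact L. ring.
      - exists (-1)%R. split; [now right|]. rewrite Rabs_left by lra. ring. }
    destruct He as (e & He & Hel).
    assert (N0 : lam <> 0).
    { intros E. rewrite E in Pb. simpl in Pb. rewrite Rabs_R0 in Pb. lra. }
    set (c1 := fun t => ((- ln (cos t))%R, (- (e * t))%R) : C).
    assert (E1 : Usum lam (gmap lam (c1 phi)) = c1 phi).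
    { apply (Usum_path lam B R HR HB c1 phi (proj1 Hphi)).
      - intros t Ht. assert (Ct : 0 < cos t) by (apply cos_gt_0; lra).
        exists ((- (/ cos t * - sin t))%R, (- e)%R). unfold c1; split; simpl.
        + auto_derive; [exact Ct|]. field; lra.
        + auto_derive; [exact I|ring].
      - intros t Ht. apply (neck_path_inside_disc lam R phi e t); assumption.
      - replace (c1 0%R) with (RtoC 0).
        + now apply (Usum_at_0 lam B R HR HB).
        + unfold c1. rewrite cos_0, ln_1, Rmult_0_r, Ropp_0. reflexivity. }
    assert (E2 : (- ln (cos phi) = ln R)%R).
    { rewrite <- ln_Rinv by exact Cp. f_equal.
      apply (Rmult_eq_reg_r (cos phi)); [|lra]. rewrite Rinv_l, Hc; lra. }
    apply (no_escape lam B R HR HB (- (e * phi)) (ln R)).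
    + rewrite <- ln_1. destruct (Req_dec R 1) as [->|N]; [lra|]. left; apply ln_increasing; lra.
    + lra.
    + intros t Ht.
      apply (Usum_path lam B R HR HB (fun t => ((ln R + t)%R, (- (e * phi))%R)) t Ht).
      * intros s0 _. exists 1. split; simpl; (auto_derive; [exact I|reflexivity]).
      * intros s0 Hs0. apply (right_ray_inside_disc lam R phi e s0); try assumption; lra.
      * rewrite Rplus_0_r. rewrite <- E2. exact E1.
Qed.

Lemma stirling_series_converges lam R s : Re lam = ln R -> Cmod s = (/ R)%R ->
  conv_region R (Rabs (Im lam)) ->
  ex_series (fun n => stirling_poly (S n) lam * s ^ S n).
Proof.
  intros Ha Hs H.
  assert (Pb := Rabs_pos (Im lam)).
  assert (HR := conv_region_gt_1 _ _ Pb H). assert (Hphi := conv_region_phi _ _ Pb H).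
  destruct (acos_inv R HR) as [A1 A2].
  destruct (stirling_poly_decay lam R _ HR Ha A1 A2 Hphi) as (q & K & Hq & HK).
  assert (I : 0 < / R) by (apply Rinv_0_lt_compat; lra).
  apply (ex_series_C_geom _ (K * (q * / R)) (q * / R)).
  - split; [apply Rmult_le_pos; lra|]. apply (Rmult_lt_reg_r R); [lra|].
    rewrite Rmult_assoc, Rinv_l; lra.
  - intros n. rewrite Cmod_mult, Cmod_pow, Hs.
    apply (Rle_trans _ (K * q ^ S n * (/ R) ^ S n)).
    + apply Rmult_le_compat_r; [apply pow_le; lra|apply HK].
    + right. rewrite Rmult_assoc, <- Rpow_mult_distr. simpl; ring.
Qed.

(** * The domain of convergence *)

Lemma cos_ratio_bound (z : C) : -1 <= Re z / Cmod z <= 1.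
Proof.
  destruct (Ceq_dec z 0) as [->|N].
  - simpl. unfold Rdiv; rewrite Rmult_0_l; lra.
  - apply Cmod_gt_0 in N. assert (L := re_le_Cmod z). apply Rabs_le_between in L.
    split; (apply (Rmult_le_reg_r (Cmod z)); [exact N|]); unfold Rdiv;
    rewrite Rmult_assoc, Rinv_l by lra; lra.
Qed.

Lemma Carg_upper z : 0 <= Im z -> Carg z = acos (Re z / Cmod z).
Proof. intros H. unfold Carg. destruct (Rle_dec 0 (Im z)); [reflexivity|contradiction]. Qed.

Lemma Carg_lower z : Im z < 0 -> Carg z = (- acos (Re z / Cmod z))%R.
Proof. intros H. unfold Carg. destruct (Rle_dec 0 (Im z)); [lra|reflexivity]. Qed.

Lemma Rabs_Carg (z : C) : Rabs (Carg z) = acos (Re z / Cmod z).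
Proof.
  assert (B := acos_bound (Re z / Cmod z)).
  destruct (Rle_lt_dec 0 (Im z)); [rewrite Carg_upper by assumption|rewrite Carg_lower, Rabs_Ropp by assumption];
  apply Rabs_pos_eq; lra.
Qed.

Lemma cos_Carg (z : C) : cos (Carg z) = (Re z / Cmod z)%R.
Proof.
  destruct (Rle_lt_dec 0 (Im z)); [rewrite Carg_upper by assumption|rewrite Carg_lower, cos_neg by assumption];
  apply cos_acos, cos_ratio_bound.
Qed.

Lemma sin_acos_ratio (z : C) : z <> 0 -> sin (acos (Re z / Cmod z)) = (Rabs (Im z) / Cmod z)%R.
Proof.
  intros N. apply Cmod_gt_0 in N.
  rewrite sin_acos by apply cos_ratio_bound.
  rewrite <- (sqrt_Rsqr (Rabs (Im z) / Cmod z)).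
  - f_equal. rewrite !Rsqr_div', <- Rsqr_abs. rewrite !Rsqr_pow2.
    rewrite Cmod2_alt. field. rewrite <- Cmod2_alt. nra.
  - apply Rdiv_le_0_compat; [apply Rabs_pos|exact N].
Qed.

Lemma sin_Carg (z : C) : z <> 0 -> sin (Carg z) = (Im z / Cmod z)%R.
Proof.
  intros N. assert (S := sin_acos_ratio z N).
  destruct (Rle_lt_dec 0 (Im z)).
  - rewrite Carg_upper, S, Rabs_pos_eq by assumption. reflexivity.
  - rewrite Carg_lower, sin_neg, S, Rabs_left by lra. unfold Rdiv; ring.
Qed.

Lemma Carg_bound (z : C) : - PI < Carg z <= PI.
Proof.
  assert (B := acos_bound (Re z / Cmod z)). assert (P := PI_RGT_0).
  destruct (Rle_lt_dec 0 (Im z)) as [L|L]; [rewrite Carg_upper by assumption; lra|].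
  rewrite Carg_lower by assumption. split; [|lra].
  apply Ropp_lt_contravar. destruct (proj2 B) as [H|H]; [exact H|].
  assert (N : z <> 0) by (intros E; rewrite E in L; simpl in L; lra).
  assert (S := sin_acos_ratio z N). rewrite H, sin_PI in S.
  apply Cmod_gt_0 in N. symmetry in S. apply Rmult_integral in S.
  assert (0 < / Cmod z) by now apply Rinv_0_lt_compat.
  assert (0 < Rabs (Im z)) by (apply Rabs_pos_lt; lra). destruct S; lra.
Qed.

Lemma Cexp_Cln (z : C) : z <> 0 -> Cexp (Cln z) = z.
Proof.
  intros N. assert (P := proj1 (Cmod_gt_0 z) N). unfold Cexp, Cln. unfold Re, Im; simpl.
  rewrite cos_Carg, sin_Carg, exp_ln by assumption.
  apply C_ext; unfold Re, Im; simpl; field; lra.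
Qed.

Lemma Cexp_neq_0 w : Cexp w <> 0.
Proof. apply Cmod_gt_0. rewrite Cmod_Cexp. apply exp_pos. Qed.

Lemma Cln_Cexp w : - PI < Im w <= PI -> Cln (Cexp w) = w.
Proof.
  intros H. assert (P := PI_RGT_0). apply C_ext.
  - change (ln (Cmod (Cexp w)) = Re w). rewrite Cmod_Cexp, ln_exp. reflexivity.
  - change (Carg (Cexp w) = Im w).
    assert (E := exp_pos (Re w)).
    assert (Q : (Re (Cexp w) / Cmod (Cexp w) = cos (Im w))%R).
    { rewrite Cmod_Cexp. change (Re (Cexp w)) with (exp (Re w) * cos (Im w))%R. field; lra. }
    assert (Y : Im (Cexp w) = (exp (Re w) * sin (Im w))%R) by reflexivity.
    destruct (Rle_lt_dec 0 (Im (Cexp w))) as [L|L].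
    + rewrite Carg_upper, Q by exact L. rewrite Y in L.
      apply acos_cos. split; [|lra]. apply Rnot_lt_le. intros NL.
      assert (0 < sin (- Im w)) by (apply sin_gt_0; lra). rewrite sin_neg in H0. nra.
    + rewrite Carg_lower, Q by exact L. rewrite Y in L.
      rewrite <- cos_neg, acos_cos; [ring|]. split; [|lra].
      apply Rnot_lt_le. intros NL.
      assert (0 <= exp (Re w) * sin (Im w))%R; [|lra].
      apply Rmult_le_pos; [lra|]. apply sin_ge_0; lra.
Qed.

Lemma Cln_neq_0 (z : C) : z <> 0 -> z <> 1 -> Cln z <> 0.
Proof. intros N0 N1 E. apply N1. rewrite <- (Cexp_Cln z N0), E. apply Cexp_0. Qed.

Lemma Re_Cln z : Re (Cln z) = ln (Cmod z).
Proof. reflexivity. Qed.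
Lemma Im_Cln z : Im (Cln z) = Carg z.
Proof. reflexivity. Qed.

Lemma ex_series_inner_sum z :
  ex_series (fun n => Defs.inner_sum z (S n)) <->
  ex_series (fun n => stirling_poly (S n) (Cln (Cln z)) * (/ Cln z) ^ S n).
Proof.
  split; apply ex_series_ext; intros n; rewrite inner_sum_stirling_poly; reflexivity.
Qed.

Lemma Rabs_Im_Cln L : Rabs (Im (Cln L)) = acos (Re L / Cmod L).
Proof. apply Rabs_Carg. Qed.

Lemma series_converges_conv (z : C) : z <> 0 -> z <> 1 ->
  conv_region (Cmod (Cln z)) (acos (Re (Cln z) / Cmod (Cln z))) -> series_converges z.
Proof.
  intros N0 N1 H. split; [exact N0|]. split; [exact N1|].
  apply ex_series_inner_sum. assert (N := Cln_neq_0 z N0 N1).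
  apply (stirling_series_converges _ (Cmod (Cln z))); [reflexivity|now apply Cmod_inv|].
  rewrite Rabs_Im_Cln. exact H.
Qed.

Lemma series_converges_div (z : C) :
  div_region (Cmod (Cln z)) (acos (Re (Cln z) / Cmod (Cln z))) -> ~ series_converges z.
Proof.
  intros H (N0 & N1 & Hs). assert (N := Cln_neq_0 z N0 N1).
  apply ex_series_inner_sum in Hs. revert Hs.
  apply (stirling_series_diverges _ (Cmod (Cln z))); [now apply Cmod_gt_0|reflexivity|now apply Cmod_inv|].
  rewrite Rabs_Im_Cln. exact H.
Qed.

Lemma plane_cont_locally g (z : C) : plane_cont g z -> 0 < g z -> exists d, 0 < d /\
  forall y : C, Cmod (y - z) < d -> 0 < g y.
Proof.
  intros Hg Hp. assert (H := proj1 (filterlim_locally g (g z)) Hg (mkposreal (g z) Hp)).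
  apply (locally_Cmod (fun y => ball (g z) (g z) (g y))) in H.
  destruct H as (d & Hd & H). exists d. split; [exact Hd|]. intros y Hy. specialize (H y Hy).
  change (Rabs (g y - g z) < g z) in H. apply Rabs_def2 in H. lra.
Qed.

(** In terms of m = (a + b) / 2 and d = (a - b) / 2, with a = acos x and b = acos y,
    y - x is 2 sin m sin d, and sin m >= sin d. *)
Lemma acos_diff x y : -1 <= x <= 1 -> -1 <= y <= 1 -> acos y <= acos x ->
  (1 - cos (acos x - acos y) <= y - x)%R.
Proof.
  intros Hx Hy L. rewrite <- (cos_acos y Hy) at 2. rewrite <- (cos_acos x Hx) at 2.
  assert (Bx := acos_bound x). assert (By := acos_bound y).
  set (a := acos x) in *. set (b := acos y) in *.
  set (m := ((a + b) / 2)%R). set (d := ((a - b) / 2)%R).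
  replace (a - b)%R with (d + d)%R by (unfold d; field).
  replace a with (m + d)%R by (unfold m, d; field). replace b with (m - d)%R by (unfold m, d; field).
  rewrite !cos_plus, cos_minus.
  assert (Sd : 0 <= sin d) by (apply sin_ge_0; unfold d; lra).
  assert (Sm : (sin d <= sin m)%R).
  { destruct (Rle_dec m (PI / 2)) as [Lm|Lm].
    - apply sin_incr_1; unfold m, d in *; lra.
    - rewrite <- (sin_PI_x m). apply sin_incr_1; unfold m, d in *; lra. }
  assert (S2 := sin2_cos2_mult d). nra.
Qed.

Lemma acos_unif_cont e : 0 < e -> exists d, 0 < d /\ forall x y, -1 <= x <= 1 -> -1 <= y <= 1 ->
  Rabs (x - y) < d -> Rabs (acos x - acos y) < e.
Proof.
  intros He. set (e' := Rmin e 1). assert (He' : 0 < e') by (apply Rmin_glb_lt; lra).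
  assert (L1 : e' <= 1) by apply Rmin_r. assert (L2 : e' <= e) by apply Rmin_l.
  assert (P := PI2_1).
  assert (Q : cos e' < 1) by (rewrite <- cos_0; apply cos_decreasing_1; lra).
  assert (K : forall x y, -1 <= x <= 1 -> -1 <= y <= 1 -> Rabs (x - y) < 1 - cos e' ->
     acos y <= acos x -> (acos x - acos y < e)%R).
  { intros x y Hx Hy A L. apply Rnot_le_lt. intros NL.
    assert (D := acos_diff x y Hx Hy L). assert (Bx := acos_bound x). assert (By := acos_bound y).
    assert (cos (acos x - acos y) <= cos e') by (apply cos_decr_1; lra).
    apply Rabs_def2 in A. lra. }
  exists (1 - cos e')%R. split; [lra|]. intros x y Hx Hy A.
  destruct (Rle_dec (acos y) (acos x)) as [L|L].
  - rewrite Rabs_pos_eq by lra. now apply K.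
  - rewrite Rabs_minus_sym in A. rewrite Rabs_left by lra.
    assert (H := K y x Hy Hx A ltac:(lra)). lra.
Qed.

Lemma plane_cont_acos g u : (forall z, -1 <= g z <= 1) -> plane_cont g u ->
  plane_cont (fun z => acos (g z)) u.
Proof.
  intros B H. apply filterlim_locally. intros e.
  destruct (acos_unif_cont e (cond_pos e)) as (d & Hd & D).
  assert (H' := proj1 (filterlim_locally g (g u)) H (mkposreal d Hd)).
  revert H'. apply filter_imp. intros z Hz. apply D; [apply B|apply B|exact Hz].
Qed.

Lemma plane_cont_Cmod (F : C -> C) u : F u <> 0 -> C_cont F u -> plane_cont (fun z => Cmod (F z)) u.
Proof.
  intros N [H1 H2]. assert (P := Cmod2_pos _ N).
  assert (D := is_derive_sqrt (fun x => x) (Re (F u) ^ 2 + Im (F u) ^ 2)%R 1 (is_derive_id _) P).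
  apply (plane_cont_comp sqrt (fun z => Re (F z) ^ 2 + Im (F z) ^ 2)%R u _ D).
  apply plane_cont_plus; (apply plane_cont_mult; [|apply plane_cont_mult; [|apply continuous_const]]);
  assumption.
Qed.

Lemma plane_cont_div (f g : R * R -> R) u : g u <> 0%R -> plane_cont f u -> plane_cont g u ->
  plane_cont (fun z => f z / g z)%R u.
Proof.
  intros N Hf Hg. apply plane_cont_mult; [exact Hf|].
  apply (plane_cont_comp Rinv g u (- 1 / g u ^ 2)%R); [|exact Hg].
  auto_derive; [exact N|]. field; exact N.
Qed.

Lemma plane_cont_cos_ratio (F : C -> C) u : F u <> 0 -> C_cont F u ->
  plane_cont (fun z => acos (Re (F z) / Cmod (F z))) u.
Proof.
  intros N H. apply plane_cont_acos; [intros z; apply cos_ratio_bound|].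
  apply plane_cont_div; [|apply H|now apply plane_cont_Cmod].
  apply Cmod_gt_0 in N; lra.
Qed.

(** The logarithm jumps on the negative half-line; this variant, with the absolute
    value of the argument, is continuous there and has the same modulus and real
    part. *)
Definition Cln_abs (z : C) : C := (ln (Cmod z), acos (Re z / Cmod z)).

Lemma C_cont_Cln_abs (z : C) : z <> 0 -> C_cont Cln_abs z.
Proof.
  intros N. split.
  - apply (plane_cont_comp ln (fun z => Cmod z) z (/ Cmod z)%R).
    + apply is_derive_ln, Cmod_gt_0, N.
    + apply (plane_cont_Cmod (fun z => z)); [exact N|apply C_cont_id].
  - apply (plane_cont_cos_ratio (fun z => z)); [exact N|apply C_cont_id].
Qed.

Lemma Cmod_Cln_abs (z : C) : Cmod (Cln_abs z) = Cmod (Cln z).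
Proof.
  apply Rsqr_inj; try apply Cmod_ge_0. rewrite !Rsqr_pow2, !Cmod2_alt.
  rewrite Re_Cln, Im_Cln, <- (pow2_abs (Carg z)), Rabs_Carg. reflexivity.
Qed.

Lemma conv_region_open (z : C) : z <> 0 -> z <> 1 ->
  conv_region (Cmod (Cln z)) (acos (Re (Cln z) / Cmod (Cln z))) ->
  exists d, 0 < d /\ forall y, Cmod (y - z) < d ->
    conv_region (Cmod (Cln y)) (acos (Re (Cln y) / Cmod (Cln y))).
Proof.
  intros N0 N1 (t & Ht & H).
  assert (N := Cln_neq_0 z N0 N1).
  assert (N' : Cln_abs z <> 0).
  { apply Cmod_gt_0. rewrite Cmod_Cln_abs. now apply Cmod_gt_0. }
  assert (G : plane_cont (fun y => Cmod (Cln_abs y) * sin t + - t +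
     - acos (Re (Cln_abs y) / Cmod (Cln_abs y)))%R z).
  { assert (CC := C_cont_Cln_abs z N0).
    apply plane_cont_plus; [apply plane_cont_plus|apply plane_cont_opp].
    - apply plane_cont_mult; [now apply plane_cont_Cmod|apply continuous_const].
    - apply continuous_const.
    - now apply plane_cont_cos_ratio. }
  destruct (plane_cont_locally _ z G) as (d & Hd & D).
  - rewrite Cmod_Cln_abs. change (Re (Cln_abs z)) with (Re (Cln z)). lra.
  - exists d. split; [exact Hd|]. intros y Hy. exists t. split; [exact Ht|].
    specialize (D y Hy). rewrite Cmod_Cln_abs in D. change (Re (Cln_abs y)) with (Re (Cln y)) in D. lra.
Qed.

(** Shrinking R makes R sin t - t strictly smaller for every t in (0, pi).  In the
    limiting case k R = 1, where the maximum moves to t = 0, it remains to see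
    that b > 0, which holds because R > 1. *)
Lemma not_conv_region_div R b k : 0 < R -> 0 <= b -> ~ conv_region R b -> 0 < k < 1 ->
  div_region (k * R) b.
Proof.
  intros HR Hb H Hk. assert (P := PI_RGT_0).
  assert (N : forall t, 0 < t < PI -> (R * sin t - t <= b)%R).
  { intros t Ht. apply Rnot_lt_le. intros L. apply H. now exists t. }
  destruct (Rlt_le_dec (k * R) 1) as [L|L]; [now left|]. right.
  assert (I : 0 < / (k * R) <= 1).
  { split; [apply Rinv_0_lt_compat; lra|]. rewrite <- Rinv_1. apply Rinv_le_contravar; lra. }
  exists (acos (/ (k * R))).
  assert (C : cos (acos (/ (k * R))) = (/ (k * R))%R) by (apply cos_acos; lra).
  assert (B := acos_bound (/ (k * R))). set (phi := acos (/ (k * R))) in *.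
  assert (Lp : phi < PI / 2).
  { apply Rnot_le_lt. intros NL. assert (cos phi <= 0)%R by (apply cos_le_0; lra). lra. }
  split; [lra|]. split; [rewrite C; field; lra|].
  assert (kR : (k * R < R)%R) by nra.
  destruct (Req_dec phi 0) as [Z|Z].
  - rewrite Z, sin_0, Rmult_0_r, Rminus_diag.
    assert (R1 : 1 < R) by lra. destruct (acos_inv R R1) as [A1 A2]. set (th := acos (/ R)) in *.
    apply (Rlt_le_trans _ (R * sin th - th)); [|apply N; lra].
    destruct (MVT_cor2 sin cos 0 th (proj1 A1)) as (c & E & Hc); [intros; apply derivable_pt_lim_sin|].
    rewrite sin_0 in E.
    assert (cos th < cos c) by (apply cos_decreasing_1; lra).
    assert (0 < R * ((cos c - cos th) * th))%R by (apply Rmult_lt_0_compat; [lra|apply Rmult_lt_0_compat; lra]).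
    replace (R * ((cos c - cos th) * th))%R with (R * (cos c * th) - (R * cos th) * th)%R in H1 by ring.
    rewrite A2 in H1. rewrite !Rminus_0_r in E. rewrite E. lra.
  - assert (0 < sin phi) by (apply sin_gt_0; lra).
    specialize (N phi ltac:(lra)). nra.
Qed.

Lemma domain_of_convergence_region (z : C) : domain_of_convergence z <->
  z <> 0 /\ z <> 1 /\ conv_region (Cmod (Cln z)) (acos (Re (Cln z) / Cmod (Cln z))).
Proof.
  split.
  - intros H. apply locally_Cmod in H. destruct H as (d & Hd & H).
    destruct (H z) as (N0 & N1 & _).
    { replace (z - z) with (RtoC 0) by ring. rewrite Cmod_0. exact Hd. }
    split; [exact N0|]. split; [exact N1|]. apply NNPP. intros NC.
    set (L := Cln z) in *. assert (NL : L <> 0) by now apply Cln_neq_0.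
    assert (ML := proj1 (Cmod_gt_0 L) NL).
    assert (cc : curve_cont (fun t => Cexp (L - RtoC t * L)) 0).
    { eapply curve_deriv_cont, curve_deriv_exp, curve_deriv_minus; [apply curve_deriv_const|apply curve_deriv_ray]. }
    destruct (curve_cont_eps _ _ cc d Hd) as (d1 & P1 & D1).
    set (t := Rmin (d1 / 2) (1 / 2)).
    assert (Ht : 0 < t) by (apply Rmin_glb_lt; lra).
    assert (Ht1 : t <= d1 / 2) by apply Rmin_l. assert (Ht2 : t <= 1 / 2) by apply Rmin_r.
    assert (D := D1 t ltac:(rewrite Rminus_0_r, Rabs_pos_eq; lra)). cbv beta in D.
    replace (L - RtoC 0 * L) with L in D by ring. unfold L at 3 in D. rewrite (Cexp_Cln z N0) in D.
    apply H in D. revert D. apply series_converges_div.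
    replace (L - RtoC t * L) with (RtoC (1 - t) * L) by (rewrite RtoC_minus; ring).
    assert (ImL := Carg_bound z). rewrite <- Im_Cln in ImL. fold L in ImL.
    rewrite Cln_Cexp.
    2: { rewrite Im_RtoC_mult. assert (PP := PI_RGT_0). split; nra. }
    rewrite Cmod_mult, Cmod_R, Rabs_pos_eq by lra. rewrite Re_RtoC_mult.
    replace ((1 - t) * Re L / ((1 - t) * Cmod L))%R with (Re L / Cmod L)%R by (field; lra).
    apply not_conv_region_div; [exact ML|apply acos_bound|exact NC|lra].
  - intros (N0 & N1 & H). apply locally_Cmod.
    destruct (conv_region_open z N0 N1 H) as (d & Hd & D).
    assert (M0 := proj1 (Cmod_gt_0 z) N0).
    assert (M1 : 0 < Cmod (z - 1)).
    { apply Cmod_gt_0. intros E. apply N1. transitivity (z - 1 + 1); [ring|rewrite E; ring]. }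
    exists (Rmin d (Rmin (Cmod z) (Cmod (z - 1)))). split; [repeat apply Rmin_glb_lt; assumption|].
    intros y Hy.
    assert (Y1 : Cmod (y - z) < d) by (eapply Rlt_le_trans; [exact Hy|apply Rmin_l]).
    assert (Y2 : Cmod (y - z) < Cmod z)
      by (eapply Rlt_le_trans; [exact Hy|eapply Rle_trans; [apply Rmin_r|apply Rmin_l]]).
    assert (Y3 : Cmod (y - z) < Cmod (z - 1))
      by (eapply Rlt_le_trans; [exact Hy|eapply Rle_trans; [apply Rmin_r|apply Rmin_r]]).
    apply series_converges_conv; [| |now apply D].
    + intros ->. replace (0 - z) with (- z) in Y2 by ring. rewrite Cmod_opp in Y2. lra.
    + intros ->. replace (1 - z) with (- (z - 1)) in Y3 by ring. rewrite Cmod_opp in Y3. lra.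
Qed.

(** * Ranges of the branches 1 and -1 of the Lambert function *)

Lemma Cexp_inj_near A B : Cexp A = Cexp B -> (Rabs (Im A - Im B) < 2 * PI)%R -> A = B.
Proof.
  intros E H.
  assert (ER : Re A = Re B).
  { apply exp_inv. rewrite <- !Cmod_Cexp. now rewrite E. }
  apply C_ext; [exact ER|].
  assert (P := exp_pos (Re B)).
  assert (E1 := f_equal Re E). assert (E2 := f_equal Im E).
  change (exp (Re A) * cos (Im A) = exp (Re B) * cos (Im B))%R in E1.
  change (exp (Re A) * sin (Im A) = exp (Re B) * sin (Im B))%R in E2.
  rewrite ER in E1, E2. apply Rmult_eq_reg_l in E1, E2; try lra.
  set (d := ((Im A - Im B) / 2)%R).
  assert (C1 : cos (d + d) = 1%R).
  { replace (d + d)%R with (Im A - Im B)%R by (unfold d; field). rewrite cos_minus, E1, E2.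
    assert (S2 := sin2_cos2_mult (Im B)). lra. }
  rewrite cos_plus in C1. assert (S2 := sin2_cos2_mult d).
  assert (S : sin d = 0%R) by (apply Rsqr_eq_0; unfold Rsqr; lra).
  assert (D : (- PI < d < PI)%R) by (apply Rabs_def2 in H; unfold d; lra).
  assert (Z : d = 0%R).
  { destruct (Rtotal_order d 0) as [L|[L|L]]; [|exact L|].
    - assert (0 < sin (- d))%R by (apply sin_gt_0; lra). rewrite sin_neg in H0; lra.
    - assert (0 < sin d)%R by (apply sin_gt_0; lra). lra. }
  unfold d in Z; lra.
Qed.

(** [Carg w + Im w] is the imaginary part of ln w + w, and t = pi - arg w turns
    R sin t - t > b into R > |w|.  Conversely, if c = - Re w >= 1, then
    R cos ph = c e^(1-c) <= 1 for ph = pi - arg w, so R lies below 1 / cos ph,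
    where the maximum of R sin t - t is tan ph - ph <= c tan ph - ph = b. *)
Lemma lambert_solution_region w R b : 0 < R -> 0 <= b <= PI -> 0 <= Im w -> w <> 0 ->
  (Carg w + Im w = b + PI)%R -> (Cmod w * exp (Re w + 1) = R)%R -> (Im w = 0%R -> Re w <= -1) ->
  Re w > -1 <-> conv_region R b.
Proof.
  intros HR Hb Hw N Harg Hmod Hreal.
  assert (P := PI_RGT_0). assert (M := proj1 (Cmod_gt_0 w) N).
  assert (Cs := cos_Carg w). assert (Sn := sin_Carg w N).
  assert (Bd := acos_bound (Re w / Cmod w)). rewrite <- Carg_upper in Bd by exact Hw.
  set (th := Carg w) in *.
  assert (Re1 : (Cmod w * cos th = Re w)%R) by (rewrite Cs; field; lra).
  assert (Im1 : (Cmod w * sin th = Im w)%R) by (rewrite Sn; field; lra).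
  split.
  - intros H.
    assert (I : 0 < Im w).
    { destruct Hw as [Hw|Hw]; [exact Hw|]. symmetry in Hw. apply Hreal in Hw. lra. }
    assert (S : 0 < sin th) by (rewrite Sn; apply Rdiv_lt_0_compat; lra).
    exists (PI - th)%R. split.
    + split.
      * destruct (Req_dec th PI) as [E|E]; [rewrite E, sin_PI in S; lra|lra].
      * destruct (Req_dec th 0) as [E|E]; [rewrite E, sin_0 in S; lra|lra].
    + rewrite sin_PI_x.
      assert (E : (1 < exp (Re w + 1))%R) by (rewrite <- exp_0 at 1; apply exp_increasing; lra).
      assert (Im w < R * sin th)%R; [|lra].
      rewrite <- Im1, <- Hmod. apply Rmult_lt_compat_r; [exact S|]. nra.
  - intros (t & Ht & H). apply Rnot_le_gt. intros L. revert H. apply Rle_not_lt.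
    set (ph := (PI - th)%R).
    assert (Cp : cos ph = (- cos th)%R) by (unfold ph; rewrite cos_minus, cos_PI, sin_PI; ring).
    assert (Sp : sin ph = sin th) by apply sin_PI_x.
    set (c := (- Re w)%R).
    assert (Ec : (Cmod w * cos ph = c)%R) by (rewrite Cp; unfold c; rewrite <- Re1; ring).
    assert (Hc : 1 <= c) by (unfold c; lra).
    assert (Pc : 0 < cos ph) by nra.
    assert (Er : (R * cos ph <= 1)%R).
    { rewrite <- Hmod. replace (Cmod w * exp (Re w + 1) * cos ph)%R with (c * exp (1 - c))%R.
      - assert (X := exp_ineq1_le (c - 1)). assert (Y := exp_opp_mult (c - 1)).
        replace (1 - c)%R with (- (c - 1))%R by ring. assert (Z := exp_pos (- (c - 1))). nra.
      - rewrite <- Ec. replace (Re w + 1)%R with (1 - Cmod w * cos ph)%R by (rewrite Ec; unfold c; ring). ring. }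
    assert (T := sin_le_tangent t ph ltac:(lra) ltac:(unfold ph; lra)).
    assert (S0 : 0 < sin t) by (apply sin_gt_0; lra).
    assert (S1 : 0 <= sin ph) by (rewrite Sp, Sn; apply Rdiv_le_0_compat; lra).
    apply (Rmult_le_reg_r (cos ph)); [exact Pc|].
    assert (b = Cmod w * sin ph - ph)%R by (rewrite Sp, Im1; unfold ph; lra).
    rewrite H. clear H.
    assert ((R * cos ph) * sin t <= 1 * (sin ph + cos ph * (t - ph)))%R by (apply Rmult_le_compat; nra).
    assert (1 * sin ph <= (Cmod w * cos ph) * sin ph)%R by (apply Rmult_le_compat_r; [exact S1|lra]).
    nra.
Qed.

Definition polar (R b : R) : C := ((R * cos b)%R, (R * sin b)%R).

(** w e^w and -L/e are exponentials; a bound on the difference of the imaginary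
    parts of their logarithms makes the logarithms equal. *)
Lemma lambert_log_form w R b : 0 < R ->
  w * Cexp w = - polar R b / RtoC (exp 1) ->
  (Rabs (Carg w + Im w - (b + PI)) < 2 * PI)%R -> w <> 0 /\
  (Carg w + Im w = b + PI)%R /\ (Cmod w * exp (Re w + 1) = R)%R.
Proof.
  intros HR E H.
  assert (Pe := exp_pos 1).
  assert (E' : - polar R b / RtoC (exp 1) = Cexp ((ln R - 1)%R, (b + PI)%R)).
  { unfold polar, Cexp. unfold Rminus. simpl. rewrite exp_plus, exp_ln, exp_Ropp, neg_cos, neg_sin by exact HR.
    apply C_ext; unfold Re, Im; simpl; field; lra. }
  rewrite E' in E.
  assert (N : w <> 0).
  { intros Z. rewrite Z, Cmult_0_l in E. symmetry in E. now apply Cexp_neq_0 in E. }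
  rewrite <- (Cexp_Cln w N) in E at 1. rewrite <- Cexp_plus in E.
  apply Cexp_inj_near in E; [|exact H].
  split; [exact N|].
  assert (E1 := f_equal Re E). assert (E2 := f_equal Im E).
  change (ln (Cmod w) + Re w = ln R - 1)%R in E1. change (Carg w + Im w = b + PI)%R in E2.
  split; [exact E2|].
  rewrite <- (exp_ln R HR). replace (ln R) with (ln (Cmod w) + (Re w + 1))%R by lra.
  rewrite (exp_plus (ln _)), exp_ln; [reflexivity|]. now apply Cmod_gt_0.
Qed.

(** The separating curves are the points where arg w + Im w is a multiple of pi. *)
Lemma curve_arg w : 0 < Im w -> 0 < sin (Im w) ->
  ((Re w < curve_abscissa (Im w) -> sin (Carg w + Im w) < 0) /\
   (curve_abscissa (Im w) < Re w -> 0 < sin (Carg w + Im w)) /\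
   (Re w = curve_abscissa (Im w) -> sin (Carg w + Im w) = 0))%R.
Proof.
  intros H S.
  assert (N : w <> 0) by (intros E; rewrite E in H; simpl in H; lra).
  assert (M := proj1 (Cmod_gt_0 w) N).
  assert (E : (sin (Carg w + Im w) = (Re w - curve_abscissa (Im w)) * (sin (Im w) / Cmod w))%R).
  { rewrite sin_plus, cos_Carg, sin_Carg by exact N. unfold curve_abscissa. field. lra. }
  assert (Q : 0 < sin (Im w) / Cmod w) by (apply Rdiv_lt_0_compat; lra).
  rewrite E. repeat split; intros; nra.
Qed.

Lemma Carg_upper_bound w : 0 < Im w -> 0 < Carg w < PI.
Proof.
  intros H. assert (N : w <> 0) by (intros E; rewrite E in H; simpl in H; lra).
  assert (M := proj1 (Cmod_gt_0 w) N).
  assert (S := sin_Carg w N). assert (B := acos_bound (Re w / Cmod w)).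
  rewrite <- Carg_upper in B by lra.
  assert (Q : 0 < sin (Carg w)) by (rewrite S; apply Rdiv_lt_0_compat; lra).
  split.
  - destruct (Req_dec (Carg w) 0) as [E|E]; [rewrite E, sin_0 in Q; lra|lra].
  - destruct (Req_dec (Carg w) PI) as [E|E]; [rewrite E, sin_PI in Q; lra|lra].
Qed.

Lemma sin_shift_2PI x : sin (x - 2 * PI) = sin x.
Proof. rewrite <- (sin_period (x - 2 * PI) 1). f_equal. simpl. ring. Qed.

Lemma above_first_curve_arg w : 0 < Im w < PI ->
  (Re w <= curve_abscissa (Im w) -> PI <= Carg w + Im w)%R /\
  (Re w < curve_abscissa (Im w) -> PI < Carg w + Im w)%R.
Proof.
  intros H. assert (B := Carg_upper_bound w ltac:(lra)).
  destruct (curve_arg w ltac:(lra) ltac:(apply sin_gt_0; lra)) as (K1 & _ & K3).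
  assert (L : (Re w < curve_abscissa (Im w) -> PI < Carg w + Im w)%R).
  { intros L. apply Rnot_le_lt. intros G. specialize (K1 L).
    assert (0 <= sin (Carg w + Im w)) by (apply sin_ge_0; lra). lra. }
  split; [|exact L]. intros [G|G]; [left; now apply L|].
  apply Rnot_lt_le. intros G'. specialize (K3 G).
  assert (0 < sin (Carg w + Im w)) by (apply sin_gt_0; lra). lra.
Qed.

Lemma below_second_curve_arg w : (2 * PI < Im w < 3 * PI)%R ->
  (curve_abscissa (Im w) <= Re w -> Carg w + Im w <= 3 * PI)%R /\
  (curve_abscissa (Im w) < Re w -> Carg w + Im w < 3 * PI)%R.
Proof.
  intros H. assert (P := PI_RGT_0). assert (B := Carg_upper_bound w ltac:(lra)).
  destruct (curve_arg w) as (_ & K2 & K3); [lra|rewrite <- sin_shift_2PI; apply sin_gt_0; lra|].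
  rewrite <- sin_shift_2PI in K2, K3. set (y := (Carg w + Im w - 2 * PI)%R) in *.
  assert (L : (curve_abscissa (Im w) < Re w -> Carg w + Im w < 3 * PI)%R).
  { intros L. apply Rnot_le_lt. intros G. specialize (K2 L).
    assert (sin y <= 0) by (apply sin_le_0; unfold y; lra). lra. }
  split; [|exact L]. intros [G|G]; [left; now apply L|].
  apply Rnot_lt_le. intros G'. specialize (K3 (eq_sym G)).
  assert (sin y < 0) by (apply sin_lt_0; unfold y; lra). lra.
Qed.

Lemma range_1_arg w : lambertW_range 1 w -> 0 < Im w /\ (PI < Carg w + Im w <= 3 * PI)%R.
Proof.
  intros [H1 H2]. simpl in H1, H2. unfold above_curve in H1, H2.
  change (Pos.to_nat 1) with 1%nat in H1, H2. simpl Init.Nat.pred in H1. simpl INR in H1, H2.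
  assert (P := PI_RGT_0).
  assert (I : 0 < Im w) by (destruct H1 as [H1|[H1 _]]; lra).
  split; [exact I|]. assert (B := Carg_upper_bound w I). split.
  - destruct H1 as [H1|[H1 H1']]; [lra|]. apply above_first_curve_arg; [lra|exact H1'].
  - destruct (Rle_lt_dec (Im w) (2 * PI)) as [L|L]; [lra|].
    assert (L3 : Im w < 3 * PI) by (apply Rnot_le_lt; intros L'; apply H2; left; lra).
    apply below_second_curve_arg; [lra|].
    apply Rnot_lt_le. intros L5. apply H2. right. split; [lra|exact L5].
Qed.

Lemma curve_abscissa_opp y : curve_abscissa (- y) = curve_abscissa y.
Proof.
  unfold curve_abscissa. rewrite cos_neg, sin_neg, Ropp_involutive.
  unfold Rdiv. rewrite Rinv_opp. ring.
Qed.

Lemma range_minus1_arg w : lambertW_range (-1) w -> let v := Cconj w in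
  0 <= Im v /\ (PI <= Carg v + Im v < 3 * PI)%R /\ (Im v = 0%R -> Re v <= -1).
Proof.
  intros [H1 H2] v. simpl in H1, H2. unfold on_or_below_conj_curve in H1, H2.
  change (Pos.to_nat 1) with 1%nat in H1, H2. simpl Init.Nat.pred in H1. simpl INR in H1, H2.
  assert (P := PI_RGT_0).
  assert (Iv : Im w = (- Im v)%R) by (unfold v, Im; simpl; ring).
  assert (Rv : Re w = Re v) by reflexivity.
  rewrite Iv, Rv in H1, H2. rewrite curve_abscissa_opp in H1, H2.
  assert (I : 0 <= Im v) by (destruct H1 as [H1|[[H1 _]|[_ [H1 _]]]]; lra).
  split; [exact I|].
  destruct (Req_dec (Im v) 0) as [Z|Z].
  - assert (L : Re v <= -1) by (destruct H1 as [H1|[[H1 _]|[_ [_ H1]]]]; lra).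
    split; [|intros _; exact L].
    rewrite Z. assert (C : Carg v = PI).
    { rewrite Carg_upper by exact I.
      assert (E : Cmod v = (- Re v)%R).
      { assert (Hv : v = RtoC (Re v)) by (apply C_ext; [reflexivity|exact Z]).
        rewrite Hv at 1. rewrite Cmod_R. apply Rabs_left; lra. }
      rewrite E. replace (Re v / - Re v)%R with (- (1))%R by (field; lra).
      rewrite acos_opp, acos_1. ring. }
    rewrite C; lra.
  - split; [|intros; contradiction].
    assert (I' : 0 < Im v) by lra. assert (B := Carg_upper_bound v I'). split.
    + destruct H1 as [H1|[[H1 H1']|[_ [H1 _]]]]; [lra| |lra].
      apply above_first_curve_arg; [lra|exact H1'].
    + destruct (Rle_lt_dec (Im v) (2 * PI)) as [L|L]; [lra|].
      assert (L3 : Im v < 3 * PI) by (apply Rnot_le_lt; intros L'; apply H2; left; lra).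
      apply below_second_curve_arg; [lra|].
      apply Rnot_le_lt. intros L5. apply H2. right; left. split; [lra|exact L5].
Qed.

(** * Existence of the branch values *)

(** The point w with Im w = b + psi and arg w = pi - psi. *)
Definition branch_point (b psi : R) : C := ((- ((b + psi) * (cos psi / sin psi)))%R, (b + psi)%R).

(** Vanishes when |w| e^(Re w + 1) = r at the point above. *)
Definition branch_gap (r b psi : R) : R :=
  ((b + psi) * exp (1 - (b + psi) * (cos psi / sin psi)) - r * sin psi)%R.

Lemma branch_point_equation R b psi : 0 < sin psi -> branch_gap R b psi = 0%R ->
  branch_point b psi * Cexp (branch_point b psi) = - polar R b / RtoC (exp 1).
Proof.
  intros S G. unfold branch_gap in G. set (eta := (b + psi)%R) in *.
  set (xi := (- (eta * (cos psi / sin psi)))%R).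
  assert (Pe := exp_pos 1).
  assert (E : (eta * exp xi = R * sin psi / exp 1)%R).
  { replace (1 - eta * (cos psi / sin psi))%R with (1 + xi)%R in G by (unfold xi; ring).
    rewrite exp_plus in G. apply (Rmult_eq_reg_r (exp 1)); [|lra]. unfold Rdiv.
    rewrite (Rmult_assoc (R * sin psi)), Rinv_l by lra. lra. }
  assert (Cb : (cos eta * cos psi + sin eta * sin psi = cos b)%R).
  { rewrite <- cos_minus. f_equal. unfold eta; ring. }
  assert (Sb : (sin eta * cos psi - cos eta * sin psi = sin b)%R).
  { rewrite <- sin_minus. f_equal. unfold eta; ring. }
  assert (X : (xi * sin psi = - (eta * cos psi))%R) by (unfold xi; field; lra).
  apply C_ext.
  - transitivity (xi * (exp xi * cos eta) - eta * (exp xi * sin eta))%R; [reflexivity|].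
    transitivity (- (R * cos b) / exp 1)%R; [|unfold polar, Re; simpl; field; lra].
    apply (Rmult_eq_reg_r (sin psi)); [|lra].
    transitivity ((xi * sin psi) * (exp xi * cos eta) - (eta * exp xi) * (sin eta * sin psi))%R; [ring|].
    rewrite X.
    transitivity (- (eta * exp xi) * (cos eta * cos psi + sin eta * sin psi))%R; [ring|].
    rewrite Cb, E. field; lra.
  - transitivity (xi * (exp xi * sin eta) + eta * (exp xi * cos eta))%R; [reflexivity|].
    transitivity (- (R * sin b) / exp 1)%R; [|unfold polar, Im; simpl; field; lra].
    apply (Rmult_eq_reg_r (sin psi)); [|lra].
    transitivity ((xi * sin psi) * (exp xi * sin eta) + (eta * exp xi) * (cos eta * sin psi))%R; [ring|].
    rewrite X.
    transitivity (- (eta * exp xi) * (sin eta * cos psi - cos eta * sin psi))%R; [ring|].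
    rewrite Sb, E. field; lra.
Qed.

Lemma branch_gap_pos R b : 0 < R -> 0 <= b -> exists psi, PI / 2 < psi < PI /\ 1 < psi /\ 0 < branch_gap R b psi.
Proof.
  intros HR Hb. assert (P := PI2_3_2).
  set (e := (/ (1 + R))%R).
  assert (He : 0 < e) by (apply Rinv_0_lt_compat; lra).
  assert (Ee : (e * (1 + R) = 1)%R) by (unfold e; field; lra).
  assert (e < 1)%R by nra.
  exists (PI - e)%R. split; [lra|]. split; [lra|].
  unfold branch_gap. rewrite sin_PI_x. rewrite cos_minus, cos_PI, sin_PI.
  assert (S : 0 < sin e) by (apply sin_gt_0; lra).
  assert (C : 0 < cos e) by (apply cos_gt_0; lra).
  assert (S1 : sin e < e) by (apply sin_lt_x; lra).
  set (q := ((b + (PI - e)) * ((-1 * cos e + 0 * sin e) / sin e))%R).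
  assert (Hq : (q <= 0)%R).
  { unfold q. replace ((b + (PI - e)) * ((-1 * cos e + 0 * sin e) / sin e))%R
      with (- ((b + (PI - e)) * (cos e / sin e)))%R by (field; lra).
    assert (0 < cos e / sin e) by (apply Rdiv_lt_0_compat; lra).
    assert (0 <= (b + (PI - e)) * (cos e / sin e))%R by (apply Rmult_le_pos; lra). lra. }
  assert (X := exp_ineq1_le (1 - q)).
  assert ((b + (PI - e)) * 1 <= (b + (PI - e)) * exp (1 - q))%R by (apply Rmult_le_compat_l; lra).
  nra.
Qed.

(** P is the modulus of the branch point, and P cos psi the opposite of its real
    part. *)
Lemma branch_gap_lt_0 R b psi : 0 < sin psi ->
  let P := ((b + psi) / sin psi)%R in
  (P * exp (1 - P * cos psi) < R)%R -> branch_gap R b psi < 0.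
Proof.
  intros S P H. unfold branch_gap.
  replace ((b + psi) * (cos psi / sin psi))%R with (P * cos psi)%R by (unfold P; field; lra).
  replace (b + psi)%R with (P * sin psi)%R by (unfold P; field; lra). nra.
Qed.

(** For b > 0 small values of psi make P = (b + psi) / sin psi so large that
    P e^(1 - P/2) < R; P >= 2 + 16/R is enough.  If b = 0, then P cos psi <= 1, and
    cos psi = k with k^2 > 1/R suffices. *)
Lemma branch_gap_neg R b : 0 < R -> 0 < b <= PI \/ (b = 0%R /\ 1 < R) ->
  exists psi, 0 < psi /\ (psi <= 1 \/ psi < PI / 2) /\ branch_gap R b psi < 0.
Proof.
  intros HR [Hb|[-> R1]]; assert (PP := PI2_3_2).
  - set (N := (2 + 16 / R)%R). assert (HN : 0 < 16 / R) by (apply Rdiv_lt_0_compat; lra).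
    set (psi := Rmin 1 (b / N)).
    assert (H0 : 0 < psi) by (apply Rmin_glb_lt; [|apply Rdiv_lt_0_compat; unfold N]; lra).
    assert (H1 : psi <= 1) by apply Rmin_l. assert (H2 : psi <= b / N) by apply Rmin_r.
    exists psi. split; [exact H0|]. split; [now left|].
    assert (S : 0 < sin psi) by (apply sin_gt_0; lra).
    assert (S1 : sin psi < psi) by (apply sin_lt_x; lra).
    assert (C : 1 / 2 <= cos psi) by (rewrite <- cos_PI3; apply cos_decr_1; lra).
    apply branch_gap_lt_0; [exact S|]. cbv zeta. set (P := ((b + psi) / sin psi)%R).
    assert (HP : (N <= P)%R).
    { apply (Rmult_le_reg_r (sin psi)); [exact S|].
      replace (P * sin psi)%R with (b + psi)%R by (unfold P; field; lra).
      apply (Rmult_le_compat_l N) in H2; [|unfold N; lra].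
      replace (N * (b / N))%R with b in H2 by (field; unfold N; lra).
      assert (N * sin psi <= N * psi)%R by (apply Rmult_le_compat_l; unfold N in *; lra). lra. }
    set (y := (P / 2 - 1)%R). assert (Hy : (8 / R <= y)%R) by (unfold y, N in *; lra).
    assert (RY : (8 <= R * y)%R).
    { apply (Rmult_le_compat_l R) in Hy; [|lra]. replace (R * (8 / R))%R with 8%R in Hy by (field; lra). exact Hy. }
    assert (Y0 : 0 < y) by lra.
    assert (E1 : exp (1 - P * cos psi) <= exp (- y)) by (apply exp_mono; unfold y, N in *; nra).
    assert (E2 := exp_opp_mult y). assert (E3 := exp_ge_quad y ltac:(lra)). assert (E4 := exp_pos (- y)).
    assert (E5 : (P < R * exp y)%R).
    { apply (Rlt_le_trans _ (R * (1 + y + y * y / 4))); [|apply Rmult_le_compat_l; lra].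
      unfold y in *; nra. }
    apply (Rle_lt_trans _ (P * exp (- y))); [apply Rmult_le_compat_l; unfold N in *; lra|].
    replace R with (R * exp y * exp (- y))%R by (rewrite Rmult_assoc, (Rmult_comm (exp y)), E2; ring).
    now apply Rmult_lt_compat_r.
  - set (r := (/ R)%R). assert (Hr : 0 < r) by (apply Rinv_0_lt_compat; lra).
    assert (Er : (r * R = 1)%R) by (unfold r; field; lra).
    assert (r < 1) by nra.
    (* the arithmetic mean of 1 and 1/R exceeds their geometric mean *)
    set (k := ((1 + r) / 2)%R). assert (Hk : 0 < k < 1) by (unfold k; lra).
    assert (Hkk : (1 < R * (k * k))%R).
    { replace (R * (k * k))%R with ((R * ((1 - r) * (1 - r)) + 4 * (r * R)) / 4)%R by (unfold k; field).
      rewrite Er. assert (0 < R * ((1 - r) * (1 - r)))%R by (apply Rmult_lt_0_compat; nra). lra. }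
    exists (acos k).
    assert (Ck : cos (acos k) = k) by (apply cos_acos; lra).
    assert (B := acos_bound_lt k ltac:(lra)). set (psi := acos k) in *.
    assert (Bp : psi < PI / 2).
    { apply Rnot_le_lt. intros NL. assert (cos psi <= 0)%R by (apply cos_le_0; lra). lra. }
    split; [lra|]. split; [now right|].
    assert (S : 0 < sin psi) by (apply sin_gt_0; lra).
    assert (S1 : sin psi < psi) by (apply sin_lt_x; lra).
    assert (T := sin_le_tangent 0 psi ltac:(lra) ltac:(lra)). rewrite sin_0, Ck in T.
    apply branch_gap_lt_0; [exact S|]. cbv zeta. rewrite Rplus_0_l, Ck.
    set (P := (psi / sin psi)%R). assert (EP : (P * sin psi = psi)%R) by (unfold P; field; lra).
    assert (P1 : 1 <= P) by nra. assert (Pk : (P * k <= 1)%R) by nra.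
    assert (E1 : exp (1 - P * k) <= exp (1 - k)) by (apply exp_mono; nra).
    assert (E2 := exp_opp_mult (k - 1)). assert (E3 := exp_ineq1_le (k - 1)).
    replace (- (k - 1))%R with (1 - k)%R in E2 by ring.
    assert (E4 := exp_pos (1 - k)). assert (E5 : (k * exp (1 - k) <= 1)%R) by nra.
    apply (Rle_lt_trans _ (P * exp (1 - k))); [apply Rmult_le_compat_l; lra|].
    apply (Rmult_lt_reg_r (k * k)); [nra|].
    apply (Rle_lt_trans _ (1 * 1)); [|lra].
    replace (P * exp (1 - k) * (k * k))%R with ((P * k) * (k * exp (1 - k)))%R by ring.
    apply Rmult_le_compat; nra.
Qed.

Lemma branch_exists R b : 0 < R -> 0 < b <= PI \/ (b = 0%R /\ 1 < R) ->
  exists psi, 0 < psi < PI /\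
  branch_point b psi * Cexp (branch_point b psi) = - polar R b / RtoC (exp 1).
Proof.
  intros HR Hb. assert (P := PI2_3_2).
  destruct (branch_gap_pos R b HR ltac:(lra)) as (p1 & H1 & H1' & G1).
  destruct (branch_gap_neg R b HR Hb) as (p0 & H0 & H0' & G0).
  destruct (Ranalysis5.IVT_interv (branch_gap R b) p0 p1) as (psi & Hpsi & G); [|lra|exact G0|exact G1|].
  - intros a Ha. assert (S : 0 < sin a) by (apply sin_gt_0; lra).
    apply continuity_pt_filterlim. apply (ex_derive_continuous (V := R_NormedModule)).
    unfold branch_gap. auto_derive. lra.
  - exists psi. split; [lra|]. apply branch_point_equation; [apply sin_gt_0; lra|exact G].
Qed.

(** The remaining case b = 0, R <= 1, in which w is real. *)
Lemma real_branch_exists r : 0 < r <= 1 -> exists x : R, x <= -1 /\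
  RtoC x * Cexp (RtoC x) = - polar r 0 / RtoC (exp 1).
Proof.
  intros HR. set (f := fun x => (- x * exp (1 + x))%R).
  assert (Cf : Ranalysis1.continuity f).
  { intros x. apply continuity_pt_filterlim. apply (ex_derive_continuous (V := R_NormedModule)).
    unfold f. auto_derive. exact I. }
  set (y := (4 / r)%R). assert (Hy : 0 < y) by (apply Rdiv_lt_0_compat; lra).
  assert (Ey : (r * y = 4)%R) by (unfold y; field; lra).
  assert (F1 : f (- (1))%R = 1%R).
  { unfold f. replace (1 + - (1))%R with 0%R by ring. rewrite exp_0. ring. }
  assert (F2 : f (- 1 - y)%R <= r).
  { unfold f. replace (1 + (- 1 - y))%R with (- y)%R by ring.
    assert (E := exp_ge_quad y ltac:(lra)).
    assert (E2 := exp_opp_mult y).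
    assert (E3 := exp_pos (- y)). replace (- (- 1 - y))%R with (1 + y)%R by ring.
    assert (L : (1 + y <= r * exp y)%R).
    { apply (Rle_trans _ (r * (1 + y + y * y / 4))); [|apply Rmult_le_compat_l; lra].
      replace (r * (1 + y + y * y / 4))%R with (r + r * y + (r * y) * y / 4)%R by field. rewrite Ey. lra. }
    replace r with (r * exp y * exp (- y))%R by (rewrite Rmult_assoc, (Rmult_comm (exp y)), E2; ring).
    apply Rmult_le_compat_r; lra. }
  destruct (IVT_gen f (- 1 - y) (- (1)) r Cf) as (x & Hx & Fx).
  { split; [eapply Rle_trans; [apply Rmin_l|exact F2]|].
    eapply Rle_trans; [|apply Rmax_r]. rewrite F1; lra. }
  exists x. split.
  - destruct Hx as [_ Hx]. rewrite Rmax_right in Hx by lra. lra.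
  - assert (Pe := exp_pos 1). unfold f in Fx. rewrite exp_plus in Fx.
    unfold polar. rewrite cos_0, sin_0.
    apply C_ext; unfold Cexp, Re, Im; simpl; rewrite cos_0, sin_0.
    + apply (Rmult_eq_reg_r (exp 1)); [|lra]. rewrite <- Fx. field; lra.
    + field; lra.
Qed.

Lemma cot_decreasing b psi : 0 <= b -> 0 < psi -> b + psi < PI ->
  (cos (b + psi) / sin (b + psi) <= cos psi / sin psi)%R /\
  (0 < b -> cos (b + psi) / sin (b + psi) < cos psi / sin psi)%R.
Proof.
  intros Hb Hp H.
  assert (S1 : 0 < sin psi) by (apply sin_gt_0; lra).
  assert (S2 : 0 < sin (b + psi)) by (apply sin_gt_0; lra).
  assert (E : (cos psi / sin psi - cos (b + psi) / sin (b + psi) = sin b / (sin psi * sin (b + psi)))%R).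
  { replace (sin b) with (sin (b + psi - psi)) by (f_equal; ring). rewrite sin_minus. field. lra. }
  assert (D : 0 < sin psi * sin (b + psi)) by (apply Rmult_lt_0_compat; assumption).
  split.
  - assert (0 <= sin b / (sin psi * sin (b + psi)))%R; [|lra].
    apply Rdiv_le_0_compat; [apply sin_ge_0; lra|exact D].
  - intros Hb'. assert (0 < sin b / (sin psi * sin (b + psi)))%R; [|lra].
    apply Rdiv_lt_0_compat; [apply sin_gt_0; lra|exact D].
Qed.

Lemma range_1_branch_point b psi : 0 < b < PI -> 0 < psi < PI -> lambertW_range 1 (branch_point b psi).
Proof.
  intros Hb Hp. simpl. unfold above_curve. change (Pos.to_nat 1) with 1%nat. simpl Init.Nat.pred. simpl INR.
  change (Im (branch_point b psi)) with (b + psi)%R.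
  change (Re (branch_point b psi)) with (- ((b + psi) * (cos psi / sin psi)))%R.
  assert (P := PI_RGT_0). split.
  - destruct (Rle_lt_dec PI (b + psi)) as [L|L]; [left; lra|right].
    split; [lra|]. unfold curve_abscissa.
    destruct (cot_decreasing b psi) as [_ K]; try lra. specialize (K ltac:(lra)). nra.
  - intros [L|[L _]]; lra.
Qed.

Lemma range_minus1_branch_point b psi : 0 <= b <= PI -> 0 < psi < PI -> lambertW_range (-1) (Cconj (branch_point b psi)).
Proof.
  intros Hb Hp. simpl. unfold on_or_below_conj_curve. change (Pos.to_nat 1) with 1%nat. simpl Init.Nat.pred. simpl INR.
  change (Im (Cconj (branch_point b psi))) with (- (b + psi))%R.
  change (Re (Cconj (branch_point b psi))) with (- ((b + psi) * (cos psi / sin psi)))%R.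
  rewrite curve_abscissa_opp.
  assert (P := PI_RGT_0). split.
  - destruct (Rle_lt_dec PI (b + psi)) as [L|L]; [left; lra|right; left].
    split; [lra|]. unfold curve_abscissa.
    destruct (cot_decreasing b psi) as [K _]; try lra. nra.
  - intros [L|[[L _]|[L _]]]; try lra. discriminate L.
Qed.

Lemma range_minus1_real (x : R) : x <= -1 -> lambertW_range (-1) (RtoC x).
Proof.
  intros Hx. simpl. unfold on_or_below_conj_curve. change (Pos.to_nat 1) with 1%nat. simpl Init.Nat.pred. simpl INR.
  change (Im (RtoC x)) with 0%R. change (Re (RtoC x)) with x.
  assert (P := PI_RGT_0). split.
  - right; right. repeat split; assumption.
  - intros [L|[[L _]|[L _]]]; try lra. discriminate L.
Qed.

Lemma lambertW_spec k z : (exists w, w * Cexp w = z /\ lambertW_range k w) ->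
  lambertW k z * Cexp (lambertW k z) = z /\ lambertW_range k (lambertW k z).
Proof. exact (epsilon_spec (inhabits (RtoC 0)) (fun w => w * Cexp w = z /\ lambertW_range k w)). Qed.

Lemma Cexp_conj w : Cexp (Cconj w) = Cconj (Cexp w).
Proof.
  unfold Cexp, Cconj. simpl. rewrite cos_neg, sin_neg. apply C_ext; simpl; unfold Re, Im; simpl; ring.
Qed.

Lemma polar_Carg (L : C) : L <> 0 -> L = polar (Cmod L) (Carg L).
Proof.
  intros N. assert (M := proj1 (Cmod_gt_0 L) N). unfold polar.
  rewrite cos_Carg, sin_Carg by exact N. apply C_ext; unfold Re, Im; simpl; field; lra.
Qed.

Lemma lambertW_1_region (L : C) : 0 < Im L ->
  (Re (lambertW 1 (- L / RtoC (exp 1))) > -1)%R <-> conv_region (Cmod L) (acos (Re L / Cmod L)).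
Proof.
  intros HI. assert (NL : L <> 0) by (intros E; rewrite E in HI; simpl in HI; lra).
  assert (M := proj1 (Cmod_gt_0 L) NL). assert (B := Carg_upper_bound L HI).
  rewrite <- Carg_upper by lra. rewrite (polar_Carg L NL) at 1. set (R := Cmod L) in *. set (b := Carg L) in *.
  destruct (lambertW_spec 1 (- polar R b / RtoC (exp 1))) as [E Rg].
  { destruct (branch_exists R b M ltac:(lra)) as (psi & Hpsi & E).
    exists (branch_point b psi). split; [exact E|]. now apply range_1_branch_point. }
  set (w := lambertW 1 (- polar R b / RtoC (exp 1))) in *.
  apply range_1_arg in Rg. destruct Rg as [I Ha].
  destruct (lambert_log_form w R b M E) as (N & A1 & A2).
  { apply Rabs_def1; lra. }
  apply (lambert_solution_region w R b); try assumption; try lra.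
Qed.

Lemma lambertW_minus1_region (L : C) : L <> 0 -> Im L <= 0 ->
  (Re (lambertW (-1) (- L / RtoC (exp 1))) > -1)%R <-> conv_region (Cmod L) (acos (Re L / Cmod L)).
Proof.
  intros NL HI. assert (M := proj1 (Cmod_gt_0 L) NL).
  assert (Pe := exp_pos 1).
  set (V := Cconj L).
  assert (HV : 0 <= Im V) by (unfold V, Im in *; simpl; lra).
  assert (NV : V <> 0).
  { intros E. apply NL. rewrite <- (Cconj_conj L). fold V. rewrite E. apply C_ext; simpl; ring. }
  assert (MV : Cmod V = Cmod L) by apply Cmod_conj.
  assert (EV : acos (Re L / Cmod L) = Carg V) by (rewrite Carg_upper by exact HV; rewrite MV; reflexivity).
  rewrite EV. assert (B := Carg_bound V). assert (B0 := acos_bound (Re L / Cmod L)). rewrite EV in B0.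
  assert (EL : - L / RtoC (exp 1) = Cconj (- polar (Cmod L) (Carg V) / RtoC (exp 1))).
  { assert (Q := polar_Carg V NV). rewrite MV in Q. rewrite <- Q. unfold V.
    apply C_ext; unfold Re, Im; simpl; field; lra. }
  rewrite EL. set (R := Cmod L) in *. set (b := Carg V) in *.
  destruct (lambertW_spec (-1) (Cconj (- polar R b / RtoC (exp 1)))) as [E Rg].
  { assert (D : (0 < b <= PI \/ (b = 0%R /\ 1 < R)) \/ (b = 0%R /\ R <= 1)) by lra.
    destruct D as [D|[Db DR]].
    - destruct (branch_exists R b M D) as (psi & Hpsi & E).
      exists (Cconj (branch_point b psi)). split; [|now apply range_minus1_branch_point].
      rewrite Cexp_conj, <- Cmult_conj, E. reflexivity.
    - destruct (real_branch_exists R ltac:(lra)) as (x & Hx & E).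
      exists (RtoC x). split; [|now apply range_minus1_real].
      rewrite Db, <- E, Cmult_conj, <- Cexp_conj.
      replace (Cconj (RtoC x)) with (RtoC x); [reflexivity|]. apply C_ext; simpl; ring. }
  set (w := lambertW (-1) (Cconj (- polar R b / RtoC (exp 1)))) in *.
  apply range_minus1_arg in Rg. cbv zeta in Rg. destruct Rg as (I & Ha & Hr).
  assert (E' : Cconj w * Cexp (Cconj w) = - polar R b / RtoC (exp 1)).
  { rewrite Cexp_conj, <- Cmult_conj, E. apply Cconj_conj. }
  destruct (lambert_log_form (Cconj w) R b M E') as (N & A1 & A2).
  { apply Rabs_def1; lra. }
  change (Re w) with (Re (Cconj w)).
  apply (lambert_solution_region (Cconj w) R b); try assumption; try lra.
Qed.

Theorem theorem8 :
  forall z : C,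
    domain_of_convergence z <->
    z <> RtoC 0 /\ z <> RtoC 1 /\
    (((- PI < Carg z <= 0)%R /\
      (Re (lambertW (-1)%Z (- Cln z / RtoC (exp 1))) > -1)%R) \/
     ((0 < Carg z <= PI)%R /\
      (Re (lambertW 1%Z (- Cln z / RtoC (exp 1))) > -1)%R)).
Proof.
  intros z. rewrite domain_of_convergence_region.
  split; intros (N0 & N1 & H); (split; [exact N0|]); (split; [exact N1|]);
    assert (B := Carg_bound z); assert (NL := Cln_neq_0 z N0 N1).
  - destruct (Rle_lt_dec (Carg z) 0) as [L|L].
    + left. split; [lra|]. now apply lambertW_minus1_region.
    + right. split; [lra|]. now apply lambertW_1_region.
  - destruct H as [[L H]|[L H]].
    + apply lambertW_minus1_region in H; [exact H|exact NL|apply L].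
    + apply lambertW_1_region in H; [exact H|apply L].
Qed.
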